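(* In the setting described in the context, let $p$ be a prime with $p>3|\mathcal{F}^w(\mathcal{T})|$, and let $\varsigma_1=\xi_1$, $\varsigma_i=\xi_{i-1}^{-1}\xi_i$ for $2\le i\le n+1$. Then the group $\Gamma=\langle\varsigma_1,\dots,\varsigma_{n+1}\rangle$ is the automorphism group of a chiral $(n+2)$-polytope $\mathcal{P}$ (with $\varsigma_1,\dots,\varsigma_{n+1}$ acting as the abstract rotations with respect to a base flag) whose facets are isomorphic to $\mathcal{T}$.
   Context: An abstract $d$-polytope is a ranked poset with minimum and maximum, all flags of size $d+2$, strongly flag-connected, satisfying the diamond condition; facets are its rank-$(d-1)$ faces. It is chiral if its automorphism group has two flag orbits with adjacent flags in distinct orbits; for a rotary polytope with base flag $\Psi$ the abstract rotations $\sigma_i$ are the automorphisms mapping $\Psi$ to $\Psi^{i,i-1}$. Let $n\ge2$, $k\in\{1,2,n\}$, and $a\ge 6n+1$ an integer. Let $\Lambda$ be $a\mathbb{Z}^n$ if $k=1$, $a\{x\in\mathbb{Z}^n:\sum x_i\text{ even}\}$ if $k=2$, $a\{x\in\mathbb{Z}^n:\text{all }x_i\text{ of equal parity}\}$ if $k=n$, and let $\mathcal{T}=\{4,3^{n-2},4\}_{(a^k,0^{n-k})}$ be the regular cubic toroid. Its flags are identified with triples $(\sigma,\mathbf{x},t)\in S_n\times\{\pm1\}^n\times(\mathbb{Z}^n/\Lambda)$, base flag $\Phi_0=(\mathrm{id},(1,\dots,1),0)$. Permutations act on the right on $\{1,\dots,n\}$ with $j(\sigma\tau)=(j\sigma)\tau$;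 $\mathbf{x}^{(i)}$ is $\mathbf{x}$ with $i$-th coordinate negated; $e_i$ standard basis vectors. Monodromy permutations (acting on the left): $r_0(\sigma,\mathbf{x},t)=(\sigma,\mathbf{x}^{(1\sigma)},t)$; $r_i(\sigma,\mathbf{x},t)=((i\ i{+}1)\sigma,\mathbf{x},t)$ for $1\le i\le n-1$; $r_n(\sigma,\mathbf{x},t)=(\sigma,\mathbf{x}^{(n\sigma)},t-x_{n\sigma}e_{n\sigma})$. The facet of $(\sigma,\mathbf{x},t)$ is identified with $t$. A flag is white iff $\mathrm{sgn}(\sigma)\prod_i x_i=1$; $\mathcal{F}^w(\mathcal{T})$ is the set of white flags. Let $v_0=(1,2,\dots,n)$, $h(\sigma,\mathbf{x},t)=(\sigma,\mathbf{x},t+(x_1(v_0)_{1\sigma^{-1}},\dots,x_n(v_0)_{n\sigma^{-1}}))$, $\bar h=r_0hr_0$. For $i\in\{0,\pm1,\pm2,\pm3\}$ let $\Phi_i=h^i\Phi_0$ and $F_i$ its facet. A flag $(\sigma,\mathbf{x},t)$ contains the vertex $X_H$ iff $t\equiv(0,-3,0,\dots,0)+(\delta_1,\dots,\delta_n)$ with $\delta_j=-1$ if $x_j=-1$ and $\delta_j=0$ otherwise; the facets incident to $X_H$ are $(0,-3,0,\dots,0)+\varepsilon$, $\varepsilon\in\{0,-1\}^n$. With $p$ as in the claim, $H=\{(F,1):F\text{ incident to }X_H\}$. For a facet $F$ and $\ell\in\mathbb{Z}_{3p}$ the root flag $\Phi_F$ (white, with facet $F$) is given by the first applicable rule: (1)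 if $F=F_i$, $i\in\{0,\pm1,\pm2,\pm3\}$, $\Phi_F=\Phi_i$; (2) if $\ell\not\equiv1\pmod3$ and $F$ is the facet of $\bar h^j\Phi$ for a white flag $\Phi$ with facet $F_0$ and $j\in\{\pm1,\pm2,\pm3\}$, $\Phi_F=\bar h^j\Phi$; (3) if $(F,\ell)\in H$, $\Phi_F$ is a fixed chosen white flag containing $F$ and $X_H$; (4) otherwise $\Phi_F=(\mathrm{id},(1,\dots,1),F)$. For $i\in\{0,1\}$ let $\rho_i^{(F,\ell)}$ be the unique permutation (written on the right) of the flags with facet $F$ commuting with $r_0,\dots,r_{n-1}$ and mapping $\Phi_F$ to $r_i\Phi_F$. Let $\rho^\ell\Phi=\Phi\rho_0^{(F,\ell)}$ if $(F,\ell)\notin H$, $\rho^\ell\Phi=\Phi\rho_1^{(F,\ell)}$ if $(F,\ell)\in H$ ($F$ the facet of $\Phi$). On $\mathcal{F}^w(\mathcal{T})\times\mathbb{Z}_{3p}$: $\xi_i(\Phi,\ell)=(r_0r_i\Phi,\ell)$ for $1\le i\le n$; $\xi_{n+1}(\Phi,\ell)=(\rho^\ell r_0\Phi,\ell+1)$ if (facet of $\Phi$ is $F_1$, $\ell\equiv0$) or ($F_3$, $\ell\equiv1$) or ($F_0$, $\ell\equiv2$) mod 3; $=(\rho^\ell r_0\Phi,\ell-1)$ if ($F_0$, $\ell\equiv0$) or ($F_1$, $\ell\equiv1$) or ($F_3$, $\ell\equiv2$) mod 3; $=(\rho^\ell r_0\Phi,\ell)$ otherwise. *)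

(* Defs.v *)
From HB Require Import structures.
From mathcomp Require Import all_boot all_order all_algebra all_fingroup.

Set Implicit Arguments.
Unset Strict Implicit.
Unset Printing Implicit Defensive.

Import Order.TTheory GRing.Theory Num.Theory.
Import Quotient.Exports.

Local Open Scope ring_scope.

Section Polytope.
Variables (disp : Order.disp_t) (P : finTBPOrderType disp).
Implicit Types (C A B : {set P}) (F G : P).

Definition chain C : bool := [forall F in C, forall G in C, (F >=< G)%O].

Definition is_flag C : bool := maxset chain C.

(* The rank of F, plus one: the minimum has height 0 and rank -1. *)
Definition height F : nat :=
  \max_(C | chain C && [forall G in C, (G < F)%O]) #|C|.

Definition adjacent A B : bool :=
  [&& is_flag A, is_flag B & #|A :\: B| == 1%N].

Definition rank_adjacent (i : nat) A B : bool :=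
  adjacent A B && [forall F in A :\: B, height F == i.+1].

Definition strongly_flag_connected : Prop :=
  forall A B, is_flag A -> is_flag B ->
  connect [rel C C' | [&& adjacent C C', A :&: B \subset C
                        & A :&: B \subset C']] A B.

Definition diamond : Prop :=
  forall F G, (F < G)%O -> height G = (height F).+2 ->
  #|[set K : P | (F < K < G)%O]| = 2%N.

(* P is ranked as soon as all its maximal chains have the same size. *)
Definition abstract_polytope (d : nat) : Prop :=
  [/\ forall C, is_flag C -> #|C| = d.+2, strongly_flag_connected & diamond].

(* Automorphisms act on the right of faces, as permutations do in MathComp:
   s * t is s followed by t. *)
Definition polytope_aut : {set {perm P}} :=
  [set s : {perm P} | [forall F, forall G, (s F <= s G)%O == (F <= G)%O]].

Lemma polytope_aut_group_set : group_set polytope_aut.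
Proof.
apply/group_setP; split=> [|s t].
  by rewrite inE; apply/'forall_'forall_eqP => F G; rewrite !perm1.
rewrite !inE => /'forall_'forall_eqP hs /'forall_'forall_eqP ht.
by apply/'forall_'forall_eqP => F G; rewrite !permM ht hs.
Qed.
Canonical polytope_aut_group := Group polytope_aut_group_set.

Definition flag_orbit A : {set {set P}} :=
  [set (s : {perm P}) @: A | s in polytope_aut].

Definition chiral (d : nat) : Prop :=
  [/\ abstract_polytope d,
      #|[set flag_orbit A | A : {set P} & is_flag A]| = 2%N
    & forall A B, adjacent A B -> B \notin flag_orbit A].

(* The flag A^i, unique in a polytope when i is a proper rank. *)
Definition adj (i : nat) A : {set P} := odflt A [pick B | rank_adjacent i A B].

(* s maps the base flag A to A^{i,i-1} = (A^i)^{i-1}. *)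
Definition is_abstract_rotation A (i : nat) (s : {perm P}) : Prop :=
  s \in polytope_aut /\ s @: A = adj i.-1 (adj i A).

Definition is_facet (d : nat) F : Prop := height F = d.

(* The section {G | G <= F} is isomorphic to the poset Q. *)
Definition face_isomorphic (disp' : Order.disp_t) (Q : finPOrderType disp') F :
    Prop :=
  exists f : Q -> P, {mono f : x y / (x <= y)%O} /\
                     (forall G, (G <= F)%O <-> exists x, f x = G).

(* phi is an isomorphism from Gam, whose elements are written on the left of
   their arguments (so that the product of f and g in Gam is f \o g, which is
   g * f in MathComp), onto the automorphism group of P. *)
Definition isom_from_left (X : finType) (Gam : {set {perm X}})
    (phi : {perm X} -> {perm P}) : Prop :=
  [/\ {in Gam &, forall f g, phi (g * f)%g = (phi f * phi g)%g},
      {in Gam &, injective phi} & phi @: Gam = polytope_aut].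

End Polytope.

Section Lattice.
Variables (n k a : nat).

(* Lambda / a, for k = 1, k = 2 and k = n respectively; for n = k = 2 the last
   two coincide. *)
Definition unit_lattice : {pred 'rV[int]_n} := fun y =>
  if k == 1%N then true
  else if k == 2%N then (2 %| (\sum_i y 0 i)%R)%Z
  else [forall i, forall j, (2 %| (y 0 i - y 0 j)%R)%Z].

Definition lattice : {pred 'rV[int]_n} := fun x =>
  [forall i, (a %| (x 0 i)%R)%Z] && unit_lattice (\row_i ((x 0 i)%R %/ a)%Z).

Lemma lattice_zmod_closed : zmod_closed lattice.
Proof.
split=> [|x y]; rewrite /lattice !unfold_in.
  apply/andP; split; first by apply/forallP => i; rewrite mxE dvdz0.
  rewrite /unit_lattice; case: ifP => // _; case: ifP => _.
    by rewrite big1 ?dvdz0 // => i _; rewrite !mxE div0z.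
  by apply/forallP => i; apply/forallP => j; rewrite !mxE div0z subrr dvdz0.
move=> /andP[/forallP dx ux] /andP[/forallP dy uy]; apply/andP; split.
  by apply/forallP => i; rewrite !mxE rpredB.
have E i : divz ((x - y) 0 i) a = divz (x 0 i) a - divz (y 0 i) a.
  have /dvdzP[b xb] := dx i; have /dvdzP[c yc] := dy i.
  rewrite !mxE xb yc -mulrBl; case: (eqVneq (a : int) 0) => [->|a0].
    by rewrite !divz0 subrr.
  by rewrite !mulzK.
move: ux uy; rewrite /unit_lattice; case: ifP => // _; case: ifP => _.
  move=> ux uy; have := rpredB ux uy; rewrite -sumrB.
  set S := \sum_i _; set S' := \sum_i _; suff -> : S = S' by [].
  by apply: eq_bigr => i _; rewrite ![(\row__ _) _ _]mxE E.
move=> /forallP ux /forallP uy; apply/forallP => i; apply/forallP => j.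
have := rpredB (forallP (ux i) j) (forallP (uy i) j).
by rewrite ![(\row__ _) _ _]mxE !E !opprD !opprK addrACA.
Qed.

HB.instance Definition _ := GRing.isZmodClosed.Build _ lattice lattice_zmod_closed.

End Lattice.

Section Torus.
Variables (n k a : nat).

(* The bound on a is only used to know that the torus is finite. *)
Definition torus of (6 * n + 1 <= a)%N : Type :=
  Quotient.quot (@lattice n k a).

Hypothesis ha : (6 * n + 1 <= a)%N.
Local Notation Tor := (torus ha).

HB.instance Definition _ := GRing.Zmodule.on Tor.
HB.instance Definition _ := Choice_isCountable.Build Tor (pcan_pickleK
  (can_pcan (@reprK _ (Quotient.quot (@lattice n k a))))).

Definition torus_class (v : 'rV[int]_n) : Tor :=
  (\pi_(Quotient.quot (@lattice n k a)) v)%qT.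

Lemma torus_class_bounded (t : Tor) :
  exists v : {ffun 'I_n -> 'I_(a + a)}, t = torus_class (\row_j (v j : nat)%:Z).
Proof.
have a0 : (0 < a + a)%N by rewrite addn_gt0 (leq_trans _ ha) // addn1.
have A0 : (a + a)%N%:Z != 0 by rewrite eqz_nat -lt0n.
elim/quotW: t => v.
exists [ffun j => Ordinal (ltn_pmod `|modz (v 0 j) (a + a)%N| a0)].
apply/eqP; rewrite /torus_class -Quotient.idealrBE unfold_in /=.
have E j : (v - \row_j ([ffun j => Ordinal
      (ltn_pmod `|modz (v 0 j) (a + a)%N| a0)] j : nat)%:Z) 0 j =
    2 * divz (v 0 j) (a + a)%N * a.
  rewrite !mxE ffunE /= modn_small; last first.
    by rewrite -ltz_nat gez0_abs ?modz_ge0 // ltz_pmod // ltz_nat.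
  rewrite gez0_abs ?modz_ge0 // {1}[v 0 j](divz_eq _ (a + a)%N) addrK.
  by rewrite PoszD mulrDr -mulr2n mulr_natl mulrnAl.
have a1 : a%:Z != 0 by rewrite eqz_nat -lt0n (leq_trans _ ha) // addn1.
apply/andP; split.
  by apply/forallP => j; rewrite E dvdz_mull.
rewrite /unit_lattice; case: ifP => // _; case: ifP => _.
  by apply: rpred_sum => j _; rewrite mxE E mulzK // dvdz_mulr.
by apply/forallP => i; apply/forallP => j; rewrite ![(\row__ _) _ _]mxE !E
  !mulzK // rpredB // dvdz_mulr.
Qed.

Definition torus_enum : seq Tor :=
  undup [seq torus_class (\row_j (v j : nat)%:Z)
        | v : {ffun 'I_n -> 'I_(a + a)}].

Lemma torus_enumP : Finite.axiom torus_enum.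
Proof.
apply: Finite.uniq_enumP; first exact: undup_uniq.
move=> t; rewrite mem_undup; apply/mapP.
by have [v ->] := torus_class_bounded t; exists v; rewrite ?mem_enum.
Qed.

HB.instance Definition _ := isFinite.Build Tor torus_enumP.

End Torus.

Arguments torus_class {n k a ha} v.

Definition indicator (n : nat) (E : {set 'I_n}) : 'rV[int]_n :=
  \row_j (j \in E)%:R.

(* Cell D u is the image in the torus of the face u + [0,1]^D of the
   tessellation of R^n by unit cubes, that is, of the points x with x_j - u_j in
   [0,1] for j in D and x_j = u_j otherwise. A vertex has D = set0; a facet has
   D = setT and is determined by u. The flag of the toroid encoded by a triple
   (s, x, t) consists, besides the minimum and the maximum, of the cells
   Cell D_i (t + indicator {j | x_j = -1 and j notin D_i}), i = 0, ..., n, where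
   D_i is the set of the images under s of the first i indices. *)
Inductive toroid (n k a : nat) (ha : (6 * n + 1 <= a)%N) : Type :=
  | Bottom
  | Cell of {set 'I_n} & torus k ha
  | Top.

Section Toroid.
Variables (n k a : nat) (ha : (6 * n + 1 <= a)%N).
Local Notation T := (toroid k ha).

Definition toroid_encode (A : T) : option (option ({set 'I_n} * torus k ha)) :=
  match A with
  | Bottom => None
  | Cell D u => Some (Some (D, u))
  | Top => Some None
  end.

Definition toroid_decode c : T :=
  match c with
  | None => Bottom _ _
  | Some None => Top _ _
  | Some (Some (D, u)) => Cell D u
  end.

Lemma toroid_encodeK : cancel toroid_encode toroid_decode.
Proof. by case. Qed.

HB.instance Definition _ := Finite.copy T (can_type toroid_encodeK).

(* The cell (D, u) is a face of some lift of (D', u') iff its base point is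
   obtained from u' by moving one step along some of the directions in
   D' :\: D. *)
Definition toroid_le : rel T := fun A B =>
  match A, B with
  | Bottom, _ => true
  | _, Top => true
  | Cell D u, Cell D' u' => (D \subset D') &&
      [exists E : {set 'I_n},
         (E \subset D' :\: D) && (u == u' + torus_class (indicator E))]
  | _, _ => false
  end.

Lemma torus_class0 : torus_class (indicator set0) = 0 :> torus k ha.
Proof.
rewrite /torus_class (_ : indicator _ = 0) ?raddf0 //.
by apply/rowP => j; rewrite !mxE inE.
Qed.

Lemma torus_classU (E E' : {set 'I_n}) : [disjoint E & E'] ->
  torus_class (indicator (E :|: E')) =
    torus_class (indicator E) + torus_class (indicator E') :> torus k ha.
Proof.
move=> dE; rewrite /torus_class -raddfD; congr (\pi_(_) _)%qT.
apply/rowP => j; rewrite !mxE inE; case: (boolP (j \in E)) => /= jE.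
  by rewrite (disjointFr dE jE) addr0.
by rewrite add0r.
Qed.

Lemma toroid_le_refl : reflexive toroid_le.
Proof.
case=> //= D u; rewrite subxx; apply/existsP; exists set0.
by rewrite sub0set torus_class0 addr0 eqxx.
Qed.

Lemma toroid_le_anti : antisymmetric toroid_le.
Proof.
case=> [|D u|] [|D' u'|] //= /andP[/andP[DD' /existsP[E /andP[sE /eqP ->]]]].
case/andP=> D'D _; have eD : D = D' by apply/eqP; rewrite eqEsubset DD'.
rewrite {}eD setDv subset0 in sE *; rewrite (eqP sE).
by rewrite torus_class0 addr0.
Qed.

Lemma toroid_le_trans : transitive toroid_le.
Proof.
case=> [|D' u'|] [|D u|] [|D'' u''|] //=.
case/andP=> DD' /existsP[E /andP[sE /eqP ->]].
case/andP=> D'D'' /existsP[E' /andP[sE' /eqP ->]].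
rewrite (subset_trans DD') //=; apply/existsP; exists (E' :|: E).
rewrite torus_classU ?addrA ?eqxx ?andbT; last first.
  rewrite disjoint_sym; apply: disjointWl sE _; apply: disjointWr sE' _.
  by rewrite -setI_eq0; apply/eqP/setP => j; rewrite !inE; case: (j \in D');
     rewrite ?andbF.
rewrite subUset (subset_trans sE') ?setDS //=.
by rewrite (subset_trans sE) ?setSD.
Qed.

Fact toroid_display : Order.disp_t. Proof. exact: Order.Disp tt tt. Qed.

HB.instance Definition _ := Order.Le_isPOrder.Build toroid_display T
  toroid_le_refl toroid_le_anti toroid_le_trans.

End Toroid.

(* Signs are booleans, true standing for -1 and false for 1. *)
Definition pm (b : bool) : int := (-1) ^+ b.

Definition perm_zpow (X : finType) (f : {perm X}) (i : int) : {perm X} :=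
  match i with
  | Posz m => (f ^+ m)%g
  | Negz m => (f ^- m.+1)%g
  end.

Section Flags.
Variables (n k a : nat) (hn : (1 < n)%N) (ha : (6 * n + 1 <= a)%N).

(* The index i of {1, ..., n}; ordinals start from 0. *)
Definition idx (i : nat) : 'I_n := insubd (Ordinal (ltnW hn)) i.-1.

Definition e_ (i : 'I_n) : 'rV[int]_n := delta_mx 0 i.

Definition flag : finType := ('S_n * {ffun 'I_n -> bool} * torus k ha)%type.

(* The facet of a flag is given by its base point. *)
Definition facet (Phi : flag) : torus k ha := Phi.2.

Definition flip (x : {ffun 'I_n -> bool}) (i : 'I_n) : {ffun 'I_n -> bool} :=
  [ffun j => x j (+) (j == i)].

(* The monodromy permutations r_0, ..., r_n, acting on the left; in 'S_n the
   product s * t is s followed by t, as for permutations written on the right. *)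
Definition r (i : nat) (Phi : flag) : flag :=
  let: (s, x, t) := Phi in
  if i == 0%N then (s, flip x (s (idx 1)), t)
  else if (i < n)%N then ((tperm (idx i) (idx i.+1) * s)%g, x, t)
  else let j := s (idx n) in (s, flip x j, t - torus_class (pm (x j) *: e_ j)).

Definition white (Phi : flag) : bool :=
  let: (s, x, _) := Phi in (-1) ^+ s * \prod_i pm (x i) == 1 :> int.

Definition white_flag : finType := {Phi : flag | white Phi}.

Definition base_flag : flag := (1%g, [ffun=> false], 0).

(* v_0 = (1, 2, ..., n), with coordinates indexed from 0. *)
Definition v0 (j : 'I_n) : int := j.+1.

Definition h_shift (s : 'S_n) (x : {ffun 'I_n -> bool}) : 'rV[int]_n :=
  \row_i (pm (x i) * v0 (s^-1%g i)).

Definition h_fun (Phi : flag) : flag :=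
  let: (s, x, t) := Phi in (s, x, t + torus_class (h_shift s x)).

Lemma h_fun_inj : injective h_fun.
Proof. by move=> [[s x] t] [[s' x'] t'] [<- <- /addIr <-]. Qed.

Definition h : {perm flag} := perm h_fun_inj.

Lemma r0K : involutive (r 0%N).
Proof.
move=> [[s x] t]; rewrite /r /=; congr (_, _, _); apply/ffunP => j.
by rewrite !ffunE addbK.
Qed.

Lemma hbar_inj : injective (fun Phi => r 0%N (h (r 0%N Phi))).
Proof. by move=> Phi Psi /(inv_inj r0K)/perm_inj/(inv_inj r0K). Qed.

Definition hbar : {perm flag} := perm hbar_inj.

Definition Phi_ (i : int) : flag := perm_zpow h i base_flag.
Definition F_ (i : int) : torus k ha := facet (Phi_ i).

Definition X_H : 'rV[int]_n := -3%:Z *: e_ (idx 2).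

Definition neg_part (x : {ffun 'I_n -> bool}) : 'rV[int]_n :=
  \row_j - (x j : nat)%:Z.

Definition contains_X_H (Phi : flag) : bool :=
  let: (_, x, t) := Phi in t == torus_class (X_H + neg_part x).

Definition facet_incident_X_H (F : torus k ha) : bool :=
  [exists eps : {ffun 'I_n -> bool}, F == torus_class (X_H + neg_part eps)].

Section Extension.
Variable p : nat.
Local Notation Z3p := 'Z_(3 * p)%N.

Definition in_H (F : torus k ha) (l : Z3p) : bool :=
  facet_incident_X_H F && (l == 1).

Definition root_rule1 (F : torus k ha) (Psi : flag) : Prop :=
  exists i : int, [/\ `|i| <= 3, F = F_ i & Psi = Phi_ i].

Definition root_rule2 (F : torus k ha) (l : Z3p) (Psi : flag) : Prop :=
  (l %% 3 != 1)%N /\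
  exists (Phi : flag) (j : int),
    [/\ white Phi, facet Phi = F_ 0, 0 < `|j| <= 3,
        F = facet (perm_zpow hbar j Phi) & Psi = perm_zpow hbar j Phi].

Definition root_rule3 (F : torus k ha) (l : Z3p) (Psi : flag) : Prop :=
  in_H F l /\ [/\ white Psi, facet Psi = F & contains_X_H Psi].

Definition root_rule4 (F : torus k ha) (Psi : flag) : Prop :=
  Psi = (1%g, [ffun=> false], F).

(* The second rule may leave two choices (for n even, Psi and its image under
   the central inversion of its facet) and the third one several; any choice is
   allowed. *)
Definition is_root_choice (root : torus k ha -> Z3p -> flag) : Prop :=
  forall F l,
  let applies1 := exists Psi, root_rule1 F Psi in
  let applies2 := exists Psi, root_rule2 F l Psi in
  let applies3 := in_H F l in
  [\/ root_rule1 F (root F l),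
      ~ applies1 /\ root_rule2 F l (root F l),
      [/\ ~ applies1, ~ applies2 & root_rule3 F l (root F l)]
    | [/\ ~ applies1, ~ applies2, ~ applies3 & root_rule4 F (root F l)]].

Variable root : torus k ha -> Z3p -> flag.

(* Permutations of the flags with facet F are extended by the identity. *)
Definition is_rho (i : nat) (F : torus k ha) (l : Z3p) (s : {perm flag}) : bool :=
  [&& perm_on [set Phi | facet Phi == F] s,
      [forall j : 'I_n, forall Phi,
         (facet Phi == F) ==> (s (r j Phi) == r j (s Phi))]
    & s (root F l) == r i (root F l)].

Definition rho (i : nat) (F : torus k ha) (l : Z3p) : {perm flag} :=
  odflt 1%g [pick s | is_rho i F l s].

Definition rho_level (l : Z3p) (Phi : flag) : flag :=
  let F := facet Phi in rho (if in_H F l then 1%N else 0%N) F l Phi.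

Definition next_level (F : torus k ha) (l : Z3p) : Z3p :=
  let m := (l %% 3)%N in
  if [|| (F == F_ 1) && (m == 0%N), (F == F_ 3) && (m == 1%N)
       | (F == F_ 0) && (m == 2%N)] then l + 1
  else if [|| (F == F_ 0) && (m == 0%N), (F == F_ 1) && (m == 1%N)
            | (F == F_ 3) && (m == 2%N)] then l - 1
  else l.

Definition ext_flag : finType := (white_flag * Z3p)%type.

(* The values of xi outside of 1, ..., n.+1 are irrelevant. *)
Definition is_xi (xi : nat -> {perm ext_flag}) : Prop :=
  (forall i (w : ext_flag), (1 <= i <= n)%N ->
     val (xi i w).1 = r 0%N (r i (val w.1)) /\ (xi i w).2 = w.2) /\
  (forall w : ext_flag,
     val (xi n.+1 w).1 = rho_level w.2 (r 0%N (val w.1)) /\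
     (xi n.+1 w).2 = next_level (facet (val w.1)) w.2).

(* xi_{i-1}^{-1} xi_i is xi_i followed by xi_{i-1}^{-1}, since these
   permutations act on the left. *)
Definition varsigma (xi : nat -> {perm ext_flag}) (i : nat) : {perm ext_flag} :=
  if i == 1%N then xi 1%N else (xi i * (xi i.-1)^-1)%g.

Definition Gamma (xi : nat -> {perm ext_flag}) : {group {perm ext_flag}} :=
  <<[set varsigma xi i.+1 | i : 'I_n.+1]>>%G.

End Extension.
End Flags.

(* Main.v *)
(* The polytope has as flags the pairs (g, b) with g in Gamma and b a colour, the
   i-adjacent flags of (g, 0) and (g, 1) being (g xi_i, 1) and (g xi_i^-1, 0), where
   xi_0 = 1; its faces of rank i are the classes of flags linked by adjacencies of
   ranks other than i. Such classes form a polytope as soon as the adjacencies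
   commute at distance at least 2 and the classes of two sets of ranks I and J meet
   in the classes of the intersection of I and J.

   For ranks up to n this property holds in the toroid, whose faces are explicit
   cells, and it lifts because the monodromy group of the toroid acts freely. What
   remains is to show that a monodromy w of the toroid that is also a word in the
   adjacencies of ranks j, ..., n+1 fixes the faces of ranks below j. For j = 1,
   evaluate w at a flag containing X_H at level 1, around which every rho fixes X_H.
   For j > 1, w thus fixes vertices, and evaluating it at a flag whose facet has
   first coordinate 2 at level 0, where every rho met only changes signs, shows
   that it also fixes the first j - 1 directions and coordinates.

   For the chirality, a reflection would invert every xi_i, hence exchange h and
   hbar, so that h xi h^-3 xi h^2 xi and hbar xi hbar^-3 xi hbar^2 xi, with
   xi = xi_{n+1}, would have the same order. The first word raises the level of Phi_1
   by 3, so p divides its order. An orbit of the second one either crosses between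
   blocks of three levels, and then has length dividing 6, or stays in a block, and
   then has length at most three times the number of white flags. *)

Require Import Defs.
From HB Require Import structures.
From mathcomp Require Import all_boot all_order all_algebra all_fingroup.
From mathcomp Require Import zify ring.

Set Implicit Arguments.
Unset Strict Implicit.
Unset Printing Implicit Defensive.

Import Order.TTheory GRing.Theory Num.Theory.
Import Quotient.Exports.

(** Whenever the first direction of the root flag of a facet is also that of the flag at hand, and
    the facet is not in [H], rho undoes [r_0], and a turn by [xi_{n+1}] changes at most the level.
    Along the shifts of [Phi_1] this is root rule 1; the exponents 2, -3, 1 make the turns fall over
    [F_1], [F_3], [F_0] exactly when these raise the level. For the black flags over [F_0] it is
    rule 2, at levels 0 and 2 modulo 3, but over [F_0] itself it may fail; apart from one
    exceptional orientation, only that passage changes the level, and the next round changes it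
    back.

    The levels change over three facets only, of first coordinates 0, 1 and 3. Facets of first
    coordinate 2, and those around [X_H], differ from them, which leaves room for words that act
    within one level.

    The bound on [a]: a shift by at most 3 times a signed permutation of [v0] has coordinates at
    most [3 * n] in absolute value, so that two of them that agree in the torus agree over the
    integers.

    Instead of computing orders, the proof uses the single exponent [(p - 1)!], which is a period of
    all black orbits, as these are shorter than [p], and is prime to [p] by Wilson's theorem. *)

(** * Words in involutions and the intersection property *)

Section Linked.
Variables (X : finType) (d : nat) (s : nat -> X -> X).
Implicit Types (I J : pred nat) (x y z : X).

(** The bound [d] is kept apart from [I] so that the same involutions serve for the facets, which
    have one generator fewer. *)
Definition link I : rel X := [rel x y | [exists i : 'I_d, I i && (y == s i x)]].
Definition linked I : rel X := connect (link I).

Lemma linked_refl I x : linked I x x.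
Proof. exact: connect0. Qed.

Lemma linked_trans I : transitive (linked I).
Proof. exact: connect_trans. Qed.

Lemma linked_step I x i : i < d -> I i -> linked I x (s i x).
Proof.
by move=> id Ii; apply: connect1; apply/existsP; exists (Ordinal id);
  rewrite /= Ii /=.
Qed.

Lemma linkedP I x y :
  reflect (exists2 w, all (fun i => (i < d) && I i) w & y = foldr s x w)
          (linked I x y).
Proof.
apply: (iffP idP) => [/connectP[q + ->]|[w + ->]].
  elim/last_ind: q => [|q z IH] /=; first by exists [::].
  rewrite rcons_path last_rcons => /andP[/IH[w aw ew]].
  move=> /existsP[i /andP[Ii /eqP ->]]; exists ((i : nat) :: w) => /=.
    by rewrite ltn_ord Ii.
  by rewrite ew.
elim: w => [|i w IH] /=; first by rewrite linked_refl.
case/andP=> /andP[id Ii] /IH xw; exact: linked_trans xw (linked_step _ id Ii).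
Qed.

Lemma linked_ind (P : X -> Prop) I x :
    P x -> (forall z i, i < d -> I i -> P z -> P (s i z)) ->
  forall y, linked I x y -> P y.
Proof.
move=> Px Ps y /linkedP[w aw ->]; elim: w aw => //= i w IH /andP[/andP[id Ii] aw].
by apply: Ps => //; apply: IH.
Qed.

Lemma linked_sub I J x y : (forall i, i < d -> I i -> J i) ->
  linked I x y -> linked J x y.
Proof.
move=> IJ; move: y; apply: (@linked_ind (linked J x)) => [|z i id Ii xz];
  first exact: linked_refl.
exact: linked_trans xz (linked_step _ id (IJ _ id Ii)).
Qed.

Hypothesis sK : forall i, involutive (s i).

Lemma linked_sym I : symmetric (linked I).
Proof.
suff L x y : linked I x y -> linked I y x by move=> x y; apply/idP/idP; apply: L.
move: y; apply: (@linked_ind (linked I ^~ x)) => [|z i id Ii zx];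
  first exact: linked_refl.
by apply: linked_trans zx; rewrite -{2}(sK i z) linked_step.
Qed.

Lemma link_csym I : connect_sym (link I).
Proof. exact: linked_sym. Qed.

(** A new [A]-letter commutes back through the [B]-letters already read, so that the word can be
    sorted. *)
Lemma linked_split (A B I : pred nat) x y :
    (forall i j z, i < d -> j < d -> A i -> B j -> s i (s j z) = s j (s i z)) ->
    (forall i, i < d -> I i -> A i || B i) ->
  linked I x y -> exists2 z, linked A x z & linked B z y.
Proof.
move=> C AB; move: y.
apply: (@linked_ind (fun y => exists2 z, linked A x z & linked B z y)) =>
  [|y i id /(AB _ id) + [z xz]].
  by exists x; apply: linked_refl.
case/orP=> [Ai|Bi] zy; last first.
  by exists z => //; exact: linked_trans zy (linked_step _ id Bi).
exists (s i z); first exact: linked_trans xz (linked_step _ id Ai).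
move: y zy; apply: (@linked_ind (fun y => linked B (s i z) (s i y)));
  first exact: linked_refl.
move=> u j jd Bj zu; by rewrite C //; apply: linked_trans zu (linked_step _ _ _).
Qed.

End Linked.

Lemma linkedW (X : finType) m (s : nat -> X -> X) (I : pred nat) x y :
  linked m s I x y -> linked m.+1 s I x y.
Proof.
move: y; apply: (@linked_ind _ _ _ (linked m.+1 s I x)) => [|z i im Ii xz].
  exact: linked_refl.
exact: linked_trans xz (linked_step _ _ (leqW im) Ii).
Qed.

Lemma linked_strip (X : finType) m (s : nat -> X -> X) (I : pred nat) x y :
  ~~ I m -> linked m.+1 s I x y -> linked m s I x y.
Proof.
move=> nIm; move: y; apply: (@linked_ind _ _ _ (linked m s I x)) => [|z i im Ii xz].
  exact: linked_refl.
apply: linked_trans xz (linked_step _ _ _ Ii).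
by rewrite ltn_neqAle -ltnS im andbT; apply: contraNneq nIm => <-.
Qed.

(* Given the intersection property of the facets, only the intersections of a
   facet with the sections above its faces are to be checked: if [j, m] is the
   last maximal run of I, a word of type I splits into commuting words of types
   I /\ [0, j - 2] and [j, m]. *)
Lemma linked_inter (X : finType) (m : nat) (s : nat -> X -> X) :
    (forall i, involutive (s i)) ->
    (forall i j x, i.+1 < j <= m -> s i (s j x) = s j (s i x)) ->
    (forall I J x y, linked m s I x y -> linked m s J x y ->
       linked m s (predI I J) x y) ->
    (forall j x y, j <= m -> linked m s predT x y -> linked m.+1 s (leq j) x y ->
       linked m s (leq j) x y) ->
  forall I J x y, linked m.+1 s I x y -> linked m.+1 s J x y ->
    linked m.+1 s (predI I J) x y.
Proof.
move=> sK sC IPm Hj.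
have up := @linkedW X m s; have down := @linked_strip X m s.
have run (I : pred nat) : I m -> exists2 j, j <= m /\ (forall i, j <= i <= m -> I i) &
    forall x y, linked m.+1 s I x y -> exists2 z,
      linked m s (fun i => I i && (i.+1 < j)) x z & linked m.+1 s (leq j) z y.
  move=> Im; pose Q j := [forall i : 'I_m.+1, (j <= i) ==> I i].
  have exQ : exists j, Q j.
    by exists m; apply/forallP => i; apply/implyP => mi;
       rewrite (_ : nat_of_ord i = m) //; apply/eqP; rewrite eqn_leq mi -ltnS ltn_ord.
  have Qm : Q m.
    by apply/forallP => i; apply/implyP => mi;
       rewrite (_ : nat_of_ord i = m) //; apply/eqP; rewrite eqn_leq mi -ltnS ltn_ord.
  case: (ex_minnP exQ) => j Qj minj; exists j.
    split; first exact: minj.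
    move=> i /andP[ji im].
    by move/forallP/(_ (Ordinal (im : i < m.+1)))/implyP: Qj; apply.
  move=> x y; have jm := minj _ Qm.
  have notI : forall i, i.+1 = j -> ~~ I i.
    move=> i ij; apply/negP => Ii; have: Q i.
      apply/forallP => k; rewrite leq_eqVlt; apply/implyP => /orP[/eqP <- //|].
      by rewrite ij => jk; move/forallP/(_ k)/implyP: Qj; apply.
    by move/minj; rewrite -ij ltnn.
  have H : forall i, i < m.+1 -> I i -> (I i && (i.+1 < j)) || (j <= i).
    move=> i _ Ii; rewrite Ii /=; case: (ltngtP i.+1 j) => //= ij.
    by have := notI _ ij; rewrite Ii.
  have C : forall i k z, i < m.+1 -> k < m.+1 -> I i && (i.+1 < j) -> j <= k ->
      s i (s k z) = s k (s i z).
    by move=> i k z _ km /andP[_ ij] jk; apply: sC; rewrite (leq_trans ij jk).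
  move=> /(linked_split (A := fun i => I i && (i.+1 < j)) (B := leq j) C H)[z xz zy].
  exists z => //; apply: down xz; rewrite negb_and -leqNgt.
  by rewrite (leq_trans jm) ?orbT.
(* Since [J] omits [m], [x] and [y] lie in one facet, and so does the middle flag [z]; then [Hj]
   replaces the run by a word of that facet. *)
have one (I J : pred nat) x y : ~~ J m -> linked m.+1 s I x y ->
  linked m.+1 s J x y ->
    linked m.+1 s (predI I J) x y.
  move=> nJ Ixy /(down _ _ _ nJ) Jxy; apply: up.
  have [Im|nIm] := boolP (I m); last exact: IPm (down _ _ _ nIm Ixy) Jxy.
  have [j [jm jI] /(_ _ _ Ixy)[z xz zy]] := run I Im.
  have zy' : linked m s (leq j) z y.
    apply: Hj => //; apply: linked_trans (linked_sub (J := predT) _ Jxy) => //.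
    by rewrite linked_sym //; apply: linked_sub xz.
  apply: IPm Jxy; apply: linked_trans (linked_sub _ xz) (linked_sub _ zy').
    by move=> i _ /andP[].
  by move=> i im ji; rewrite jI // ji ltnW.
move=> I J x y Ixy Jxy.
have [Im|nIm] := boolP (I m); last first.
  by apply: linked_sub (one J I x y nIm Jxy Ixy) => i _ /=; rewrite andbC.
have [Jm|nJm] := boolP (J m); last exact: one.
have [i [im iI] rI] := run I Im; have [j [jm jJ] rJ] := run J Jm.
(* With [i <= j] the run of [J] also lies in [I]; once it is removed, the rest of the [J]-word omits
   [m] and [one] applies. *)
wlog ij : I J i j x y im jm iI jJ rI rJ Im Jm Ixy Jxy / i <= j.
  move=> W; have [ij|ji] := leqP i j; first exact: (W I J i j).
  apply: (linked_sub (I := predI J I)) => [k _ /=|]; first by rewrite andbC.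
  exact: (W J I j i _ _ jm im jJ iI rJ rI Jm Im Jxy Ixy (ltnW ji)).
have [z xz zy] := rJ _ _ Jxy.
have yz : linked m.+1 s I y z.
  rewrite linked_sym //; apply: linked_sub zy => k km jk.
  by rewrite iI // (leq_trans ij jk) -ltnS.
have := one I (fun k => J k && (k.+1 < j)) x z; rewrite ltnNge (leqW jm) andbF.
move=> /(_ isT (linked_trans Ixy yz) (up _ _ _ xz)) xz'.
apply: linked_trans (linked_sub _ xz') (linked_sub _ zy).
  by move=> k _ /= /and3P[-> ->].
move=> k km jk /=; rewrite iI ?jJ //; first by rewrite jk.
by rewrite (leq_trans ij jk).
Qed.

(** * Polytopes from flag graphs with the intersection property *)

(** [fs_inter] is what distinguishes the flag graphs of polytopes among the connected graphs with
    such commuting involutions. *)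
Record flag_system := FlagSystem {
  fs_rank : nat;
  fs_flag :> finType;
  fs_adj : nat -> fs_flag -> fs_flag;
  fs_base : fs_flag;
  fs_adjK : forall i, involutive (fs_adj i);
  fs_adj_neq : forall i x, fs_adj i x != x;
  fs_adjC : forall i j x, i.+1 < j < fs_rank ->
    fs_adj i (fs_adj j x) = fs_adj j (fs_adj i x);
  fs_conn : forall x y, linked fs_rank fs_adj predT x y;
  fs_inter : forall I J x y, linked fs_rank fs_adj I x y ->
    linked fs_rank fs_adj J x y -> linked fs_rank fs_adj (predI I J) x y }.

(* The index of a face is its rank plus one; since no s_i has i.+1 = 0 or
   i.+1 = d.+1, the extreme indices give one face each. *)
Section Faces.
Variable S : flag_system.
Local Notation d := (fs_rank S).
Local Notation s := (@fs_adj S).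
Local Notation Linked := (linked d s).
Implicit Types (x y z : S).

Definition avoid (k : nat) : pred nat := fun i => i.+1 != k.

(** A class of flags is represented by its canonical root, which makes the faces a finite type. *)
Definition is_face (p : 'I_d.+2 * S) : bool := roots (link d s (avoid p.1)) p.2.

Definition face : Type := {p | is_face p}.

HB.instance Definition _ := Finite.copy face {p | is_face p}.

Lemma mk_face_proof (i : 'I_d.+2) x :
  is_face (i, fingraph.root (link d s (avoid i)) x).
Proof. apply: roots_root; exact/link_csym/fs_adjK. Qed.

Definition mk_face (i : 'I_d.+2) x : face :=
  exist (fun p => is_face p) _ (mk_face_proof i x).
Definition fidx (F : face) : 'I_d.+2 := (val F).1.

Lemma fidx_mk i x : fidx (mk_face i x) = i. Proof. by []. Qed.

Lemma mk_face_eq i j x y :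
  (mk_face i x == mk_face j y) = (i == j) && Linked (avoid i) x y.
Proof.
rewrite -val_eqE /= -pair_eqE /=; case: eqP => //= <-.
exact/root_connect/link_csym/fs_adjK.
Qed.

Lemma mk_faceP i x y : reflect (mk_face i x = mk_face i y) (Linked (avoid i) x y).
Proof. by apply: (iffP idP) => [xy|/eqP]; [apply/eqP|]; rewrite mk_face_eq eqxx. Qed.

Lemma face_mk (F : face) : exists x, F = mk_face (fidx F) x.
Proof.
case: F => [[i x] rx]; exists x; apply: val_inj; rewrite /= /fidx /=.
by rewrite (eqP rx).
Qed.

Lemma linked_fs_sym I x y : Linked I x y = Linked I y x.
Proof. exact/linked_sym/fs_adjK. Qed.

Lemma avoid_split j x y : Linked (avoid j) x y ->
  exists2 z, Linked (leq j) x z & Linked (fun i => i.+1 < j) z y.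
Proof.
apply: linked_split => [i k z id kd ji kj|i _].
  by rewrite [RHS]fs_adjC ?id ?andbT ?(leq_trans kj ji).
by rewrite /avoid neq_ltn orbC.
Qed.

Definition fle (F G : face) : bool := (fidx F <= fidx G) &&
  [exists z, (mk_face (fidx F) z == F) && (mk_face (fidx G) z == G)].

Lemma fleP F G : reflect (exists z (i j : 'I_d.+2),
    [/\ i <= j, F = mk_face i z & G = mk_face j z]) (fle F G).
Proof.
apply: (iffP andP) => [[ij /existsP[z /andP[/eqP zF /eqP zG]]]|].
  by exists z, (fidx F), (fidx G).
case=> z [i] [j] [ij -> ->]; rewrite !fidx_mk; split=> //.
by apply/existsP; exists z; rewrite !eqxx.
Qed.

Lemma fle_refl : reflexive fle.
Proof.
by move=> F; have [x ->] := face_mk F; apply/fleP; exists x, (fidx F), (fidx F).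
Qed.

Lemma fle_anti : antisymmetric fle.
Proof.
move=> F G /andP[/fleP[z [i] [j] [ij -> ->]] /andP[]]; rewrite !fidx_mk => ji _.
by have -> : i = j by apply/val_inj/eqP; rewrite eqn_leq ij.
Qed.

(** Two flags through [G] are linked by letters above [G], which preserve [F], followed by letters
    below [G], which preserve [K]; the flag in between contains all three faces. *)
Lemma fle_trans : transitive fle.
Proof.
move=> G F K /fleP[z [i] [j] [ij -> ->]] /fleP[z' [j'] [k] [jk /eqP + ->]].
rewrite mk_face_eq => /andP[/eqP ej]; rewrite -{j'}ej in jk *.
case/avoid_split => u zu uz'; apply/fleP; exists u, i, k.
split; first exact: leq_trans ij jk.
  apply/mk_faceP; apply: linked_sub zu => l _ jl.
  by rewrite /avoid neq_ltn ltnS (leq_trans ij jl) orbT.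
apply/mk_faceP; rewrite linked_fs_sym; apply: linked_sub uz' => l _ jl.
by rewrite /avoid neq_ltn (leq_trans jl jk).
Qed.

Fact face_display : Order.disp_t. Proof. exact: Order.Disp tt tt. Qed.

HB.instance Definition _ := Order.Le_isPOrder.Build face_display face
  fle_refl fle_anti fle_trans.

Lemma fbot_le F : fle (mk_face ord0 (fs_base S)) F.
Proof.
have [x ->] := face_mk F; apply/fleP; exists x, ord0, (fidx F); split=> //.
by apply/mk_faceP; apply: linked_sub (fs_conn _ _).
Qed.

Lemma fle_top F : fle F (mk_face ord_max (fs_base S)).
Proof.
have [x ->] := face_mk F; apply/fleP; exists x, (fidx F), ord_max; split=> //.
  exact: leq_ord.
apply/mk_faceP; apply: linked_sub (fs_conn _ _) => i id _.
by rewrite /avoid /= eqSS ltn_eqF.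
Qed.

HB.instance Definition _ := Order.hasBottom.Build face_display face fbot_le.
HB.instance Definition _ := Order.hasTop.Build face_display face fle_top.

End Faces.

Section FacesPolytope.
Variable S : flag_system.
Local Notation d := (fs_rank S).
Local Notation s := (@fs_adj S).
Local Notation Linked := (linked d s).
Implicit Types (x y z : S) (F G K : face S) (C : {set face S}).

Lemma mk_face_le (i j : 'I_d.+2) x : i <= j -> (mk_face i x <= mk_face j x)%O.
Proof. by move=> ij; apply/fleP; exists x, i, j. Qed.

Lemma face_leP F G :
  reflect (exists z (i j : 'I_d.+2),
             [/\ i <= j, F = mk_face i z & G = mk_face j z]) (F <= G)%O.
Proof. exact: fleP. Qed.

Lemma fidx_le F G : (F <= G)%O -> fidx F <= fidx G.
Proof. by move=> /face_leP[z [i] [j] [ij -> ->]]. Qed.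

Lemma le_fidx_eq F G : (F <= G)%O -> fidx F = fidx G -> F = G.
Proof. by move=> /face_leP[z [i] [j] [_ -> ->]]; rewrite !fidx_mk => ->. Qed.

Lemma lt_fidx F G : (F < G)%O -> fidx F < fidx G.
Proof.
rewrite lt_neqAle => /andP[neq le]; rewrite ltn_neqAle fidx_le // andbT.
by apply: contra neq => /eqP/val_inj/(le_fidx_eq le) ->.
Qed.

Lemma comparable_fidx_eq F G : (F >=< G)%O -> fidx F = fidx G -> F = G.
Proof.
by case/orP=> le e; [apply: le_fidx_eq|apply/esym/le_fidx_eq].
Qed.

Lemma comparable_fidx_le F G : (F >=< G)%O -> fidx F <= fidx G -> (F <= G)%O.
Proof.
case/orP=> // le FG; rewrite (_ : F = G) //; apply/esym/le_fidx_eq => //.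
by apply/val_inj/eqP; rewrite eqn_leq FG fidx_le.
Qed.

Definition mk_flag x : {set face S} := [set mk_face i x | i : 'I_d.+2].

Lemma mem_mk_flag F x : (F \in mk_flag x) = (F == mk_face (fidx F) x).
Proof.
apply/imsetP/eqP => [[i _ ->]|->]; first by rewrite fidx_mk.
by exists (fidx F).
Qed.

Lemma mem_mk_face i x y : (mk_face i x \in mk_flag y) = Linked (avoid i) x y.
Proof. by rewrite mem_mk_flag mk_face_eq eqxx. Qed.

Lemma chainP C : reflect {in C &, forall F G, (F >=< G)%O} (chain C).
Proof.
apply: (iffP 'forall_implyP) => [H F G FC GC|H F FC].
  by have /'forall_implyP := H F FC; apply.
by apply/'forall_implyP => G; apply: H.
Qed.

(** The flag grows by increasing index, [j] being the index of the last face of [C] met so far. To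
    add [F0], take a flag [y] through it and the face at [j]: of the word from [x] to [y], the
    letters above [j] suffice to reach [F0], and they preserve the lower faces. *)
Lemma chain_sub_mk_flag C : chain C -> exists x, C \subset mk_flag x.
Proof.
move=> /chainP chC.
suff H m : exists x (j : 'I_d.+2), [/\ j < m \/ j = ord0,
    j = ord0 \/ exists2 G, G \in C & fidx G = j &
    forall F, F \in C -> fidx F < m -> fidx F <= j /\ F = mk_face (fidx F) x].
  have [x [j [_ _ H']]] := H d.+2; exists x; apply/subsetP => F FC.
  by rewrite mem_mk_flag; apply/eqP; apply H'.
elim: m => [|m [x [j [jm jC IH]]]].
  by exists (fs_base S), ord0; split=> //; [right|left].
have [/exists_inP[F0 F0C /eqP F0m]|noF] :=
    boolP [exists F in C, (fidx F == m :> nat)]; last first.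
  exists x, j; split=> // [|F FC Fm]; first by case: jm => [jm|->]; [left;
    apply: ltnW|right].
  apply: IH => //; rewrite ltn_neqAle -ltnS Fm andbT.
  by apply: contraNneq noF => Fm'; apply/exists_inP; exists F; rewrite ?Fm'.
have jm' : j <= m by case: jm => [/ltnW|->].
have [y [yF0 xy]] : exists y, F0 = mk_face (fidx F0) y /\ Linked (avoid j) x y.
  case: jC => [->|[G GC Gj]].
    have [y yF] := face_mk F0; exists y; split=> //.
    by apply: linked_sub (fs_conn x y).
  have jltm : j < m \/ j = 0 :> nat.
    case: (eqVneq m 0) => [m0|]; last first.
      by case: jm => [|->]; [left|rewrite -lt0n; left].
    by right; apply/eqP; rewrite -leqn0 -m0.
  case: jltm => [jltm|j0].
    have [|_ Gx] := IH _ GC; first by rewrite Gj.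
    have /face_leP[y [i] [k] [_ eG eF0]] : (G <= F0)%O.
      by apply: comparable_fidx_le; rewrite ?chC // Gj F0m.
    exists y; split; first by rewrite {1}eF0 [in RHS]eF0 fidx_mk.
    move/eqP: Gx; rewrite [in X in X == _]eG mk_face_eq Gj.
    by case/andP=> /eqP ->; rewrite linked_fs_sym.
  have [y yF] := face_mk F0; exists y; split=> //.
  by apply: linked_sub (fs_conn x y) => i _ _; rewrite /avoid j0.
have [z xz zy] := avoid_split xy.
exists z, (fidx F0); split; first by left; rewrite F0m.
  by right; exists F0.
move=> F FC; rewrite ltnS leq_eqVlt => /orP[/eqP Fm|Fm].
  have -> : F = F0 by apply: comparable_fidx_eq; rewrite ?chC //; apply/val_inj;
    rewrite /= Fm F0m.
  split=> //; rewrite {1}yF0; apply/mk_faceP; rewrite linked_fs_sym.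
  apply: linked_sub zy => l _ lj; rewrite /avoid neq_ltn F0m.
  by rewrite (leq_trans lj jm').
have [Fj Fx] := IH _ FC Fm; split; first by rewrite F0m ltnW.
rewrite {1}Fx; apply/mk_faceP; apply: linked_sub xz => l _ jl.
by rewrite /avoid neq_ltn ltnS (leq_trans Fj jl) orbT.
Qed.

(** The intersection property, iterated over the shared faces. If all faces are shared, the word is
    empty, which makes [mk_flag] injective. *)
Lemma linked_multi (K : pred nat) x y :
    (forall k, k < d.+2 -> K k -> Linked (avoid k) x y) ->
  Linked (fun i => ~~ K i.+1) x y.
Proof.
move=> H; suff H' m : m <= d.+2 -> Linked (fun i => ~~ (K i.+1 && (i.+1 < m))) x y.
  by apply: linked_sub (H' _ (leqnn _)) => i id /=; rewrite !ltnS ltnW // andbT.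
elim: m => [_|m IH md].
  by apply: linked_sub (fs_conn x y) => i _; rewrite andbF.
have {}IH := IH (ltnW md).
have [Km|nKm] := boolP (K m); last first.
  apply: linked_sub IH => i _ /=; rewrite [i.+1 < m.+1]ltnS [i.+1 <= m]leq_eqVlt.
  by case: eqP => [->|//]; rewrite (negbTE nKm).
apply: linked_sub (fs_inter IH (H m md Km)) => i _ /=.
rewrite /avoid [i.+1 < m.+1]ltnS [i.+1 <= m]leq_eqVlt.
by case: eqP => // _ /andP[].
Qed.

Lemma mk_flag_inj : injective mk_flag.
Proof.
move=> x y e; have : Linked (fun i => ~~ predT i.+1) x y.
  apply: linked_multi => k kd _; have := mem_mk_face (Ordinal kd) x y.
  by rewrite -e mem_mk_flag eqxx => <-.
move=> /linkedP[[|i w] /=]; first by move=> _ ->.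
by rewrite andbF.
Qed.

Lemma card_mk_flag x : #|mk_flag x| = d.+2.
Proof.
by rewrite card_imset ?card_ord // => i j /(congr1 (@fidx _)).
Qed.

Lemma mk_flag_chain x : chain (mk_flag x).
Proof.
apply/chainP => F G; rewrite !mem_mk_flag => /eqP -> /eqP ->.
by rewrite /Order.comparable; case/orP: (leq_total (fidx F) (fidx G)) => le;
   rewrite (mk_face_le _ le) ?orbT.
Qed.

Lemma is_flagP C : reflect (exists x, C = mk_flag x) (is_flag C).
Proof.
apply: (iffP maxsetP) => [[chC maxC]|[x ->]].
  have [x sC] := chain_sub_mk_flag chC; exists x.
  by apply/esym/maxC => //; apply: mk_flag_chain.
split=> [|B /chain_sub_mk_flag[y sB] sxB]; first exact: mk_flag_chain.
apply/eqP; rewrite eq_sym eqEcard sxB card_mk_flag -(card_mk_flag y).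
exact: subset_leq_card.
Qed.

Lemma height_fidx F : height F = fidx F.
Proof.
apply/eqP; rewrite eqn_leq; apply/andP; split.
  apply/bigmax_leqP => C /andP[/chainP chC /forall_inP ltC].
  rewrite cardE -(size_map (fun G => fidx G : nat)) -(size_iota 0 (fidx F)).
  apply: uniq_leq_size => [|k /mapP[G]].
    rewrite map_inj_in_uniq ?enum_uniq // => G K; rewrite !mem_enum => GC KC /val_inj.
    by apply: comparable_fidx_eq; apply: chC.
  by rewrite mem_enum mem_iota => /ltC/lt_fidx GF ->.
have [x xF] := face_mk F.
pose f (j : 'I_(fidx F)) := mk_face (widen_ord (ltnW (ltn_ord (fidx F))) j) x.
have finj : injective f by move=> i j /(congr1 (@fidx _))/(congr1 val)/= /val_inj.
pose C := [set f i | i : 'I_(fidx F)].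
have PC : chain C && [forall G in C, (G < F)%O].
  apply/andP; split.
    apply/chainP => G K /imsetP[i _ ->] /imsetP[j _ ->].
    by apply: (chainP _ (mk_flag_chain x)); rewrite mem_mk_flag.
  apply/forall_inP => G /imsetP[i _ ->]; rewrite [X in (_ < X)%O]xF lt_neqAle.
  rewrite (@mk_face_le (widen_ord _ i)) ?(ltnW (ltn_ord i)) // andbT.
  by apply: contraTneq (ltn_ord i) => /(congr1 (@fidx _))/(congr1 val)/= ->;
    rewrite ltnn.
have := @leq_bigmax_cond _ (fun C => chain C && [forall G in C, (G < F)%O])
  (fun C : {set face S} => #|C|) C PC.
by rewrite card_imset // card_ord.
Qed.

Lemma linked_adj i j x : i < d -> (i.+1 != j) -> Linked (avoid j) x (s i x).
Proof. by move=> id ij; apply: linked_step. Qed.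

Lemma unlinked_adj i x : i < d -> ~~ Linked (avoid i.+1) x (s i x).
Proof.
move=> id; apply/negP => L; have := fs_adj_neq i x; rewrite -(inj_eq mk_flag_inj).
case/eqP; apply/setP => F; rewrite !mem_mk_flag.
suff -> : mk_face (fidx F) (s i x) = mk_face (fidx F) x by [].
apply/mk_faceP; rewrite linked_fs_sym; case: (eqVneq i.+1 (fidx F)) => [<- //|ne].
exact: linked_adj.
Qed.

Lemma mk_flag_setD i x (id : i < d) :
  mk_flag x :\: mk_flag (s i x) = [set mk_face (lift ord0 (widen_ord (leqnSn _)
    (Ordinal id))) x].
Proof.
apply/setP => F; rewrite !inE !mem_mk_flag; have [y ->] := face_mk F.
rewrite fidx_mk !mk_face_eq eqxx /=; case: eqP => [->|ne] /=; last first.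
  apply/negbTE; rewrite negb_and negbK orbC -implybE; apply/implyP => yx.
  apply: linked_trans yx _; apply: linked_adj => //.
  by apply/eqP => e; apply: ne; apply/val_inj; rewrite /= -e.
rewrite andbC; case: (boolP (Linked _ y x)) => //= yx.
apply/negP => L; have /negP[] := unlinked_adj x id.
by apply: linked_trans L; rewrite linked_fs_sym.
Qed.

Lemma adjacentP x y : reflect (exists2 i, i < d & y = s i x)
  (adjacent (mk_flag x) (mk_flag y)).
Proof.
apply: (iffP and3P) => [[_ _ /cards1P[F eF]]|[i id ->]]; last first.
  split; try by apply/is_flagP; eexists.
  by rewrite (mk_flag_setD _ id) cards1.
have L : Linked (fun i => ~~ [pred k | k != fidx F :> nat] i.+1) x y.
  apply: linked_multi => k kd /= kF; rewrite -(mem_mk_face (Ordinal kd)).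
  have : mk_face (Ordinal kd) x \notin mk_flag x :\: mk_flag y.
    by rewrite eF inE; apply: contraNneq kF => <-.
  by rewrite inE !mem_mk_face linked_refl andbT negbK.
have neq : y != x.
  apply: contraPneq (set11 F) => exy; rewrite -eF exy setDv inE.
  by [].
have [i id iF] : exists2 i, i < d & i.+1 = fidx F.
  move/linkedP: (L) => [[|i w] /= aw e]; first by rewrite e eqxx in neq.
  by case/andP: aw => /andP[id] /negPn/eqP iF _; exists i.
exists i => //; have : y = x \/ y = s i x.
  move: y L {eF neq}; apply: (@linked_ind _ _ _ (fun y => y = x \/ y = s i x)).
    by left.
  move=> z j jd /negPn/eqP; rewrite -iF => -[->] [->|->]; first by right.
  by left; rewrite fs_adjK.
by case=> // e; rewrite e eqxx in neq.
Qed.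

Lemma rank_adjacentP i x C : i < d ->
  reflect (C = mk_flag (s i x)) (rank_adjacent i (mk_flag x) C).
Proof.
move=> id; apply: (iffP andP) => [[adj]|->]; last first.
  split; first by apply/adjacentP; exists i.
  by apply/forall_inP => F; rewrite (mk_flag_setD _ id) inE => /eqP ->;
    rewrite height_fidx.
have /and3P[_ /is_flagP[y ey] _] := adj; rewrite {C}ey in adj *.
have /adjacentP[j jd ->] := adj; rewrite (mk_flag_setD _ jd) => /forall_inP.
by move=> /(_ _ (set11 _)); rewrite height_fidx => /eqP[]; rewrite add0n => ->.
Qed.

Lemma adj_mk_flag i x : i < d -> adj i (mk_flag x) = mk_flag (s i x).
Proof.
move=> id; rewrite /adj; case: pickP => [C /rank_adjacentP -> //|].
by move/(_ (mk_flag (s i x)))/negbT/negP; case; apply/rank_adjacentP.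
Qed.

Lemma faces_polytope : abstract_polytope (face S) d.
Proof.
split.
- by move=> C /is_flagP[x ->]; apply: card_mk_flag.
- move=> A B /is_flagP[x ->] /is_flagP[y ->].
  (* [K] marks the indices of the shared faces; a word avoiding them keeps these faces at each of
     its flags. *)
  pose K k := [exists i : 'I_d.+2, (i == k :> nat) && Linked (avoid i) x y].
  have L : Linked (fun i => ~~ K i.+1) x y.
    by apply: linked_multi => k kd /existsP[i /andP[/eqP <- ]].
  have sub z : Linked (fun i => ~~ K i.+1) x z ->
      mk_flag x :&: mk_flag y \subset mk_flag z.
    move=> xz; apply/subsetP => F; rewrite inE !mem_mk_flag => /andP[/eqP eF].
    rewrite {1}eF mk_face_eq eqxx /= => Fxy; rewrite eF mk_face_eq eqxx /=.
    apply: linked_sub xz => i _; apply: contra => /eqP e; apply/existsP.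
    by exists (fidx F); rewrite e eqxx.
  pose R := [rel C C' | [&& adjacent C C', mk_flag x :&: mk_flag y \subset C
                         & mk_flag x :&: mk_flag y \subset C']].
  pose P z := connect R (mk_flag x) (mk_flag z) /\ Linked (fun i => ~~ K i.+1) x z.
  suff [] : P y by [].
  move: (y) L; apply: linked_ind; first by split;
    [apply: connect0|apply: linked_refl].
  move=> z i id Ki [cz xz]; have xsz := linked_trans xz (linked_step s z id Ki).
  split=> //; apply: connect_trans cz (connect1 _) => /=.
  by apply/and3P; split; [apply/adjacentP; exists i|exact: sub|exact: sub].
move=> F G FG; rewrite !height_fidx => hG.
have /face_leP[x [i] [j] [_ eF eG]] := ltW FG.
rewrite eF eG !fidx_mk in hG *.
have id : i < d by rewrite -ltnS -ltnS -hG ltn_ord.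
pose k : 'I_d.+2 := lift ord0 (widen_ord (leqnSn _) (Ordinal id)).
have kE : k = i.+1 :> nat by [].
rewrite (_ : [set K | _] = [set mk_face k x; mk_face k (s i x)]).
  rewrite cards2 mk_face_eq eqxx /=.
  by rewrite (negbTE (unlinked_adj x id)).
apply/setP => K; rewrite !inE; apply/andP/orP => [[FK KG]|].
  (* A flag [y] through the three faces is linked to [x] by letters that fix both ends. As
     [j = i + 2], the letter [i] commutes with the other ones, which fix the face of index [k]; only
     the two images of [x] under [i] remain. *)
  have /chain_sub_mk_flag[y] : chain [set mk_face i x; K; mk_face j x].
    apply/chainP => A B; rewrite !inE /Order.comparable.
    by move=> /orP[/orP[]|] /eqP -> /orP[/orP[]|] /eqP ->;
       rewrite ?lexx ?(ltW FK) ?(ltW KG) ?(ltW (lt_trans FK KG)) ?orbT.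
  move=> /subsetP sub.
  have /[!mem_mk_face] Li : mk_face i x \in mk_flag y by apply: sub;
    rewrite !inE eqxx.
  have /[!mem_mk_face] Lj : mk_face j x \in mk_flag y by apply: sub;
    rewrite !inE eqxx !orbT.
  have /[!mem_mk_flag] /eqP eK : K \in mk_flag y by apply: sub;
    rewrite !inE eqxx !orbT.
  have := lt_fidx FK; have := lt_fidx KG; rewrite !fidx_mk hG => Kj iK.
  have {}eK : K = mk_face k y.
    by rewrite eK; congr mk_face; apply/val_inj/eqP; rewrite /= eqn_leq iK -ltnS Kj.
  have L : Linked (predI (avoid i) (avoid j)) x y by apply: fs_inter.
  have [||z xz zy] := @linked_split _ d s (pred1 (i :
    nat)) (predI (avoid k) (predI (avoid i) (avoid j))) _ x y _ _ L.
  - move=> l m z ld md /eqP -> /and3P[]; rewrite /avoid hG kE !eqSS => n1 n2 n3.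
    case: (ltngtP m i) => [mi|mi|mi]; last by rewrite mi eqxx in n1.
      by rewrite [RHS]fs_adjC // id andbT ltn_neqAle n2 mi.
    by rewrite fs_adjC // md andbT ltn_neqAle eq_sym n3.
  - move=> l ld /= /andP[-> ->]; rewrite !andbT /avoid.
    by rewrite /bump add1n eqSS orbN.
  have zK : K = mk_face k z.
    rewrite eK; apply/mk_faceP; rewrite linked_fs_sym.
    by apply: linked_sub zy => l _ /and3P[].
  have : z = x \/ z = s i x.
    move: (z) xz; apply: (@linked_ind _ _ _ (fun y => y = x \/ y = s i x)).
      by left.
    by move=> u l ld /eqP -> [->|->]; rewrite ?fs_adjK; [right|left].
  by case=> zE; [left|right]; rewrite zK zE.
have le1 y : i < k -> mk_face i x = mk_face i y -> mk_face j x = mk_face j y ->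
    (mk_face i x < mk_face k y)%O /\ (mk_face k y < mk_face j x)%O.
  by move=> _ -> ->; split; rewrite lt_neqAle mk_face_le ?andbT ?mk_face_eq //
    -?val_eqE /= ?hG // negb_and /bump ?neq_ltn /= ?leqnn ?orbT //=.
by case=> /eqP ->; apply: le1 => //; apply/mk_faceP;
  rewrite linked_adj // ?hG ?neq_ltn ?ltnS ?leqnn ?orbT.
Qed.

End FacesPolytope.

Lemma linked_homo (X Y : finType) d (s : nat -> X -> X) (t : nat -> Y -> Y) (f : X ->
  Y)
    (I : pred nat) x y :
  (forall i z, i < d -> I i -> f (s i z) = t i (f z)) ->
  linked d s I x y -> linked d t I (f x) (f y).
Proof.
move=> fs; move: y; apply: (@linked_ind _ _ _ (fun y => linked d t I (f x) (f y))).
  exact: linked_refl.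
move=> z i id Ii L; rewrite fs //.
exact: linked_trans L (linked_step _ _ id Ii).
Qed.

(** * Automorphisms of the face poset and chirality *)

Section FaceAutomorphisms.
Variable S : flag_system.
Local Notation d := (fs_rank S).
Local Notation s := (@fs_adj S).
Implicit Types (x y z : S) (F G K : face S).

Definition commutes_adj (f : S -> S) := forall i x, i < d -> f (s i x) = s i (f x).

Definition face_map (f : S -> S) F : face S := mk_face (fidx F) (f (val F).2).

Lemma face_map_mk f i x : commutes_adj f ->
  face_map f (mk_face i x) = mk_face i (f x).
Proof.
move=> fC; apply/mk_faceP; apply: linked_homo => [l z ld _|]; first exact: fC.
by rewrite linked_fs_sym; apply: connect_root.
Qed.

Lemma face_map_le f F G : commutes_adj f ->
  (F <= G)%O -> (face_map f F <= face_map f G)%O.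
Proof.
move=> fC /face_leP[z [i] [j] [ij -> ->]].
by rewrite !face_map_mk // mk_face_le.
Qed.

Lemma face_mapK f g : commutes_adj f -> commutes_adj g -> cancel f g ->
  cancel (face_map f) (face_map g).
Proof.
by move=> fC gC fK F; have [x ->] := face_mk F; rewrite !face_map_mk // fK.
Qed.

Lemma height_aut (a : {perm face S}) F : a \in polytope_aut (face S) ->
  height (a F) = height F.
Proof.
have H b G : b \in polytope_aut (face S) -> height G <= height (b G).
  rewrite inE => /'forall_'forall_eqP bP.
  apply/bigmax_leqP => C /andP[/chainP chC /forall_inP ltC].
  have PC : chain (b @: C) && [forall K in b @: C, (K < b G)%O].
    apply/andP; split.
      apply/chainP => _ _ /imsetP[K KC ->] /imsetP[L LC ->].
      by rewrite /Order.comparable !bP; apply: chC.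
    apply/forall_inP => _ /imsetP[K KC ->]; have := ltC K KC.
    by rewrite !lt_neqAle bP (inj_eq perm_inj).
  have := @leq_bigmax_cond _ (fun C => chain C && [forall K in C, (K < b G)%O])
    (fun C : {set face S} => #|C|) (b @: C) PC.
  by rewrite card_imset //; apply: perm_inj.
move=> aA; apply/eqP; rewrite eqn_leq H // andbT.
by have := H a^-1%g (a F); rewrite permK; apply; rewrite groupV.
Qed.

(** Comparability and height are preserved, hence so are flags and rank adjacency. *)
Lemma aut_flag (a : {perm face S}) : a \in polytope_aut (face S) ->
  exists2 f : S -> S, commutes_adj f & forall i x, a (mk_face i x) = mk_face i (f x).
Proof.
move=> aA; have /[!inE] /'forall_'forall_eqP aP := aA.
have E x : exists y, [forall i, a (mk_face i x) == mk_face i y].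
  have /chain_sub_mk_flag[y /subsetP sub] : chain (a @: mk_flag x).
    apply/chainP => _ _ /imsetP[K KC ->] /imsetP[L LC ->].
    by rewrite /Order.comparable !aP; apply: (chainP _ (mk_flag_chain x)).
  exists y; apply/forallP => i.
  have : a (mk_face i x) \in mk_flag y by apply/sub/imset_f; rewrite mem_mk_flag.
  rewrite mem_mk_flag => /eqP {1}->; apply/eqP; congr mk_face.
  by apply/val_inj; rewrite /= -height_fidx height_aut // height_fidx.
have [f aE] : exists f, forall i x, a (mk_face i x) = mk_face i (f x).
  exists (fun x => xchoose (E x)) => i x.
  exact/eqP/(forallP (xchooseP (E x))).
exists f => // i x id; apply: mk_flag_inj; apply/esym/setP.
have aS y : a @: mk_flag y = mk_flag (f y).
  rewrite /mk_flag -imset_comp; apply: eq_imset => j; exact: aE.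
have : rank_adjacent i (mk_flag (f x)) (mk_flag (f (s i x))).
  have /andP[/and3P[_ _ A] B] : rank_adjacent i (mk_flag x) (mk_flag (s i x)).
    exact/rank_adjacentP.
  have D : mk_flag (f x) :\: mk_flag (f (s i x)) = a @: (mk_flag x :\:
    mk_flag (s i x)).
    rewrite -(aS x) -(aS (s i x)); apply/setP => F;
      apply/setDP/imsetP => [[/imsetP[K K1 ->] K2]|].
      by exists K => //; rewrite inE K1 andbT; apply: contra K2; apply: imset_f.
    case=> K /setDP[K1 K2] ->; split; first exact: imset_f.
    by apply: contra K2 => /imsetP[L L1 /perm_inj ->].
  apply/andP; split.
    apply/and3P; split; try by apply/is_flagP; eexists.
    by rewrite D card_imset //; apply: perm_inj.
  apply/forall_inP => F; rewrite D => /imsetP[K KD ->].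
  by rewrite height_aut //; apply: (forall_inP B).
by move/(rank_adjacentP _ _ id) ->.
Qed.

End FaceAutomorphisms.

(* The action of G on the flags is on the left, whence the order of the factors
   in face_autM. *)
Section Chirality.
Variables (S : flag_system) (gT : finGroupType) (G : {group gT}).
Variables (act : gT -> S -> S) (col : S -> bool).
Local Notation d := (fs_rank S).
Local Notation s := (@fs_adj S).
Local Notation x0 := (fs_base S).
Hypothesis d_gt0 : 0 < d.
Hypothesis act1 : forall x, act 1%g x = x.
Hypothesis actM : {in G &, forall g h x, act (g * h)%g x = act g (act h x)}.
Hypothesis actC : {in G, forall g, commutes_adj (act g)}.
Hypothesis act_free : {in G &, forall g h, act g x0 = act h x0 -> g = h}.
Hypothesis adj_col : forall i x, i < d -> col (s i x) = ~~ col x.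
Hypothesis act_trans : forall x, col x = col x0 -> exists2 g, g \in G & x = act g x0.
Hypothesis no_reflection : forall f, commutes_adj f -> f x0 <> s 0 x0.

Let actK g : g \in G -> cancel (act g) (act g^-1%g).
Proof. by move=> gG x; rewrite -actM ?groupV // mulVg act1. Qed.

(** The identity replaces elements outside [G], so that [face_aut] is a permutation for every
    [g]. *)
Lemma face_aut_inj g : injective (face_map (S := S) (act (if g \in G then g else
  1%g))).
Proof.
set g' := if _ then _ else _; have gG : g' \in G by rewrite /g'; case: ifP.
by apply: can_inj; apply: face_mapK (actK gG); apply: actC; rewrite ?groupV.
Qed.

Definition face_aut g : {perm face S} := perm (@face_aut_inj g).

Lemma face_aut_mk g i x : g \in G -> face_aut g (mk_face i x) = mk_face i (act g x).
Proof. by move=> gG; rewrite permE /= gG face_map_mk //; apply: actC. Qed.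

Lemma face_aut_flag g x : g \in G -> face_aut g @: mk_flag x = mk_flag (act g x).
Proof.
by move=> gG; rewrite /mk_flag -imset_comp; apply: eq_imset => j; apply: face_aut_mk.
Qed.

Lemma face_autM : {in G &, forall g h,
  face_aut (g * h)%g = (face_aut h * face_aut g)%g}.
Proof.
move=> g h gG hG; apply/permP => F; have [x ->] := face_mk F.
by rewrite permM !face_aut_mk ?groupM // actM.
Qed.

Lemma face_aut_aut g : g \in G -> face_aut g \in polytope_aut (face S).
Proof.
move=> gG; rewrite inE; apply/'forall_'forall_eqP => F K.
have H h : h \in G -> (F <= K)%O -> (face_aut h F <= face_aut h K)%O => [hG|].
  by rewrite !permE hG; apply: face_map_le; apply: actC.
apply/idP/idP => [FK|]; last exact: H.
have E L : L = face_aut g^-1%g (face_aut g L).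
  by have [x ->] := face_mk L; rewrite !face_aut_mk ?groupV // actK.
rewrite (E F) (E K); move: FK; rewrite !permE groupV gG.
by apply: face_map_le; apply: actC; rewrite groupV.
Qed.

(** If [f x0] had the other colour, [s 0 (f x0)] would be [g x0] for some [g] in [G], and [g^-1]
    after [f] would be a forbidden reflection. *)
Lemma commutes_col f : commutes_adj f -> forall x, col (f x) = col x.
Proof.
move=> fC; have f0 : col (f x0) = col x0.
  apply/eqP; apply/negP => /negP ne.
  have [|g gG e] := @act_trans (s 0 (f x0)).
    by rewrite adj_col //; move: ne; case: (col _); case: (col _).
  have [] := no_reflection (f := act g^-1%g \o f).
    by move=> i x id; rewrite /= fC // actC ?groupV.
  apply: (inv_inj (fs_adjK 0)); rewrite /= fs_adjK -actC ?groupV // e.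
  by rewrite actK.
move=> x; move: (fs_conn x0 x).
apply: (@linked_ind _ _ _ (fun x => col (f x) = col x)) => // z i id _ e.
by rewrite fC // !adj_col // e.
Qed.

Lemma flag_orbit_col x y :
  (mk_flag y \in flag_orbit (mk_flag x)) = (col x == col y).
Proof.
apply/imsetP/eqP => [[a aA e]|xy].
  have [f fC fE] := aut_flag aA; rewrite -(commutes_col fC); congr col.
  apply: mk_flag_inj; rewrite e; apply/esym.
  by rewrite /mk_flag -imset_comp; apply: eq_imset => j; apply: fE.
have [g gG ->] : exists2 g, g \in G & y = act g x.
  have H u v : col u = col x0 -> col v = col x0 -> exists2 g, g \in G & v = act g u.
    move=> /act_trans[g gG ->] /act_trans[h hG ->]; exists (h * g^-1)%g.
      by rewrite groupM ?groupV.
    by rewrite actM ?groupV // actK.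
  have [x0x|x0x] := eqVneq (col x) (col x0); first by apply: H; rewrite -?xy.
  have sx u : col u = col x -> col (s 0 u) = col x0.
    by move=> ux; rewrite adj_col // ux; move: x0x; case: (col x); case: (col x0).
  have [||g gG e] := H (s 0 x) (s 0 y); [exact: sx|exact: sx|].
  by exists g => //; apply: (inv_inj (fs_adjK 0)); rewrite e actC.
by exists (face_aut g); rewrite ?face_aut_aut ?face_aut_flag.
Qed.

Lemma faces_chiral : chiral (face S) d.
Proof.
split; first exact: faces_polytope.
  have E x y : (flag_orbit (mk_flag x) == flag_orbit (mk_flag y)) = (col x == col y).
    apply/eqP/idP => [e|/eqP xy].
      by rewrite -flag_orbit_col e flag_orbit_col.
    apply/setP => C; apply/imsetP/imsetP => -[a aA ->].
      have : mk_flag x \in flag_orbit (mk_flag y) by rewrite flag_orbit_col xy.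
      case/imsetP=> b bA ->; exists (b * a)%g; first by rewrite groupM.
      by rewrite -imset_comp; apply: eq_imset => F; rewrite permM.
    have : mk_flag y \in flag_orbit (mk_flag x) by rewrite flag_orbit_col xy.
    case/imsetP=> b bA ->; exists (b * a)%g; first by rewrite groupM.
    by rewrite -imset_comp; apply: eq_imset => F; rewrite permM.
  rewrite (_ : [set _ | _ in _] =
      [set flag_orbit (mk_flag x0); flag_orbit (mk_flag (s 0 x0))]).
    by rewrite cards2 E adj_col //; case: (col x0).
  apply/setP => O; rewrite !inE; apply/imsetP/orP =>
    [[A /[!inE] /is_flagP[x ->] ->]|].
    by rewrite !E adj_col //; case: (col x); case: (col x0); [left|right|right|left].
  case=> /eqP ->; [exists (mk_flag x0)|exists (mk_flag (s 0 x0))] => //;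
  by rewrite inE; apply/is_flagP; eexists.
move=> A B AB; have /and3P[/is_flagP[x eA] /is_flagP[y eB] _] := AB.
rewrite {}eA {}eB in AB *; rewrite flag_orbit_col.
by have /adjacentP[i id ->] := AB; rewrite adj_col //; case: (col x).
Qed.

Lemma face_aut_in_inj : {in G &, injective face_aut}.
Proof.
move=> g h gG hG e; apply: act_free => //; apply: mk_flag_inj.
by rewrite -!face_aut_flag // e.
Qed.

Lemma face_aut_surj : face_aut @: G = polytope_aut (face S).
Proof.
apply/setP => a; apply/imsetP/idP => [[g gG ->]|aA]; first exact: face_aut_aut.
have [f fC fE] := aut_flag aA.
have [g gG f0] := act_trans (commutes_col fC x0).
exists g => //; apply/permP => F; have [x ->] := face_mk F.
rewrite fE face_aut_mk //; congr mk_face.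
move: (fs_conn x0 x); apply: (@linked_ind _ _ _ (fun x => f x = act g x)) =>
  // z i id _ e.
by rewrite fC // actC // e.
Qed.

End Chirality.

Local Open Scope ring_scope.

(** * Flags of the cubic toroid *)

Section TorusClass.
Variables (n k a : nat) (ha : (6 * n + 1 <= a)%N).
Local Notation Tor := (torus k ha).
Local Notation tc := (@torus_class n k a ha).
Implicit Types (u v : 'rV[int]_n) (t : Tor).

Lemma torus_classD u v : tc (u + v) = tc u + tc v.
Proof. by rewrite /torus_class -raddfD. Qed.

Lemma torus_classN u : tc (- u) = - tc u.
Proof. by rewrite /torus_class -raddfN. Qed.

Lemma torus_classB u v : tc (u - v) = tc u - tc v.
Proof. by rewrite torus_classD torus_classN. Qed.

Lemma torus_class_0 : tc 0 = 0.
Proof. by rewrite /torus_class raddf0. Qed.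

Lemma torus_class_eq u v : (tc u == tc v) = (u - v \in @lattice n k a).
Proof. by rewrite Quotient.idealrBE. Qed.

Lemma torus_class_surj t : exists v, t = tc v.
Proof. by elim/quotW: t => v; exists v. Qed.

Lemma a_gt0 : (0 < a)%N.
Proof. by apply: leq_trans ha; rewrite addn1. Qed.

Lemma torus_class_dvd u v j : tc u = tc v -> (a %| (u 0 j - v 0 j)%R)%Z.
Proof.
move/eqP; rewrite torus_class_eq unfold_in => /andP[/forallP/(_ j)].
by rewrite !mxE.
Qed.

(** Lattice vectors have coordinates divisible by [a]. Every passage from the torus back to integers
    relies on this. *)
Lemma torus_class_near u v j : tc u = tc v -> `|u 0 j - v 0 j| < a%:Z ->
  u 0 j = v 0 j.
Proof.
move=> /(torus_class_dvd j)/dvdzP[q e]; rewrite e => lt.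
have q0 : q = 0 by move: lt; have := a_gt0; nia.
by apply/eqP; rewrite -subr_eq0 e q0 mul0r.
Qed.

Definition signed_perm (tau : 'S_n) (y : {ffun 'I_n -> bool}) v : 'rV[int]_n :=
  \row_j (pm (y j) * v 0 (tau^-1%g j)).

Lemma signed_permD tau y u v :
  signed_perm tau y (u + v) = signed_perm tau y u + signed_perm tau y v.
Proof. by apply/rowP => j; rewrite !mxE mulrDr. Qed.

Lemma signed_permN tau y u : signed_perm tau y (- u) = - signed_perm tau y u.
Proof. by apply/rowP => j; rewrite !mxE mulrN. Qed.

Lemma pm_dvd2 (b : bool) (z : int) : (2 %| (pm b * z - z)%R)%Z.
Proof.
apply/dvdzP; case: b; rewrite /pm ?expr1 ?expr0.
  by exists (- z); lia.
by exists 0; rewrite mul1r subrr mul0r.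
Qed.

(** The conditions on [v / a] are symmetric in the coordinates and depend on parities only, which
    signs do not change. *)
Lemma lattice_signed_perm tau y v :
  v \in @lattice n k a -> signed_perm tau y v \in @lattice n k a.
Proof.
rewrite !unfold_in => /andP[/forallP dv uv].
have dv' j : (a %| (signed_perm tau y v 0 j)%R)%Z by rewrite mxE dvdz_mull.
apply/andP; split; first exact/forallP.
pose z := \row_i ((v 0 i)%R %/ a)%Z.
have E i : (\row_l ((signed_perm tau y v 0 l)%R %/ a)%Z) 0 i = pm (y i) * z 0
  (tau^-1%g i).
  have /dvdzP[q e] := dv (tau^-1%g i); rewrite !mxE e mulrA !mulzK //;
  by rewrite eqz_nat -lt0n a_gt0.
rewrite -/z in uv; move: uv; rewrite /unit_lattice; case: ifP => // _; case: ifP => _.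
  move=> uv; rewrite -(subrK (\sum_i z 0 i) (\sum_i _)); apply: rpredD => //.
  rewrite [X in _ - X](reindex_inj (h := tau^-1%g) perm_inj) -sumrB;
    apply: rpred_sum => i _.
  rewrite E; exact: pm_dvd2.
move/forallP=> uv; apply/forallP => i; apply/forallP => j.
rewrite !E.
have -> : pm (y i) * z 0 (tau^-1%g i) - pm (y j) * z 0 (tau^-1%g j) =
    (pm (y i) * z 0 (tau^-1%g i) - z 0 (tau^-1%g i)) -
    (pm (y j) * z 0 (tau^-1%g j) - z 0 (tau^-1%g j)) +
    (z 0 (tau^-1%g i) - z 0 (tau^-1%g j)) by ring.
apply: rpredD; last exact: (forallP (uv _)).
by apply: rpredB; apply: pm_dvd2.
Qed.

Definition torus_perm tau y t : Tor := 
  tc (signed_perm tau y (@generic_quotient.repr _ (Quotient.quot (@lattice n k a))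
    t)).

Lemma torus_permE tau y v : torus_perm tau y (tc v) = tc (signed_perm tau y v).
Proof.
apply/eqP; rewrite torus_class_eq -signed_permN -signed_permD.
by apply: lattice_signed_perm; rewrite -torus_class_eq /torus_class reprK.
Qed.

Lemma torus_permB tau y t v :
  torus_perm tau y (t - tc v) = torus_perm tau y t - tc (signed_perm tau y v).
Proof.
have [u ->] := torus_class_surj t.
by rewrite -torus_classB !torus_permE -torus_classB -signed_permN -signed_permD.
Qed.

Lemma torus_permD tau y t v :
  torus_perm tau y (t + tc v) = torus_perm tau y t + tc (signed_perm tau y v).
Proof.
have [u ->] := torus_class_surj t.
by rewrite -torus_classD !torus_permE -torus_classD -signed_permD.
Qed.

Lemma pmD b c : pm (b (+) c) = pm b * pm c.
Proof. by rewrite /pm signr_addb. Qed.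

Lemma normr_pm b : `|pm b| = 1.
Proof. by rewrite /pm normr_sign. Qed.

End TorusClass.

Section FlagMaps.
Variables (n k a : nat) (hn : (1 < n)%N) (ha : (6 * n + 1 <= a)%N).
Local Notation Tor := (torus k ha).
Local Notation tc := (@torus_class n k a ha).
Local Notation flag := (flag k ha).
Local Notation rr := (@r n k a hn ha).
Implicit Types (Phi Psi : flag) (s tau : 'S_n) (x y : {ffun 'I_n ->
  bool}) (t c : Tor).

Lemma idxE i : (0 < i <= n)%N -> idx hn i = i.-1 :> nat.
Proof. by case: i => // i /andP[_ id]; rewrite /idx val_insubd id. Qed.

Lemma flipK j : involutive (fun x => flip x j).
Proof. by move=> x; apply/ffunP => i; rewrite !ffunE addbK. Qed.

(** Every index [i >= n] behaves as [n], so that [r i] is an involution without any bound on [i]. *)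
Variant r_spec : nat -> (flag -> flag) -> Prop :=
  | R_low : r_spec 0 (fun Phi => let: (s, x, t) := Phi in (s, flip x (s (idx hn 1)),
    t))
  | R_mid i of (0 < i < n)%N : r_spec i
      (fun Phi => let: (s, x, t) := Phi in ((tperm (idx hn i) (idx hn i.+1) * s)%g,
        x, t))
  | R_high i of (n <= i)%N : r_spec i
      (fun Phi => let: (s, x, t) := Phi in
         let j := s (idx hn n) in (s, flip x j, t - tc (pm (x j) *: e_ j))).

Lemma rP i : exists2 f, r_spec i f & forall Phi, r hn i Phi = f Phi.
Proof.
case: (posnP i) => [->|i0]; first by eexists; [apply: R_low|move=> [[s x] t]].
case: (ltnP i n) => ni.
  eexists; first by apply: R_mid; rewrite i0.
  by move=> [[s x] t]; rewrite /r eqn0Ngt i0 /= ni.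
eexists; first by apply: R_high.
by move=> [[s x] t]; rewrite /r eqn0Ngt i0 /= ltnNge ni.
Qed.

Lemma rK i : involutive (@r n k a hn ha i).
Proof.
move=> [[s x] t]; have [f fi fE] := rP i; rewrite !fE {fE};
  case: fi => [|{}i i0|{}i ni] /=.
- by rewrite flipK.
- by rewrite mulgA tperm2 mul1g.
- rewrite flipK; congr (_, _, _); rewrite ffunE eqxx addbT -addrA -opprD
  -torus_classD.
  by rewrite -scalerDl; case: (x _); rewrite scale0r torus_class_0 subr0.
Qed.

Lemma r_comm i j Phi : (i.+1 < j <= n)%N -> r hn i (r hn j Phi) = r hn j (r hn i Phi).
Proof.
case: Phi => [[s x] t] /andP[ij jn].
have [f fi fE] := rP i; have [g gj gE] := rP j; rewrite !fE !gE {fE gE}.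
have neq l m : (0 < l <= n)%N -> (0 < m <= n)%N -> l != m -> idx hn l != idx hn m.
  move=> l0 m0; apply: contra => /eqP/(congr1 val)/=; rewrite !idxE //.
  by case: l l0 => //= l; case: m m0 => //= m _ _ ->.
have fix_tperm l m : (0 < l < n)%N -> (0 < m <= n)%N -> (l != m) -> (l.+1 != m) ->
    tperm (idx hn l) (idx hn l.+1) (idx hn m) = idx hn m.
  by move=> l0 m0 lm l1m; rewrite tpermD // neq //; lia.
case: fi ij => [|{}i i0|{}i ni] ij; case: gj jn ij => [|{}j j0|{}j nj] jn ij; try lia.
- by rewrite permM (@fix_tperm j 1) //; lia.
- have jn' : j = n by lia. 
  rewrite /= ffunE; have /negPf -> : s (idx hn n) != s (idx hn 1).
    by rewrite (inj_eq perm_inj) neq //; lia.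
  rewrite addbF; congr (_, _, _); apply/ffunP => l; rewrite !ffunE.
  by rewrite -!addbA [(_ == _) (+) _]addbC.
- congr (_, _, _); rewrite !mulgA; congr (_ * _)%g.
  by rewrite [LHS]conjgC tpermJ !fix_tperm //; lia.
- have jn' : j = n by lia.
  by rewrite permM fix_tperm //; lia.
Qed.

(** The symmetry of the toroid with linear part [(tau, y)] and translation [c]. *)
Definition flag_aut tau y c (Phi : flag) : flag := let: (s, x, t) := Phi in
  ((s * tau)%g, [ffun j => x (tau^-1%g j) (+) y j], torus_perm tau y t + c).

Lemma flag_aut_r tau y c i Phi :
  flag_aut tau y c (r hn i Phi) = r hn i (flag_aut tau y c Phi).
Proof.
case: Phi => [[s x] t]; have [f fi fE] := rP i; rewrite !fE {fE}.
have flipE m : [ffun j => flip x (s m) (tau^-1%g j) (+) y j] =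
    flip [ffun j => x (tau^-1%g j) (+) y j] ((s * tau)%g m).
  apply/ffunP => j; rewrite !ffunE permM -!addbA; congr (_ (+) _).
  by rewrite addbC; congr (_ (+) _); rewrite -(inj_eq (@perm_inj _ tau)) permKV.
case: fi => [|{}i i0|{}i ni] /=; rewrite ?flipE ?mulgA //.
congr (_, _, _); rewrite torus_permB addrAC; congr (_ - tc _).
apply/rowP => j; rewrite !mxE !ffunE permM permK eqxx /= pmD.
rewrite -[(tau^-1)%g j == _](inj_eq (@perm_inj _ tau)) permKV.
by case: eqP => [->|_]; rewrite ?mulr0 // !mulr1 mulrC.
Qed.

Lemma flag_aut_trans Phi Psi : exists tau y c, flag_aut tau y c Phi = Psi.
Proof.
case: Phi Psi => [[s x] t] [[s' x'] t'].
pose tau := (s^-1 * s')%g; pose y := [ffun j => x (tau^-1%g j) (+) x' j].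
exists tau, y, (t' - torus_perm tau y t); rewrite /= mulKVg subrKC.
by congr (_, _, _); apply/ffunP => j; rewrite !ffunE addbA addbb.
Qed.

(* Words in the r_i commute with the automorphisms, which are transitive on the
   flags, so that such a word is determined by the image of one flag. *)
Lemma r_words_eq (w w' : seq nat) Phi Psi :
  foldr rr Phi w = foldr rr Phi w' -> foldr rr Psi w = foldr rr Psi w'.
Proof.
have [tau [y [c <-]]] := flag_aut_trans Phi Psi.
have E v : foldr rr (flag_aut tau y c Phi) v = flag_aut tau y c (foldr rr Phi v).
  by elim: v => //= i v ->; rewrite flag_aut_r.
by rewrite !E => ->.
Qed.

End FlagMaps.

(** * Cells of the toroid and its intersection property *)

Section Cells.
Variables (n k a : nat) (hn : (1 < n)%N) (ha : (6 * n + 1 <= a)%N).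
Local Notation Tor := (torus k ha).
Local Notation tc := (@torus_class n k a ha).
Local Notation flag := (flag k ha).
Local Notation rr := (@r n k a hn ha).
Local Notation L := (linked n.+1 rr).
Implicit Types (Phi Psi : flag) (s tau : 'S_n) (x y : {ffun 'I_n ->
  bool}) (t c : Tor).

Definition prefix_set (i : nat) s : {set 'I_n} := [set j | (s^-1%g j < i)%N].

Definition suffix_ind (i : nat) s x : 'rV[int]_n :=
  indicator [set j | x j & (i <= s^-1%g j)%N].

(* The face of index i, that is, of rank i - 1. *)
Definition tcell (i : nat) (Phi : flag) : toroid k ha :=
  let: (s, x, t) := Phi in
  if i is i'.+1 then
    if (i' <= n)%N then Cell (prefix_set i' s) (t + tc (suffix_ind i' s x))
    else Top _ _
  else Bottom _ _.

Lemma suffix_indE i s x j : suffix_ind i s x 0 j = (x j && (i <= s^-1%g j)%N)%:R.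
Proof. by rewrite mxE inE. Qed.

Lemma tperm_ltn i m (q : 'I_n) : (0 < i < n)%N -> m != i ->
  (tperm (idx hn i) (idx hn i.+1) q < m)%N = (q < m)%N.
Proof.
move=> i0 mi; have e1 := @idxE n hn i; have e2 := @idxE n hn i.+1.
by case: tpermP => [->|->|//]; rewrite e1 ?e2; lia.
Qed.

Lemma tcell_r i m Phi : (i <= n)%N -> m != i.+1 -> tcell m (rr i Phi) = tcell m Phi.
Proof.
case: Phi m => [[s x] t] [|m]; first by case: (rr _ _) => [[]].
rewrite eqSS => + mi; have [f fi fE] := rP k hn ha i; rewrite fE.
case: fi mi {fE} => [|{}i i0|{}i ni] /= mi i_n; case: ifP => // mn.
- congr (Cell _ (_ + tc _)); apply/rowP => j; rewrite !suffix_indE ffunE.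
  case: (j =P s _) => [->|_]; last by rewrite addbF.
  have -> : (m <= s^-1%g (s (idx hn 1)))%N = false by rewrite permK idxE //; lia.
  by rewrite !andbF.
- have E j : ((tperm (idx hn i) (idx hn i.+1) * s)^-1%g j < m)%N = (s^-1%g j < m)%N.
    by rewrite invMg permM tpermV tperm_ltn.
  congr (Cell _ (_ + tc _)); first by apply/setP => j; rewrite !inE E.
  by apply/rowP => j; rewrite !suffix_indE !(leqNgt m) E.
have {}mn : (m < n)%N by lia.
congr (Cell _); rewrite -addrA -torus_classN -torus_classD; congr (_ + tc _).
apply/rowP => j; rewrite !mxE !inE ffunE eqxx /= eq_sym.
case: (s _ =P j) => [<-|_]; last by rewrite addbF mulr0 oppr0 add0r.
have -> : (m <= s^-1%g (s (idx hn n)))%N by rewrite permK idxE //; lia.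
by rewrite !andbT addbT mulr1; case: (x _); rewrite /pm.
Qed.

Lemma linked_tcell (I : pred nat) Phi Psi : L I Phi Psi ->
  forall m, (m <= n)%N -> ~~ I m -> tcell m.+1 Phi = tcell m.+1 Psi.
Proof.
move=> PP m mn nIm; move: Psi PP.
apply: (@linked_ind _ _ _ (fun Psi => tcell m.+1 Phi = tcell m.+1 Psi)) =>
  // Psi i i_n Ii ->.
rewrite tcell_r // eqSS; by apply: contraNneq nIm => ->.
Qed.

Lemma tcell_inj m s x t s' x' t' : (m <= n)%N ->
    tcell m.+1 (s, x, t) = tcell m.+1 (s', x', t') ->
  prefix_set m s = prefix_set m s' /\
  t + tc (suffix_ind m s x) = t' + tc (suffix_ind m s' x').
Proof. by move=> mn; rewrite /= mn => -[]. Qed.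

Lemma perm_id_of_ltn (f : 'S_n) :
  (forall p q : 'I_n, q = p.+1 :> nat -> (f p < f q)%N) -> f = 1%g.
Proof.
move=> H; apply/permP => p; rewrite perm1; apply/val_inj/eqP; rewrite eqn_leq.
have low m : forall p : 'I_n, p = m :> nat -> (m <= f p)%N.
  elim: m => // m IH q qm; have mn : (m < n)%N by rewrite (leq_trans _ (ltn_ord q))
    // qm.
  by apply: leq_ltn_trans (H (Ordinal mn) q qm); apply: IH.
have high m : forall p : 'I_n, (n - p.+1)%N = m -> (f p <= p)%N.
  elim: m => [|m IH] q qm; first by have := ltn_ord (f q); have := ltn_ord q; lia.
  have mn : (q.+1 < n)%N by lia.
  have {}IH : (f (Ordinal mn) <= q.+1)%N by apply: IH; rewrite /=; lia.
  by rewrite -ltnS; apply: leq_trans (H q (Ordinal mn) erefl) IH.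
by rewrite (high _ p erefl) low.
Qed.

Lemma r_midE (p q : 'I_n) s x t : q = p.+1 :> nat ->
  rr q (s, x, t) = ((tperm p q * s)%g, x, t).
Proof.
move=> qp; have qn := ltn_ord q; rewrite /r qp /= -qp qn.
by congr ((tperm _ _ * _)%g, _, _); apply/val_inj; rewrite /= idxE; lia.
Qed.

Lemma r_highE (p : 'I_n) s x t : n = p.+1 ->
  rr n (s, x, t) = (s, flip x (s p), t - tc (pm (x (s p)) *: e_ (s p))).
Proof.
move=> np; have e : idx hn n = p.
  by apply/val_inj; rewrite /= idxE ?leqnn ?andbT ?(ltnW hn) // [in LHS]np.
by rewrite /r ltnn e; case: eqP => // n0; have := hn; rewrite {1}n0.
Qed.

(** Bubble sort of [f s]. A descent occurs only at a letter of [I], because the prefix sets agree at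
    the others. By the rearrangement inequality each swap increases [mu], which is bounded. *)
Lemma linked_perm (I : pred nat) s s' x t :
    (forall i, (i <= n)%N -> ~~ I i -> prefix_set i s = prefix_set i s') ->
  L I (s, x, t) (s', x, t).
Proof.
pose f (u : 'S_n) : 'S_n := (u * s'^-1)%g;
  pose mu (u : 'S_n) := (\sum_(p < n) p * f u p)%N.
have [m] := ubnP (n * (n * n) - mu s)%N; elim: m s => // m IH s mus H.
have [/forallP inc|] := boolP [forall p : 'I_n, forall q : 'I_n,
    (q == p.+1 :> nat) ==> (f s p < f s q)%N].
  have f1 : f s = 1%g.
    apply: perm_id_of_ltn => p q pq; have /forallP/(_ q)/implyP := inc p.
    by apply; apply/eqP.
  by rewrite -[s](mulgKV s') -/(f s) f1 mul1g linked_refl.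
rewrite negb_forall => /existsP[p]; rewrite negb_forall => /existsP[q].
rewrite negb_imply -leqNgt => /andP[/eqP pq le].
have {le} lt : (f s q < f s p)%N.
  rewrite ltn_neqAle le andbT; apply/eqP => /val_inj/perm_inj e.
  by move: pq; rewrite e; lia.
have qn := ltn_ord q.
have Iq : I q.
  apply: contraT => /(H _ (ltnW qn))/setP E.
  have := E (s p); have := E (s q); rewrite !inE !permK pq leqnn ltnn.
  by move: lt; rewrite /f !permM; lia.
apply: linked_trans (linked_step rr (s, x, t) (leqW qn) Iq) _.
rewrite (r_midE _ _ _ pq); set s1 := (tperm p q * s)%g; apply: IH; last first.
  move=> i i_n nIi; rewrite -H //; apply/setP => j; rewrite !inE invMg permM tpermV.
  have e1 : p = idx hn q by apply/val_inj; rewrite /= idxE; lia.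
  have e2 : q = idx hn q.+1 by apply/val_inj; rewrite /= idxE; lia.
  have -> : tperm p q = tperm (idx hn q) (idx hn q.+1) by congr tperm.
  by rewrite tperm_ltn //; [lia|apply: contraNneq nIi => ->].
have pNq : p != q by rewrite -val_eqE /=; lia.
have E u : mu u = (p * f u p + (q * f u q + \sum_(i < n | (i != p) && (i != q)) i * f
  u i))%N.
  by rewrite /mu (bigD1 p) //= (bigD1 q) //= eq_sym.
have fs1 i : f s1 i = f s (tperm p q i) by rewrite /f /s1 !permM.
have S : (\sum_(i < n | (i != p) && (i != q)) i * f s1 i =
    \sum_(i < n | (i != p) && (i != q)) i * f s i)%N.
  apply: eq_bigr => i /andP[ip iq]; rewrite fs1 tpermD // eq_sym //.
have lt1 : (mu s < mu s1)%N.
  rewrite !E S !fs1 tpermL tpermR; move: lt pq;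
    move: (f s q : nat) (f s p : nat) => b c.
  by move=> bc ->; nia.
have le1 : (mu s1 <= n * (n * n))%N.
  apply: (@leq_trans (\sum_(i < n) n * n)%N); last by rewrite sum_nat_const card_ord.
  by apply: leq_sum => i _; apply: leq_mul; apply: ltnW; apply: ltn_ord.
move: mus lt1 le1; move: (n * (n * n))%N (mu s) (mu s1) => N b c; lia.
Qed.

(** Conjugating [r 0] by adjacent transpositions flips the direction in position [m]. The high flip
    does the same from the other end with [r n], which also moves the facet. *)
Lemma linked_low_flip (I : pred nat) (m : 'I_n) s x t :
  (forall i, (i <= m)%N -> I i) -> L I (s, x, t) (s, flip x (s m), t).
Proof.
case: m => m mn /=; elim: m mn s => [|m IH] mn s II.
  have := linked_step rr (s, x, t) (ltn0Sn n) (II 0%N (leqnn _)); rewrite /=.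
  by rewrite (_ : idx hn 1 = Ordinal mn) //; apply/val_inj; rewrite /= idxE; lia.
have mn' : (m < n)%N by exact: ltnW.
have E u z : rr m.+1 (u, z, t) = ((tperm (Ordinal mn') (Ordinal mn) * u)%g, z, t).
  exact: (@r_midE (Ordinal mn') (Ordinal mn)).
have step u z : L I (u, z, t) ((tperm (Ordinal mn') (Ordinal mn) * u)%g, z, t).
  by rewrite -E; apply: linked_step; [exact: leqW|exact: II].
apply: linked_trans (step s x) _; apply: linked_trans (IH mn' _ _) _.
  by move=> i im; apply: II; apply: leqW.
rewrite permM tpermL; apply: linked_trans (step _ _) _.
by rewrite mulgA tperm2 mul1g linked_refl.
Qed.

Lemma linked_high_flip (I : pred nat) (m : 'I_n) s x t :
  (forall i, (m < i <= n)%N -> I i) ->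
  L I (s, x, t) (s, flip x (s m), t - tc (pm (x (s m)) *: e_ (s m))).
Proof.
have [l] := ubnP (n - m)%N; elim: l m s => // l IH m s ml II.
have [mn|nm] := ltnP m.+1 n; last first.
  have nm' : n = m.+1 by apply/eqP; rewrite eqn_leq nm ltn_ord.
  rewrite -r_highE //; apply: linked_step => //; apply: II.
  by rewrite leqnn ltn_ord.
pose q := Ordinal mn.
have step u z c : L I (u, z, c) ((tperm m q * u)%g, z, c).
  by rewrite -r_midE //; apply: linked_step; [exact: leqW|apply: II; rewrite /= ;
    lia].
apply: linked_trans (step s x t) _; apply: linked_trans (IH q _ _ _) _.
- by rewrite /=; lia.
- by move=> i /= im; apply: II; lia.
rewrite permM tpermR; apply: linked_trans (step _ _ _) _.
by rewrite mulgA tperm2 mul1g linked_refl.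
Qed.

(** A low and a high flip along one direction compose to a unit translation, whose sense depends on
    [x j]. *)
Lemma linked_translate s x t v : L predT (s, x, t) (s, x, t + tc v).
Proof.
have up (j : 'I_n) c : L predT (s, x, c) (s, x, c + tc (pm (x j) *: e_ j)).
  have := linked_low_flip (I := predT) (m := s^-1%g j) s x c (fun _ _ => isT).
  move=> /linked_trans; apply.
  have := linked_high_flip (I := predT) (m := s^-1%g j) s (flip x j) c (fun _ _ =>
    isT).
  rewrite permKV flipK ffunE eqxx addbT -torus_classN -scaleNr.
  by rewrite (_ : - pm (~~ x j) = pm (x j)) // /pm; case: (x j).
have down (j : 'I_n) c : L predT (s, x, c) (s, x, c - tc (pm (x j) *: e_ j)).
  rewrite linked_sym; last exact: rK.
  by have := up j (c - tc (pm (x j) *: e_ j)); rewrite subrK.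
have one (j : 'I_n) c (z : int) : L predT (s, x, c) (s, x, c + tc (z *: e_ j)).
  suff H (m : nat) c' : L predT (s, x, c') (s, x, c' + tc ((pm (x j) * m%:Z) *:
    e_ j)) /\
                        L predT (s, x, c') (s, x, c' - tc ((pm (x j) * m%:Z) *:
                          e_ j)).
    have [m [->|->]] : exists m : nat, z = pm (x j) * m%:Z \/ z = - (pm (x j) * m%:Z).
      case: z => m; [exists m|exists m.+1; rewrite NegzE]; case: (x j);
      rewrite /pm ?expr1 ?expr0 ?mulN1r ?mul1r ?opprK; by [left|right].
    - by have [] := H m c.
    - by rewrite scaleNr torus_classN; have [] := H m c.
  elim: m c' => [|m IH] c'.
    by rewrite mulr0 scale0r torus_class_0 subr0 addr0 !linked_refl.
  rewrite intS [1 + _]addrC mulrDr mulr1 scalerDl torus_classD opprD !addrA.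
  have [u1 u2] := IH c'; split; [apply: linked_trans u1 _|apply: linked_trans u2 _].
  - exact: up.
  - exact: down.
have -> : v = \sum_j v 0 j *: e_ j by rewrite {1}[v]row_sum_delta.
elim: (index_enum _) t => [|j l IH] c.
  by rewrite big_nil torus_class_0 addr0 linked_refl.
rewrite big_cons torus_classD addrA; apply: linked_trans (one j c _) (IH _).
Qed.

(** Once the directions are aligned, the signs are corrected one by one, by a low or a high flip if
    [I] contains the letters needed. Otherwise letters are missing on both sides of the position of
    [j], and the two corresponding shared cells already determine the sign at [j]. *)
Lemma tcell_linked (I : pred nat) Phi Psi :
    (forall m, (m <= n)%N -> ~~ I m -> tcell m.+1 Phi = tcell m.+1 Psi) ->
  L I Phi Psi.
Proof.
case: Phi Psi => [[s x] t] [[s' x'] t'] H.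
have Hs : forall i, (i <= n)%N -> ~~ I i -> prefix_set i s = prefix_set i s'.
  by move=> i i_n nI; have [] := tcell_inj i_n (H i i_n nI).
have L1 := linked_perm x t Hs; apply: linked_trans (L1) _.
have H' m (mn : (m <= n)%N) (nIm : ~~ I m) :
  tcell m.+1 (s', x, t) = tcell m.+1 (s', x', t').
  by rewrite -H // -(linked_tcell L1).
move: H' => {H Hs L1} H.
have [l] := ubnP #|[set j | x j != x' j]|; elim: l x t H => // l IH x t H cl.
have [/eqP|/set0Pn[j]] := boolP ([set j | x j != x' j] == set0).
  move/setP=> e; have {e} exx : x = x'.
    by apply/ffunP => j; have := e j; rewrite !inE => /negbFE/eqP.
  rewrite {}exx in H *.
  have [/forallP allI|] := boolP [forall i : 'I_n.+1, I i].
    have [v ev] := torus_class_surj (t' - t).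
    have := linked_translate s' x' t v; rewrite -ev subrKC.
    by apply: linked_sub => i i_n _; apply: (allI (Ordinal i_n)).
  rewrite negb_forall => /existsP[i nIi].
  have i_n : (i <= n)%N by rewrite -ltnS.
  by have [_ /addIr ->] := tcell_inj i_n (H i i_n nIi); apply: linked_refl.
rewrite inE => xj.
have next c : L I (s', x, t) (s', flip x j, c) -> L I (s', x, t) (s', x', t').
  move=> L2; apply: linked_trans (L2) _; apply: IH => [m mn nIm|].
    by rewrite -(linked_tcell L2) // H.
  rewrite -ltnS; apply: leq_trans cl; rewrite ltnS; apply: proper_card;
    apply/properP; split.
    apply/subsetP => i; rewrite !inE ffunE; case: (eqVneq i j) => [->|_];
      first by rewrite xj.
    by rewrite addbF.
  by exists j; rewrite ?inE // ffunE eqxx addbT; move: xj; case: (x j); case: (x' j).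
pose m := s'^-1%g j; have mj : s' m = j by rewrite permKV.
have [/forallP low|] := boolP [forall i : 'I_n.+1, (i <= m)%N ==> I i].
  apply: (next t); rewrite -mj; apply: linked_low_flip => i im.
  have i_n : (i < n.+1)%N by have := ltn_ord m; lia.
  by have /implyP := low (Ordinal i_n); apply.
rewrite negb_forall => /existsP[i]; rewrite negb_imply => /andP[im nIi].
have [/forallP high|] := boolP [forall i : 'I_n.+1, (m < i)%N ==> I i].
  apply: (next _); rewrite -mj; apply: linked_high_flip => q /andP[mq qn].
  by have /implyP := high (Ordinal (qn : (q < n.+1)%N)); apply.
rewrite negb_forall => /existsP[i']; rewrite negb_imply => /andP[mi' nIi'].
have in_ (q : 'I_n.+1) : (q <= n)%N by rewrite -ltnS.
have [_ E1] := tcell_inj (in_ i) (H i (in_ i) nIi).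
have [_ E2] := tcell_inj (in_ i') (H i' (in_ i') nIi').
(* The difference of the two base points does not involve the facet, and its coordinate at [j] is
   the sign bit. *)
have E : tc (suffix_ind i s' x - suffix_ind i' s' x) =
         tc (suffix_ind i s' x' - suffix_ind i' s' x').
  rewrite !torus_classB -(addrKA t) -[RHS](addrKA t') ![_ + t]addrC ![_ + t']addrC.
  by rewrite E1 E2.
have := torus_class_near (j := j) E;
  rewrite !mxE !inE -/m im leqNgt mi' /= !andbT !andbF.
have a1 : 1 < a%:Z by have := ha; have := hn; lia.
move: xj; case: (x j); case: (x' j) => // _; rewrite !subr0 /= ?sub0r ?normrN.
  by rewrite normr1 => /(_ a1).
by rewrite normr1 => /(_ a1).
Qed.

End Cells.

Lemma card_prefix_set n i (s : 'S_n) : (i <= n)%N -> #|prefix_set i s| = i.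
Proof.
move=> i_n; rewrite -[RHS]card_ord.
have winj : injective (widen_ord i_n) by move=> p q /(congr1 val)/= /val_inj.
rewrite -(card_imset _ (inj_comp (@perm_inj _ s) winj)).
apply: eq_card => j; rewrite inE; apply/idP/imsetP => [ji|[l _ ->]].
  by exists (Ordinal ji) => //=; rewrite (_ : widen_ord _ _ = s^-1%g j) ?permKV //;
    apply/val_inj.
by rewrite /= permK /=.
Qed.

Lemma prefix_set_exists n (D D' : {set 'I_n}) : D \subset D' ->
  exists2 s : 'S_n, prefix_set #|D| s = D & prefix_set #|D'| s = D'.
Proof.
move=> DD'; pose l1 := enum D; pose l2 := enum (D' :\: D); pose l3 := enum (~: D').
pose l := l1 ++ l2 ++ l3.
have sl : size l = n.
  rewrite !size_cat -!cardE addnA; apply: etrans (card_ord n).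
  rewrite -(cardsC D'); congr addn; by rewrite -(cardsID D D'); congr addn;
    move/setIidPr: DD' => ->.
have inl j : j \in l.
  by rewrite !mem_cat !mem_enum !inE; case: (j \in D); case: (j \in D').
have lt j : (index j l < n)%N by move: (inl j); rewrite -index_mem sl.
have ginj : injective (fun j => Ordinal (lt j)).
  by move=> i j [] e; rewrite -(nth_index i (inl i)) e nth_index.
have ind j (m1 m2 : seq 'I_n) : (index j (m1 ++ m2) < size m1)%N = (j \in m1).
  by rewrite index_cat; case: ifP => [|_]; rewrite ?index_mem // ltnNge leq_addr.
exists (perm ginj)^-1%g; apply/setP => j; rewrite inE invgK permE /=.
  by rewrite cardE ind mem_enum.
have -> : #|D'| = size (l1 ++ l2).
  rewrite size_cat -!cardE -(cardsID D D'); congr addn.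
  by move/setIidPr: DD' => ->.
rewrite /l catA ind mem_cat !mem_enum inE; have /subsetP/(_ j) := DD'.
by case: (j \in D) => //= ->.
Qed.

Section CellOrder.
Variables (n k a : nat) (ha : (6 * n + 1 <= a)%N).
Local Notation Tor := (torus k ha).
Local Notation tc := (@torus_class n k a ha).
Local Notation flag := (flag k ha).
Implicit Types (Phi Psi : flag).

Lemma tcell_surj (c : toroid k ha) : exists i Phi, (i <= n.+2)%N /\ c = tcell i Phi.
Proof.
case: c => [|D u|].
- by exists 0%N, (1%g, [ffun=> false], 0).
- have [s sD _] := prefix_set_exists (subxx D).
  exists #|D|.+1, (s, [ffun=> false], u).
  have Dn : (#|D| <= n)%N by rewrite -[X in (_ <= X)%N](card_ord n) max_card.
  split; first by rewrite ltnS ltnW.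
  rewrite /= Dn sD (_ : suffix_ind _ _ _ = 0) ?torus_class_0 ?addr0 //.
  by apply/rowP => j; rewrite suffix_indE ffunE mxE.
- by exists n.+2, (1%g, [ffun=> false], 0); rewrite /= ltnn.
Qed.

Lemma tcell_le (i j : nat) Phi Psi : (i <= n.+2)%N -> (j <= n.+2)%N ->
  (tcell i Phi <= tcell j Psi)%O <->
  (i <= j)%N /\ exists Theta, tcell i Theta = tcell i Phi /\ tcell j Theta = tcell j
    Psi.
Proof.
case: Phi Psi => [[s x] t] [[s' x'] t'].
rewrite /Order.le /=.
case: i => [|i] i_n.
  by split=> // _; split=> //; exists (s', x', t').
case: j => [|j] j_n /=; first by case: ifP => //; split=> [//|[]//].
have [jn|nj] := leqP j n; last first.
  have ij : (i.+1 <= j.+1)%N by lia.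
  split=> _; last by case: ifP.
  by split=> //; exists (s, x, t); rewrite /= (leqNgt j) nj.
have [in_|ni] := leqP i n; last first.
  by split=> [//|[]]; lia.
split=> [/andP[DD /existsP[E /andP[sE /eqP eE]]]|[ij [[[s2 x2] t2] /=]]].
  have [s2 e1 e2] := prefix_set_exists DD.
  rewrite !card_prefix_set // in e1 e2.
  have ij : (i <= j)%N.
    by rewrite -(card_prefix_set s in_) -(card_prefix_set s' jn) subset_leq_card.
  (* The directions run through the smaller cell, then the larger one; the signs record the step [E]
     between the base points. *)
  split=> //; exists (s2, [ffun l => l \in E], t' + tc (suffix_ind j s' x')).
  rewrite /= in_ jn e1 e2; split; congr Cell.
    rewrite eE; congr (_ + tc _); congr indicator; apply/setP => l.
    rewrite inE ffunE; case: (boolP (l \in E)) => //= lE.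
    have := subsetP sE _ lE; rewrite inE => /andP[+ _].
    by rewrite -e1 inE -leqNgt => ->.
  rewrite (_ : suffix_ind j s2 _ = 0) ?torus_class_0 ?addr0 //.
  apply/rowP => l; rewrite suffix_indE ffunE mxE; case: (boolP (l \in E)) => //= lE.
  have := subsetP sE _ lE; rewrite inE => /andP[_].
  by rewrite -e2 inE ltnNge => /negbTE ->.
rewrite in_ jn => -[[e1 e2] [e3 e4]]; apply/andP; split.
  by rewrite -e1 -e3; apply/subsetP => l; rewrite !inE => /leq_trans; apply.
apply/existsP; exists [set l in prefix_set j s2 :\: prefix_set i s2 | x2 l].
apply/andP; split.
  by rewrite -e1 -e3; apply/subsetP => l; rewrite inE => /andP[].
rewrite -e2 -e4 -addrA -torus_classD; apply/eqP; congr (_ + tc _).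
apply/rowP => l; rewrite !mxE !inE -leqNgt; have := ij.
case: (x2 l); rewrite ?andbF //= andbT.
by case: (leqP i (s2^-1%g l)) => [il|li] /=; case: (leqP j (s2^-1%g l)) => //= jl;
  lia.
Qed.

End CellOrder.

(** * The reflections rho and the root flags *)

Section Shifts.
Variables (n k a : nat) (hn : (1 < n)%N) (ha : (6 * n + 1 <= a)%N).
Local Notation Tor := (torus k ha).
Local Notation tc := (@torus_class n k a ha).
Local Notation flag := (flag k ha).
Local Notation rr := (@r n k a hn ha).
Implicit Types (Phi Psi : flag) (s tau : 'S_n) (x y : {ffun 'I_n ->
  bool}) (t c : Tor).

Lemma h_powE (i : int) s x t :
  perm_zpow (h k ha) i (s, x, t) = (s, x, t + tc (i *: h_shift s x)).
Proof.
have H m u : ((h k ha) ^+ m)%g (s, x, u) = (s, x, u + tc (m%:Z *: h_shift s x)).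
  elim: m u => [|m IH] u; first by rewrite expg0 perm1 scale0r torus_class_0 addr0.
  rewrite expgS permM permE /= IH -addrA -torus_classD -{1}[h_shift s x]scale1r.
  by rewrite -scalerDl intS.
case: i => m; first exact: H.
rewrite /perm_zpow; apply: (canLR (permK _)); rewrite H NegzE scaleNr torus_classN.
by rewrite subrK.
Qed.

Lemma hbar_powE (i : int) Phi :
  perm_zpow (hbar k hn ha) i Phi = rr 0 (perm_zpow (h k ha) i (rr 0 Phi)).
Proof.
have H m Psi : ((hbar k hn ha) ^+ m)%g Psi = rr 0 (((h k ha) ^+ m)%g (rr 0 Psi)).
  elim: m Psi => [|m IH] Psi; first by rewrite !expg0 !perm1 rK.
  by rewrite !expgS !permM permE IH rK.
case: i => m; first exact: H.
by rewrite /perm_zpow; apply: (canLR (permK _)); rewrite H rK permKV rK.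
Qed.

Definition no_signs : {ffun 'I_n -> bool} := [ffun=> false].

Lemma Phi_E i : Phi_ k ha i = (1%g, no_signs, tc (i *: h_shift 1 no_signs)).
Proof. by rewrite /Phi_ h_powE add0r. Qed.

Lemma F_E i : F_ k ha i = tc (i *: h_shift 1 no_signs).
Proof. by rewrite /F_ Phi_E. Qed.

(** Over the integers, the largest absolute value of a coordinate is [n] times that of the exponent;
    since the entries of [v0] are distinct, the other absolute values then give the permutation. *)
Lemma h_shift_inj (i j : int) s s' x x' : `|i| <= 3 -> `|j| <= 3 ->
    tc (i *: h_shift s x) = tc (j *: h_shift s' x') ->
  i != 0 -> s = s' /\ forall m, i * pm (x m) = j * pm (x' m).
Proof.
move=> i3 j3 e i0.
have bnd (b : bool) (l : int) (m : 'I_n) : `|l| <= 3 ->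
  `|l * (pm b * m.+1%:Z)| <= (3 * n)%N%:Z.
  move=> l3; rewrite !normrM normr_pm mul1r; have := ltn_ord m.
  have -> : `|m.+1%:Z| = m.+1%:Z by [].
  by move: l3; move: `|l| => {}l; nia.
have E m : i * (pm (x m) * (s^-1%g m).+1%:Z) = j * (pm (x' m) * (s'^-1%g m).+1%:Z).
  have := torus_class_near (j := m) e; rewrite !mxE /v0; apply.
  apply: le_lt_trans (ler_normB _ _) _.
  have := lerD (bnd (x m) i (s^-1%g m) i3) (bnd (x' m) j (s'^-1%g m) j3).
  by move=> /le_lt_trans; apply; have := ha; lia.
have A m : `|i| * (s^-1%g m).+1%:Z = `|j| * (s'^-1%g m).+1%:Z.
  by have := congr1 Num.norm (E m); rewrite !normrM !normr_pm !mul1r.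
have n0 : (n.-1 < n)%N by lia.
pose q := Ordinal n0.
have ij : `|i| = `|j|.
  have := A (s q); have := A (s' q); rewrite !permK /=.
  have := ltn_ord (s'^-1%g (s q)); have := ltn_ord (s^-1%g (s' q)).
  move: (nat_of_ord (s'^-1%g (s q))) (nat_of_ord (s^-1%g (s' q))) => b c bn cn.
  move: `|i| `|j| (normr_ge0 i) (normr_ge0 j) => I J.
  nia.
have ss m : s^-1%g m = s'^-1%g m.
  apply/val_inj; have := A m; rewrite -ij => /mulfI; rewrite normr_eq0 => /(_ i0).
  by case.
split=> [|m]; first by apply: invg_inj; apply/permP.
have := E m; rewrite -ss !mulrA => /mulIf; apply; by [].
Qed.

End Shifts.

Section Colors.
Variables (n k a : nat) (hn : (1 < n)%N) (ha : (6 * n + 1 <= a)%N).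
Local Notation flag := (flag k ha).
Local Notation rr := (@r n k a hn ha).
Implicit Types (Phi Psi : flag) (s tau : 'S_n) (x y : {ffun 'I_n -> bool}).

Definition parity x : bool := \big[addb/false]_j x j.

Lemma whiteE s x t : white ((s, x, t) : flag) = ~~ (s (+) parity x).
Proof.
rewrite /white (_ : \prod_i pm (x i) = (-1) ^+ parity x).
  by rewrite -signr_addb; case: (_ (+) _).
by apply/esym/(big_morph (fun b : bool => (-1) ^+ b)) => // b c; rewrite signr_addb.
Qed.

Lemma parity0 : parity (no_signs n) = false.
Proof. by rewrite /parity big1 // => j _; rewrite ffunE. Qed.

Lemma parity_flip x j : parity (flip x j) = ~~ parity x.
Proof.
rewrite /parity (eq_bigr (fun i => x i (+) (i == j))) => [|i _];
  last by rewrite ffunE.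
rewrite big_split /= [X in _ (+) X](bigD1 j) //= eqxx [X in true (+) X]big1 ?addbT //.
by move=> i /negbTE.
Qed.

Lemma parity_perm x tau : parity [ffun j => x (tau j)] = parity x.
Proof.
rewrite /parity [RHS](reindex_inj (h := tau) perm_inj) /=.
by apply: eq_bigr => j _; rewrite ffunE.
Qed.

Lemma parityD x y : parity [ffun j => x j (+) y j] = parity x (+) parity y.
Proof. by rewrite /parity -big_split; apply: eq_bigr => j _; rewrite ffunE. Qed.

Lemma white_r i Phi : white (rr i Phi) = ~~ white Phi.
Proof.
case: Phi => [[s x] t]; have [f fi fE] := rP k hn ha i; rewrite fE.
case: fi {fE} => [|{}i i0|{}i ni]; rewrite !whiteE ?parity_flip ?addbN ?negbK //.
rewrite odd_permM odd_tperm; have -> : idx hn i != idx hn i.+1.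
  by rewrite -val_eqE /= !idxE; lia.
by rewrite addTb addNb negbK.
Qed.

End Colors.

Section Rho.
Variables (n k a : nat) (hn : (1 < n)%N) (ha : (6 * n + 1 <= a)%N).
Local Notation Tor := (torus k ha).
Local Notation tc := (@torus_class n k a ha).
Local Notation flag := (flag k ha).
Local Notation rr := (@r n k a hn ha).
Implicit Types (Phi Psi : flag) (s tau : 'S_n) (x y : {ffun 'I_n ->
  bool}) (t c : Tor).

(** A symmetry of the cube applied inside each facet: unlike [flag_aut], it does not move the
    facet. *)
Definition cube_map tau y Phi : flag := let: (s, x, t) := Phi in
  ((s * tau)%g, [ffun j => x (tau^-1%g j) (+) y j], t).

Lemma r_low_fst j (q : 'S_n * {ffun 'I_n -> bool}) t t' : (j < n)%N ->
  rr j (q, t) = ((rr j (q, t')).1, t).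
Proof.
case: q => [s x] jn; have [f fj fE] := rP k hn ha j; rewrite !fE.
by case: fj jn {fE} => // {}j nj; rewrite ltnNge nj.
Qed.

Lemma cube_map_r tau y j Phi : (j < n)%N ->
  cube_map tau y (rr j Phi) = rr j (cube_map tau y Phi).
Proof.
have E Psi : cube_map tau y Psi = ((flag_aut tau y 0 Psi).1, Psi.2).
  by case: Psi => [[]].
case: Phi => [q t] jn; rewrite !E flag_aut_r (surjective_pairing (flag_aut _ _ _ _)).
rewrite [RHS](r_low_fst _ _ (flag_aut tau y 0 (q, t)).2) //; congr (_, _).
by rewrite (r_low_fst q t 0 jn).
Qed.

Lemma cube_map_inj tau y : injective (cube_map tau y).
Proof.
move=> [[s x] t] [[s' x'] t'] [/mulIg -> /ffunP e ->]; congr (_, _, _).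
by apply/ffunP => j; have := e (tau j); rewrite !ffunE permK => /addIb.
Qed.

Lemma r_low_facet j Phi : (j < n)%N -> facet (rr j Phi) = facet Phi.
Proof. by case: Phi => [q t] jn; rewrite (r_low_fst q t 0 jn). Qed.

Lemma facet_linked Phi Psi : facet Phi = facet Psi ->
  linked n.+1 rr (fun j => (j < n)%N) Phi Psi.
Proof.
case: Phi Psi => [[s x] t] [[s' x'] t'] /= e; rewrite /facet /= in e.
apply: tcell_linked => m mn; rewrite -leqNgt => nm.
have -> : m = n by apply/eqP; rewrite eqn_leq mn.
rewrite /= leqnn e; congr (Cell _ (_ + tc _)).
  by apply/setP => j; rewrite !inE !ltn_ord.
by apply/rowP => j; rewrite !suffix_indE ![(n <= _)%N]leqNgt !ltn_ord !andbF.
Qed.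

Variables (p : nat) (root : Tor -> 'Z_(3 * p) -> flag).

(** The flags of a facet are connected by [r_0, ..., r_{n-1}], so a map commuting with these is
    determined by its value at the root flag. Exhibiting the cube symmetry also shows that the
    [pick] in [rho] succeeds. *)
Lemma rho_cube_map i F l tau y Phi :
    facet (root F l) = F -> cube_map tau y (root F l) = rr i (root F l) ->
    facet Phi = F -> rho hn root i F l Phi = cube_map tau y Phi.
Proof.
move=> rF ri PF.
pose g Psi := if facet Psi == F then cube_map tau y Psi else Psi.
have facet_cube Psi : facet (cube_map tau y Psi) = facet Psi by case: Psi => [[]].
have ginj : injective g.
  move=> A B; rewrite /g; case: eqP => [AF|AF]; case: eqP => [BF|BF] //.
  - exact: cube_map_inj.
  - by move=> e; case: BF; rewrite -e facet_cube.
  - by move=> e; case: AF; rewrite e facet_cube.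
have rhog : is_rho hn root i F l (perm ginj).
  apply/and3P; split.
  - by apply/subsetP => Psi; rewrite !inE permE /g; case: ifP => // _ /eqP.
  - apply/forallP => j; apply/forallP => Psi; apply/implyP => /eqP PsiF.
    by rewrite !permE /g r_low_facet ?PsiF ?eqxx // cube_map_r.
  - by rewrite permE /g rF eqxx ri.
rewrite /rho; case: pickP => [s /and3P[_ /'forall_'forall_implyP sC /eqP sr]|];
  last first.
  by move/(_ (perm ginj)); rewrite rhog.
have : facet (root F l) = facet Phi by rewrite rF PF.
move/facet_linked => L.
suff [] : s Phi = cube_map tau y Phi /\ facet Phi = F by [].
move: Phi L {PF}; apply: linked_ind => [|Psi j jn j_n [e PF]].
  by rewrite sr ri.
have /eqP -> := sC (Ordinal j_n) Psi (introT eqP PF).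
by rewrite e cube_map_r ?r_low_facet.
Qed.

Definition axis F l : 'I_n := (root F l).1.1 (idx hn 1).

Lemma rho0E s x t l : facet (root t l) = t ->
  rho hn root 0 t l (s, x, t) = (s, flip x (axis t l), t).
Proof.
move=> rF; pose y : {ffun 'I_n -> bool} := [ffun j => j == axis t l].
have E s' x' t' : cube_map 1%g y (s', x', t') = (s', flip x' (axis t l), t').
  rewrite /= mulg1; congr (_, _, _); apply/ffunP => j.
  by rewrite !ffunE invg1 perm1.
apply: etrans (E _ _ _); apply: rho_cube_map => //.
by move: (E); rewrite /axis; case: (root t l) => [[s0 x0] t0] ->.
Qed.

(** Chosen so that the signs [x0] of the root flag, and hence its vertex, are fixed. *)
Definition rho1_sign tau (x0 : {ffun 'I_n -> bool}) : {ffun 'I_n -> bool} :=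
  [ffun j => x0 (tau^-1%g j) (+) x0 j].

Lemma rho1E t l : facet (root t l) = t ->
  exists u v : 'I_n, u != v /\
  forall s x, rho hn root 1 t l (s, x, t) =
    cube_map (tperm u v) (rho1_sign (tperm u v) (root t l).1.2) (s, x, t).
Proof.
case e : (root t l) => [[s0 x0] F0]; rewrite /facet /= => F0t.
exists (s0 (idx hn 1)), (s0 (idx hn 2)); split.
  by rewrite (inj_eq perm_inj) -val_eqE /= !idxE //; lia.
move=> s x; apply: rho_cube_map => //; rewrite e //.
rewrite /r /= hn -tpermJ; congr (_, _, _); first by rewrite -conjgC.
by apply/ffunP => j; rewrite !ffunE addbA addbb.
Qed.

Hypothesis root_facet : forall F l, facet (root F l) = F.

(** The first two side conditions make the cube symmetry an involution, the third makes it reverse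
    colours. *)
Lemma rho_levelE l t : exists tau y, (forall s x,
   rho_level hn root l (s, x, t) = cube_map tau y (s, x, t)) /\
  [/\ tau^-1%g = tau, (forall j, y (tau j) = y j) & tau (+) parity y].
Proof.
rewrite /rho_level /facet /=; case: ifP => _.
  have [u [v [uv E]]] := rho1E (root_facet t l).
  exists (tperm u v), (rho1_sign (tperm u v) (root t l).1.2); split=> //; split.
  - by rewrite tpermV.
  - by move=> j; rewrite !ffunE tpermV tpermK addbC.
  - rewrite odd_tperm uv /rho1_sign tpermV.
    have := parityD [ffun j => (root t l).1.2 (tperm u v j)] (root t l).1.2.
    rewrite parity_perm addbb => E'.
    set Y := finfun _; have -> // : parity Y = false.
    by rewrite -E'; congr parity; apply/ffunP => j; rewrite !ffunE.
exists 1%g, [ffun j => j == axis t l]; split.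
  move=> s x; rewrite rho0E // /= mulg1; congr (_, _, _).
  by apply/ffunP => j; rewrite !ffunE invg1 perm1.
split=> [|j|]; rewrite ?invg1 ?perm1 //.
set Y := finfun _; suff -> : Y = flip (no_signs n) (axis t l).
  by rewrite parity_flip parity0 odd_perm1.
by apply/ffunP => j; rewrite !ffunE.
Qed.

Lemma facet_rho_level l Phi : facet (rho_level hn root l Phi) = facet Phi.
Proof.
by case: Phi => [[s x] t]; have [tau [y [-> _]]] := rho_levelE l t.
Qed.

Lemma rho_level_r l j Phi : (j < n)%N ->
  rho_level hn root l (rr j Phi) = rr j (rho_level hn root l Phi).
Proof.
move=> jn; case: Phi => [[s x] t]; have [tau [y [E _]]] := rho_levelE l t.
have := r_low_facet (s, x, t) jn; case e : (rr j (s, x, t)) => [[s' x'] t'].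
rewrite /facet /= => t't; rewrite t't in e *; rewrite !E -e.
exact: cube_map_r.
Qed.

Lemma rho_levelK l : involutive (rho_level hn root l).
Proof.
move=> [[s x] t]; have [tau [y [E [tauV yC _]]]] := rho_levelE l t.
rewrite E {1}/cube_map E /= tauV -mulgA -{2}tauV mulgV mulg1; congr (_, _, _).
apply/ffunP => j; rewrite !ffunE yC -addbA addbb addbF.
by rewrite -{1}tauV permK.
Qed.

Lemma white_rho_level l Phi : white (rho_level hn root l Phi) = ~~ white Phi.
Proof.
case: Phi => [[s x] t]; have [tau [y [E [tauV yC py]]]] := rho_levelE l t.
rewrite E /cube_map !whiteE odd_permM.
have -> : parity [ffun j => x (tau^-1%g j) (+) y j] = parity x (+) parity y.
  rewrite -(parity_perm x tau^-1%g) -parityD; congr parity.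
  by apply/ffunP => j; rewrite !ffunE.
by rewrite addbACA py addbT.
Qed.

Lemma rho_level_axis l s x t : ~~ in_H hn t l ->
  rho_level hn root l (s, x, t) = (s, flip x (axis t l), t).
Proof. by move=> /negbTE nH; rewrite /rho_level /facet /= nH rho0E. Qed.

End Rho.

Section Levels.
Variables (p : nat) (hp : prime p).
Local Notation Z := 'Z_(3 * p)%N.
Implicit Types l : Z.

Definition lev l : nat := (l %% 3)%N.

Lemma Z_gt1 : (1 < 3 * p)%N.
Proof. by have := prime_gt1 hp; lia. Qed.

Lemma lev_lt l : (lev l < 3)%N. Proof. exact: ltn_mod. Qed.

Lemma level_add1 l : (l + 1 : Z) = ((l + 1) %% (3 * p))%N :> nat.
Proof.
rewrite /=; move: (nat_of_ord l) => x.
by rewrite Zp_cast ?Z_gt1 // (@modn_small 1 (3 * p)) ?Z_gt1.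
Qed.

Lemma lev_add1 l : lev (l + 1) = ((lev l).+1 %% 3)%N.
Proof. by rewrite /lev level_add1 modn_dvdm ?dvdn_mulr // addn1 -[in RHS]addn1
  modnDml addn1. Qed.

Lemma lev_sub1 l : lev (l - 1) = ((lev l).+2 %% 3)%N.
Proof.
have := lev_add1 (l - 1); rewrite subrK; have := lev_lt (l - 1).
by case: (lev (l - 1)) => [|[|[|]]] // _ ->.
Qed.

End Levels.

Section Roots.
Variables (n k a p : nat) (hn : (1 < n)%N) (ha : (6 * n + 1 <= a)%N).
Variables (hp : prime p) (root : torus k ha -> 'Z_(3 * p)%N -> flag k ha).
Hypothesis hroot : is_root_choice hn root.
Local Notation Tor := (torus k ha).
Local Notation tc := (@torus_class n k a ha).
Local Notation Z := 'Z_(3 * p)%N.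
Local Notation rr := (@r n k a hn ha).
Local Notation F_ := (@F_ n k a ha).
Implicit Types (Phi Psi : flag k ha) (s : 'S_n) (x y : {ffun 'I_n ->
  bool}) (t F : Tor) (l : Z).

Lemma root_facet F l : facet (root F l) = F.
Proof.
case: (hroot F l) => [[i [_ -> ->]]|[_ [_ [Phi [j [_ _ _ ->
  ->]]]]]|[_ _ [_ []]]|[_ _ _ ->]] //.
Qed.

(** Any [Phi_ j] will do, since all of them have the trivial permutation and thus the same axis. *)
Lemma root_F i l : `|i| <= 3 -> exists j, root (F_ i) l = Phi_ k ha j.
Proof.
move=> i3; have H : exists Psi, root_rule1 (F_ i) Psi by exists (Phi_ k ha i), i.
by case: (hroot (F_ i) l) => [[j [_ _ ->]]|[]|[]|[]] //; exists j.
Qed.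

Lemma axis_F i l : `|i| <= 3 -> axis hn root (F_ i) l = idx hn 1.
Proof. by move=> /(root_F l)[j e]; rewrite /axis e Phi_E perm1. Qed.

Lemma F_inj i j : `|i| <= 3 -> `|j| <= 3 -> F_ i = F_ j -> i = j.
Proof.
rewrite !F_E => i3 j3 e.
have E i' j' : `|i'| <= 3 -> `|j'| <= 3 ->
    tc (i' *: h_shift 1 (no_signs n)) = tc (j' *: h_shift 1 (no_signs n)) ->
    i' != 0 -> i' = j'.
  move=> i3' j3' e' i0; have [_ /(_ (idx hn 1))] := h_shift_inj hn i3' j3' e' i0.
  by rewrite ffunE /pm expr0 !mulr1.
have [i0|/(E _ _ i3 j3 e) //] := eqVneq i 0.
have [j0|/(E _ _ j3 i3 (esym e)) //] := eqVneq j 0.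
by rewrite i0 j0.
Qed.

Lemma F_eq i j : `|i| <= 3 -> `|j| <= 3 -> (F_ i == F_ j) = (i == j).
Proof. by move=> i3 j3; apply/eqP/eqP => [/F_inj|->] //; apply. Qed.

Lemma in_H_F i l : `|i| <= 3 -> in_H hn (F_ i) l = false.
Proof.
move=> i3; apply/negbTE; rewrite negb_and; apply/orP; left.
(* The first coordinate [i] would be 0 or -1, and the second, [2 * i], would be -3 or -4. *)
apply/existsP => -[eps /eqP]; rewrite F_E => e.
have b (c : bool) : c%:R = (c : nat)%:Z :> int by case: c.
have i1 := @idxE n hn 1; have i2 := @idxE n hn 2.
have ne : idx hn 1 != idx hn 2 by rewrite -val_eqE /= i1 ?i2; lia.
have := torus_class_near (j := idx hn 1) e;
  have := torus_class_near (j := idx hn 2) e.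
rewrite !mxE !ffunE /pm expr0 !mul1r invg1 !perm1 /v0 !eqxx (negbTE ne) /= i1 ?i2;
  lia.
Qed.

Lemma root_rule2_sigma F l Psi : root_rule2 hn F l Psi ->
  forall j s y, 0 < `|j| <= 3 -> F = tc (j *: h_shift s y) -> Psi.1.1 = s.
Proof.
move=> [_ [[[s' x'] t'] [j' [_ F0 /andP[j'0 j'3] FE ->]]]] j s y /andP[j0 j3] E.
rewrite hbar_powE /= h_powE /=; rewrite hbar_powE /= h_powE /facet /= in FE.
rewrite /facet /= in F0; rewrite F0 F_E scale0r torus_class_0 add0r E in FE.
by have [|-> _] := h_shift_inj hn j3 j'3 FE; rewrite -?normr_gt0.
Qed.

(** By [r_0] the black flag [(s, y)] over [F_0] becomes a white one, whose image under [hbar^j] has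
    facet [t]: rule 2 applies unless rule 1 does, and then [s] is trivial. In both cases the axis is
    the first direction. *)
Lemma axis_h_shift s y j l t : 0 < `|j| <= 3 -> lev l != 1%N ->
    ~~ white ((s, y, 0) : flag k ha) -> t = tc (j *: h_shift s y) ->
  axis hn root t l = s (idx hn 1).
Proof.
move=> /andP[j0 j3] l1 nw tE; rewrite /axis.
have F0 : 0 = F_ 0 by rewrite F_E scale0r torus_class_0.
have r2 : root_rule2 hn t l (rr 0 (s, y, t)).
  split=> //; exists (rr 0 (s, y, 0)), j.
  rewrite !hbar_powE rK h_powE add0r -tE white_r; split=> //.
  by rewrite j0.
case: (hroot t l) => [[i [i3 e ->]]|[_ /root_rule2_sigma/(_ j s y)->]|[_ n2 _]|[_ n2
  _ _]].
- rewrite Phi_E /=; rewrite e F_E in tE.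
  by have [|<- _] := h_shift_inj hn j3 i3 (esym tE); rewrite -?normr_gt0.
- by [].
- by rewrite j0.
- by [].
- by case: n2; exists (rr 0 (s, y, t)).
- by case: n2; exists (rr 0 (s, y, t)).
Qed.

End Roots.

(** * Adjacencies on pairs of a flag and a level *)

Section ExtendedFlags.
Variables (n k a p : nat) (hn : (1 < n)%N) (ha : (6 * n + 1 <= a)%N).
Variables (hp : prime p) (root : torus k ha -> 'Z_(3 * p)%N -> flag k ha).
Hypothesis hroot : is_root_choice hn root.
Local Notation Tor := (torus k ha).
Local Notation tc := (@torus_class n k a ha).
Local Notation Z := 'Z_(3 * p)%N.
Local Notation rr := (@r n k a hn ha).
Local Notation F_ := (@F_ n k a ha).
Local Notation Y := (flag k ha * Z)%type.
Implicit Types (Phi Psi : flag k ha) (s : 'S_n) (x y : {ffun 'I_n -> bool}).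
Implicit Types (t F : Tor) (l : Z) (q : Y).

(** With both colours present, [xi_i] is the product of the involutions [ext_adj 0] and
    [ext_adj i]. *)
Definition ext_adj (i : nat) (q : Y) : Y :=
  if (i <= n)%N then (rr i q.1, q.2)
  else (rho_level hn root q.2 q.1, next_level (facet q.1) q.2).

(** Levels come in blocks of three: [F_1] and [F_3] exchange levels within a block, while [F_0]
    joins the last level of a block to the first of the next. *)
Lemma next_F0 l : next_level (F_ 0) l =
  if lev l == 0%N then l - 1 else if lev l == 2%N then l + 1 else l.
Proof. by rewrite /next_level !(F_eq k hn) //= -/(lev l);
  case: (lev l) (lev_lt l) => [|[|[|]]]. Qed.

Lemma next_F1 l : next_level (F_ 1) l =
  if lev l == 0%N then l + 1 else if lev l == 1%N then l - 1 else l.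
Proof. by rewrite /next_level !(F_eq k hn) //= -/(lev l);
  case: (lev l) (lev_lt l) => [|[|[|]]]. Qed.

Lemma next_F3 l : next_level (F_ 3) l =
  if lev l == 1%N then l + 1 else if lev l == 2%N then l - 1 else l.
Proof. by rewrite /next_level !(F_eq k hn) //= -/(lev l);
  case: (lev l) (lev_lt l) => [|[|[|]]]. Qed.

Lemma next_case F :
  (exists2 i : int, i \in [:: 0; 1; 3] & F = F_ i) \/ forall l, next_level F l = l.
Proof.
have [F0|n0] := eqVneq F (F_ 0); first by left; exists 0.
have [F1|n1] := eqVneq F (F_ 1); first by left; exists 1.
have [F3|n3] := eqVneq F (F_ 3); first by left; exists 3.
by right=> l; rewrite /next_level (negbTE n0) (negbTE n1) (negbTE n3).
Qed.

Lemma mem013 (i : int) : i \in [:: 0; 1; 3] -> `|i| <= 3.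
Proof. by rewrite !inE => /or3P[] /eqP ->. Qed.

Lemma next_levelK F : involutive (next_level F : Z -> Z).
Proof.
have lt := lev_lt; move=> l; have [[i im ->]|H] := next_case F; last by rewrite !H.
move: im; rewrite !inE => /or3P[] /eqP ->; rewrite ?next_F0 ?next_F1 ?next_F3;
move: (lt _ l) (lev_add1 hp l) (lev_sub1 hp l);
case e: (lev l) => [|[|[|]]] //= _ e1 e2; by rewrite ?e ?e1 ?e2 /= ?subrK ?addrK.
Qed.

(** Where the level changes, rule 1 gives the same axis at all levels; otherwise the last adjacency
    would not be an involution. *)
Lemma rho_level_next l Phi :
  rho_level hn root (next_level (facet Phi) l) Phi = rho_level hn root l Phi.
Proof.
have [[i /mem013 i3 e]|-> //] := next_case (facet Phi).
have H l' s x := rho_level_axis (root_facet hroot) s x (negbT (in_H_F k hn ha hp l'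
  i3)).
by case: Phi e => [[s x] t]; rewrite {1}/facet /= => ->; rewrite !H !(axis_F hroot).
Qed.

Lemma ext_adjK i : involutive (ext_adj i).
Proof.
case=> Phi l; rewrite /ext_adj; case: ifP => i_n; rewrite i_n /= ?rK //.
rewrite facet_rho_level; last exact: (root_facet hroot).
have E := rho_level_next l (rho_level hn root l Phi).
rewrite facet_rho_level in E; last exact: (root_facet hroot).
by rewrite E (rho_levelK hn (root_facet hroot)) (next_levelK (facet Phi) l).
Qed.

Lemma ext_adj_comm i j q : (i.+1 < j < n.+2)%N ->
  ext_adj i (ext_adj j q) = ext_adj j (ext_adj i q).
Proof.
case: q => Phi l /andP[ij jn]; rewrite /ext_adj /=.
have i_n : (i <= n)%N by lia.
rewrite i_n /=; have [jn'|nj] := leqP j n; rewrite /= ?i_n /=.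
  by rewrite r_comm ?ij.
have i_n' : (i < n)%N by lia.
by rewrite r_low_facet // (rho_level_r hn (root_facet hroot)).
Qed.

Lemma white_ext_adj i q : white (ext_adj i q).1 = ~~ white q.1.
Proof.
rewrite /ext_adj; case: ifP => _ /=; first exact: white_r.
by apply: white_rho_level; apply: (root_facet hroot).
Qed.

Lemma foldr_ext_adj (w : seq nat) q : all (fun i => i <= n)%N w ->
  foldr ext_adj q w = (foldr rr q.1 w, q.2).
Proof.
elim: w => [|i w IH] /=; first by case: q.
by case/andP=> i_n /IH ->; rewrite /ext_adj i_n.
Qed.

Lemma contains_X_H_tcell Phi :
  contains_X_H hn Phi = (tcell 1 Phi == Cell set0 (tc (X_H hn))).
Proof.
case: Phi => [[s x] t]; rewrite /contains_X_H /=.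
have E : suffix_ind 0 s x = - neg_part x.
  by apply/rowP => j; rewrite suffix_indE !mxE opprK andbT; case: (x j).
have -> : prefix_set 0 s = set0 by apply/setP => j; rewrite !inE.
rewrite E torus_classN torus_classD; apply/eqP/eqP => [->|[<-]].
  by rewrite addrK.
by rewrite subrK.
Qed.

Lemma facet_X_H Phi : contains_X_H hn Phi -> facet_incident_X_H hn (facet Phi).
Proof. by case: Phi => [[s x] t] /eqP ->; apply/existsP; exists x. Qed.

Lemma lev1 : lev (1 : Z) = 1%N.
Proof.
have l0 : lev (0 : Z) = 0%N by rewrite /lev mod0n.
by rewrite -[1]add0r (lev_add1 hp) l0.
Qed.

(* On the facets around X_H, whose root flags at level 1 contain X_H, rho is the
   reflection that maps the root flag to its 1-adjacent flag: it fixes X_H. *)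
Lemma contains_X_H_rho Phi : contains_X_H hn Phi ->
  contains_X_H hn (rho_level hn root 1 Phi).
Proof.
case: Phi => [[s x] t] X; have inH : in_H hn t (1 : Z).
  by rewrite /in_H eqxx andbT; apply: facet_X_H X.
have n1 : ~ exists Psi, root_rule1 t Psi.
  by move=> [Psi [i [i3 e _]]]; rewrite e (in_H_F k hn ha hp) in inH.
have n2 : ~ exists Psi, root_rule2 hn t (1 : Z) Psi.
  by move=> [Psi []]; rewrite -/(lev (1 : Z)) lev1.
have [_ [_ r_t r_X]] : root_rule3 hn t (1 : Z) (root t 1).
  have := hroot t 1; case=> [H|[_ H]|[_ _ H]|[_ _ nH _]] //.
  - by case: n1; exists (root t 1).
  - by case: n2; exists (root t 1).
rewrite /rho_level /facet /= inH.
have [u [v [_ ->]]] := rho1E hn (root_facet hroot t 1).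
case e : (root t 1) r_t r_X => [[s0 x0] t0]; rewrite /facet /= => -> X0.
have x0x : x0 = x.
  apply/ffunP => j; move: X X0 => /eqP {1}-> /eqP /(torus_class_near (j := j)).
  rewrite !mxE; have := ha; have := hn.
  by case: (x j); case: (x0 j) => //= ? ? E; exfalso; have {}E := E _; lia.
rewrite x0x; move: X => /eqP ->; apply/eqP; congr (tc (_ + neg_part _)).
by apply/ffunP => j; rewrite !ffunE addKb.
Qed.

Lemma ext_adj_X_H i q : (0 < i)%N -> contains_X_H hn q.1 -> q.2 = 1 ->
  contains_X_H hn (ext_adj i q).1 /\ (ext_adj i q).2 = 1.
Proof.
case: q => Phi l i0 X l1 /=; rewrite /= in X l1; rewrite l1 /ext_adj.
case: ifP => [i_n|_] /=.
  by split=> //; move: X; rewrite !contains_X_H_tcell tcell_r // ltn_eqF.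
split; first exact: contains_X_H_rho.
have [[i' /mem013 i3 e]|-> //] := next_case (facet Phi).
by have := in_H_F k hn ha hp (1 : Z) i3; rewrite -e /in_H facet_X_H.
Qed.

Lemma X_H_flag (b : bool) : exists2 Phi :
  flag k ha, white Phi = b & contains_X_H hn Phi.
Proof.
pose Phi : flag k ha := (1%g, no_signs n, tc (X_H hn + neg_part (no_signs n))).
have wP : white Phi by rewrite whiteE parity0 odd_perm1.
have XP : contains_X_H hn Phi by rewrite /= eqxx.
case: b; first by exists Phi.
exists (rr n Phi); first by rewrite white_r wP.
by move: XP; rewrite !contains_X_H_tcell tcell_r // ltn_eqF // ltnS ltnW.
Qed.

(* Away from level 1 the reflections rho only change signs, so that the flags
   below keep their first j - 1 directions and the corresponding coordinates of
   their facets; the first coordinate being 2, the level does not change. *)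
Definition apart (j : nat) q := q.2 = 0 /\
  (forall m : 'I_n, (m < j.-1)%N -> q.1.1.1 m = m) /\
  exists2 v : 'rV[int]_n, q.1.2 = tc v &
    forall m : 'I_n, (m < j.-1)%N -> v 0 m = if m == 0%N :> nat then 2 else 0.

Lemma ext_adj_apart i j q : (1 < j <= i)%N -> apart j q -> apart j (ext_adj i q).
Proof.
case: q => [[[s x] t] l] /andP[j1 ji] [/= l0 [sE [v vE v0E]]].
rewrite /ext_adj; case: ifP => [i_n|ni]; last rewrite /=.
  have [f fi fE] := rP k hn ha i; rewrite fE;
    case: fi ji i_n {fE} => [|{}i i0|{}i ni] ji i_n; first by lia.
    split=> //=; split; last by exists v.
    move=> m mj; rewrite permM tpermD ?sE // -val_eqE /= idxE; lia.
  split=> //; split=> //; rewrite vE.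
  exists (v - pm (x (s (idx hn n))) *: e_ (s (idx hn n))) => /=.
    by rewrite torus_classB.
  move=> m mj; rewrite !mxE v0E // eqxx /=.
  case: (m =P s _) => [e|_]; last by rewrite mulr0 subr0.
  have := sE m mj; rewrite [RHS]e => /perm_inj/(congr1 val) /=.
  rewrite idxE; lia.
have n0 : (0 < n)%N by lia.
(* The first coordinate of [F_ i'] is [i'], which differs from 2 modulo [a]. *)
have nF (i' : int) : i' \in [:: 0; 1; 3] -> t <> F_ i'.
  move=> i3 e; move: e; rewrite F_E vE => /(torus_class_near (j := Ordinal n0)).
  rewrite v0E /=; last by lia.
  rewrite !mxE !ffunE /pm expr0 mul1r invg1 perm1 /v0 /=.
  have := ha; have := hn; move: i3; rewrite !inE => /or3P[] /eqP -> ? ? E;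
  by exfalso; have {}E := E _; lia.
have nH : in_H hn t (0 : Z) = false.
  by apply/negbTE; rewrite negb_and orbC eq_sym oner_eq0.
rewrite l0 rho_level_axis ?nH //; last exact: (root_facet hroot).
rewrite /facet /=; split; last by split=> //; exists v.
by rewrite /=; have [[i' /nF //]|->] := next_case t.
Qed.

Lemma apart_flag j (b : bool) : exists2 q : Y, white q.1 = b & apart j q.
Proof.
pose v : 'rV[int]_n := \row_m if m == 0%N :> nat then 2 else 0.
pose Phi y : flag k ha := (1%g, y, tc v).
have A y : apart j (Phi y, 0).
  split=> //; split=> [m _|]; first by rewrite perm1.
  by exists v => // m _; rewrite mxE.
have wP : white (Phi (no_signs n)) by rewrite whiteE parity0 odd_perm1.
case: b; first by exists (Phi (no_signs n), 0).
exists (Phi (flip (no_signs n) (idx hn 1)), 0) => //.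
by rewrite [LHS]whiteE parity_flip parity0 odd_perm1.
Qed.

(** The facets agree in the first [j - 1] coordinates, so a common vertex forces equal signs there,
    and a cell of rank below [j] is obtained from the vertex through these coordinates only. *)
Lemma apart_tcell j q q' : (1 < j <= n.+1)%N -> apart j q -> apart j q' ->
    tcell 1 q.1 = tcell 1 q'.1 ->
  forall m, (m < j)%N -> tcell m.+1 q.1 = tcell m.+1 q'.1.
Proof.
case: q q' => [[[s x] t] l] [[[s' x'] t'] l'] /andP[j1 jn].
move=> [/= _ [sE [v vE v0E]]] [/= _ [s'E [v' v'E v'0E]]].
move=> /(tcell_inj (leq0n n))[_ E] m mj; have mn : (m <= n)%N by lia.
have pre (u : 'S_n) : (forall m : 'I_n, (m < j.-1)%N -> u m = m) ->
    forall i : 'I_n, (u^-1%g i < m)%N = (i < m)%N.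
  move=> uE i; apply/idP/idP => lt.
    by have := uE (u^-1%g i); rewrite permKV => ->; lia.
  by rewrite -{1}(uE i) ?permK //; lia.
rewrite /tcell /= mn; congr Cell; first by apply/setP => i; rewrite !inE !pre.
have xx' (i : 'I_n) : (i < j.-1)%N -> x i = x' i.
  move=> ij; move: E; rewrite vE v'E -!torus_classD => /(torus_class_near (j := i)).
  rewrite !mxE !inE v0E // v'0E // !andbT; have := ha; have := hn.
  by case: (x i); case: (x' i) => //= ? ? H; exfalso; have {}H := H _; lia.
have split_ind (u : 'S_n) z : (forall m : 'I_n, (m < j.-1)%N -> u m = m) ->
    suffix_ind m u z = suffix_ind 0 u z - \row_i (z i && (i < m)%N)%:R.
  move=> uE; apply/rowP => i; rewrite !mxE !inE leqNgt pre //.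
  by case: (z i) => //=; case: (i < m)%N.
rewrite !split_ind // !torus_classB !addrA E; congr (_ - tc _).
apply/rowP => i; rewrite !mxE; case: ltnP => im; last by rewrite !andbF.
by rewrite xx' //; lia.
Qed.

End ExtendedFlags.

(** * The flag system of the extension *)

Section Extension.
Variables (n k a p : nat) (hn : (1 < n)%N) (ha : (6 * n + 1 <= a)%N).
Variables (hp : prime p) (root : torus k ha -> 'Z_(3 * p)%N -> flag k ha).
Hypothesis hroot : is_root_choice hn root.
Local Notation Tor := (torus k ha).
Local Notation tc := (@torus_class n k a ha).
Local Notation Z := 'Z_(3 * p)%N.
Local Notation rr := (@r n k a hn ha).
Local Notation F_ := (@F_ n k a ha).
Local Notation Y := (flag k ha * Z)%type.
Local Notation EF := (ext_flag k ha p).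
Local Notation eadj := (ext_adj hn root).
Local Notation eadjK := (ext_adjK hp hroot).
Implicit Types (Phi Psi : flag k ha) (q : Y) (z : EF).

Definition emb z : Y := (val z.1, z.2).

Definition unemb Phi (l : Z) (w : white Phi) : EF := (exist (fun Phi =>
  white Phi) Phi w, l).

Lemma emb_inj : injective emb.
Proof. by move=> [u l] [u' l'] [/val_inj -> ->]. Qed.

Lemma white_xi i z : white (eadj 0 (eadj i (emb z))).1.
Proof. by rewrite !white_ext_adj // negbK; apply: (valP z.1). Qed.

Definition xi_fun i z : EF :=
  unemb (eadj 0 (eadj i (emb z))).2 (white_xi i z).

Lemma emb_xi_fun i z : emb (xi_fun i z) = eadj 0 (eadj i (emb z)).
Proof. exact/esym/surjective_pairing. Qed.

Lemma xi_fun_inj i : injective (xi_fun i).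
Proof.
move=> z z' /(congr1 emb); rewrite !emb_xi_fun.
by move=> /(inv_inj (eadjK 0))/(inv_inj (eadjK i))/emb_inj.
Qed.

Definition xi i : {perm EF} := perm (@xi_fun_inj i).

Lemma emb_xi i z : emb (xi i z) = eadj 0 (eadj i (emb z)).
Proof. by rewrite permE emb_xi_fun. Qed.

Lemma emb_xiV i z : emb ((xi i)^-1%g z) = eadj i (eadj 0 (emb z)).
Proof.
by apply: (inv_inj (eadjK i)); apply: (inv_inj (eadjK 0));
  rewrite -emb_xi permKV !eadjK.
Qed.

Lemma xi0 : xi 0 = 1%g.
Proof. by apply/permP => z; apply: emb_inj; rewrite emb_xi perm1 eadjK. Qed.

Lemma is_xi_xi : is_xi hn root xi.
Proof.
split=> [i z /andP[i0 i_n]|z].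
  by have := emb_xi i z; rewrite /ext_adj leq0n i_n => -[].
have := emb_xi n.+1 z; rewrite /ext_adj leq0n ltnn => -[e1 e2].
split; last exact: e2; apply: etrans e1 _ => /=.
by rewrite (rho_level_r hn (root_facet hroot)) //; lia.
Qed.

Local Notation G := (Gamma xi).

Lemma xi_in i : (i <= n.+1)%N -> xi i \in G.
Proof.
elim: i => [_|i IH i_n]; first by rewrite xi0 group1.
have := mem_gen (imset_f (fun i : 'I_n.+1 =>
  varsigma xi i.+1) (in_setT (Ordinal i_n))).
rewrite /varsigma /=; case: i i_n IH => [|i] i_n IH //=.
  move=> H; apply: (subsetP _ _ H); apply: genS.
  by apply/subsetP => _ /imsetP[j _ ->]; apply/imsetP; exists j.
move=> H; rewrite -[xi i.+2](mulgKV (xi i.+1)); apply: groupM;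
  last exact: IH (ltnW i_n).
apply: (subsetP _ _ H); apply: genS.
by apply/subsetP => _ /imsetP[j _ ->]; apply/imsetP; exists j.
Qed.

(* (g, false) stands for the image of the base flag under g, and (g, true) for its
   0-adjacent flag. Evaluating at a white flag z sends them to g z and r_0 (g z),
   and turns i-adjacency into r_i or, for i = n.+1, into rho. *)
Definition xflag : finType := (subg_of G * bool)%type.
Implicit Types x y : xflag.

Definition xadj (i : nat) x : xflag :=
  if x.2 then (x.1 * (subg G (xi i))^-1, false)%g else (x.1 * subg G (xi i), true)%g.

Lemma xadjK i : involutive (xadj i).
Proof. by case=> g []; rewrite /xadj /= ?mulgK ?mulgKV. Qed.

Lemma subgE g : g \in G -> sgval (subg G g) = g.
Proof. exact: subgK. Qed.

Definition eval z x : Y :=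
  let q := emb (sgval x.1 z) in if x.2 then eadj 0 q else q.

Lemma eval_xadj i z x : (i <= n.+1)%N -> eval z (xadj i x) = eadj i (eval z x).
Proof.
move=> i_n; case: x => g []; rewrite /eval /xadj /= permM ?subgE ?xi_in //.
  by rewrite emb_xiV.
by rewrite emb_xi eadjK.
Qed.

Lemma white_eval z x : white (eval z x).1 = ~~ x.2.
Proof.
case: x => g b; have w : white (emb (sgval g z)).1 := valP (sgval g z).1.
case: b; last exact: w.
by apply: etrans (white_ext_adj hroot 0 _) _; rewrite w.
Qed.

Lemma eval_faithful x y : (forall z, eval z x = eval z y) -> x = y.
Proof.
move=> E; have exy : x.2 = y.2.
  have w1 : white (base_flag k ha).
    by rewrite /base_flag whiteE parity0 odd_perm1.
  have /(congr1 (fun q : Y => white q.1)) := E (unemb 0 w1).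
  by rewrite !white_eval => /negb_inj.
case: x y exy E => [g b] [g' b'] /= <- E; congr (_, _); apply: val_inj.
apply/permP => z; apply: emb_inj; have := E z; rewrite /eval /=.
by case: b {E} => // /(inv_inj (eadjK 0)).
Qed.

Lemma eval_surj x q : white q.1 = ~~ x.2 -> exists z, eval z x = q.
Proof.
case: x => g b; pose q' := if b then eadj 0 q else q => wq.
have w' : white q'.1.
  by move: wq; rewrite /q'; case: (b) => wq; rewrite ?(white_ext_adj hroot 0 q) wq.
exists ((sgval g)^-1%g (unemb q'.2 w')).
rewrite /eval /= permKV /emb /= -surjective_pairing /q'.
by case: (b); rewrite ?eadjK.
Qed.

Lemma xadj_comm i j x : (i.+1 < j < n.+2)%N -> xadj i (xadj j x) = xadj j (xadj i x).
Proof.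
move=> ij; have [i_n jn] : (i <= n.+1)%N /\ (j <= n.+1)%N by lia.
by apply: eval_faithful => z; rewrite !eval_xadj // ext_adj_comm.
Qed.

Lemma xadj_mull i g x :
  xadj i ((g * x.1)%g, x.2) = ((g * (xadj i x).1)%g, (xadj i x).2).
Proof. by case: x => g' []; rewrite /xadj /= mulgA. Qed.

(** Left multiplication preserves adjacency, so the elements linked to the identity form a subgroup.
    It contains [varsigma_i], reached by the adjacencies [i] and then [i - 1]. *)
Lemma xadj_conn x y : linked n.+2 xadj predT x y.
Proof.
pose x0 : xflag := (1%g, false).
suff H u : linked n.+2 xadj predT x0 u.
  by apply: linked_trans (H y); rewrite linked_sym // => i; apply: xadjK.
suff {u} H g : g \in G -> linked n.+2 xadj predT x0 (subg G g, false).
  case: u => g [].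
    have <- : xadj 0 (g, false) = (g, true).
      by rewrite /xadj /= xi0 (_ : subg G 1 = 1%g) ?mulg1 //; apply: val_inj;
        rewrite /= subgE ?group1.
    apply: linked_trans (linked_step _ _ _ _) => //.
    by rewrite -(sgvalK g); apply: H; apply: subgP.
  by rewrite -(sgvalK g); apply: H; apply: subgP.
pose R := [set g in G | linked n.+2 xadj predT x0 (subg G g, false)].
have R1 : group_set R.
  apply/group_setP; split=> [|u v].
    rewrite inE group1 (_ : subg G 1 = 1%g) ?linked_refl //.
    by apply: val_inj; rewrite /= subgE ?group1.
  rewrite !inE => /andP[uG Lu] /andP[vG Lv]; rewrite groupM //=.
  apply: linked_trans Lu _.
  have := @linked_homo _ _ n.+2 xadj xadj (fun x =>
    ((subg G u * x.1)%g, x.2)) predT _ _ _ Lv.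
  rewrite /= mulg1 (_ : (subg G u * subg G v)%g = subg G (u * v));
    first by apply=> i v' _ _; rewrite xadj_mull.
  by apply: val_inj; rewrite /= !subgE ?groupM.
move=> gG; suff : g \in R by rewrite inE => /andP[].
apply: (subsetP _ _ gG); rewrite (gen_subG _ (Group R1)).
apply/subsetP => _ /imsetP[i _ ->].
have i_n := ltn_ord i; have vE : varsigma xi i.+1 = (xi i.+1 * (xi i)^-1)%g.
  by rewrite /varsigma /=; case: (nat_of_ord i) => //=; rewrite xi0 invg1 mulg1.
have vG : varsigma xi i.+1 \in G by rewrite vE groupM ?groupV ?xi_in // ltnW.
rewrite inE vG /=; have -> : (subg G (varsigma xi i.+1),
  false) = xadj i (xadj i.+1 x0).
  rewrite /xadj /= mul1g; congr (_, _); apply: val_inj.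
  by rewrite vE /= !subgE ?groupM ?groupV ?xi_in // ltnW.
apply: linked_trans (linked_step _ _ _ _); [|by rewrite ltnW|by []].
by apply: linked_step.
Qed.

Lemma linked_eval I x y : linked n.+1 xadj I x y ->
  exists2 w, all (fun i => (i < n.+1)%N && I i) w &
    y = foldr xadj x w /\ forall z, eval z y = (foldr rr (eval z x).1 w,
      (eval z x).2).
Proof.
case/linkedP => w aw ->; exists w => //; split=> // z'.
have aw' : all (fun i => i <= n)%N w by apply: sub_all aw => i /andP[].
rewrite -(foldr_ext_adj hn root (eval z' x) aw').
elim: w aw' {aw} => //= i w IH /andP[i_n aw].
by rewrite eval_xadj ?IH // ltnW.
Qed.

(** Toroid words that agree at one flag agree at all of them, so that within a facet a single
    evaluation decides equality. *)
Lemma linked_eval_inj x y y' z : linked n.+1 xadj predT x y ->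
  linked n.+1 xadj predT x y' -> eval z y = eval z y' -> y = y'.
Proof.
move=> /linked_eval[w _ [_ E]] /linked_eval[w' _ [_ E']].
rewrite E E' => -[e]; apply: eval_faithful => z'; rewrite E E'; congr (_, _).
exact: r_words_eq e.
Qed.

Lemma linked_eval_fst (I : pred nat) x y z : linked n.+1 xadj I x y ->
  linked n.+1 rr I (eval z x).1 (eval z y).1.
Proof.
by move=> /linked_eval[w aw [_ ->]]; apply/linkedP; exists w.
Qed.

Lemma linked_lift (I : pred nat) x z Phi : linked n.+1 rr I (eval z x).1 Phi ->
  exists2 y, linked n.+1 xadj I x y & eval z y = (Phi, (eval z x).2).
Proof.
case/linkedP => w aw ->; have L : linked n.+1 xadj I x (foldr xadj x w).
  by apply/linkedP; exists w.
exists (foldr xadj x w) => //.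
have aw' : all (fun i => i <= n)%N w by apply: sub_all aw => i /andP[].
rewrite -(foldr_ext_adj hn root (eval z x) aw').
elim: w aw' {aw L} => //= i w IH /andP[i_n aw].
by rewrite eval_xadj ?IH // ltnW.
Qed.

Lemma linked_eval_sub (I : pred nat) x y z : linked n.+1 xadj predT x y ->
  linked n.+1 rr I (eval z x).1 (eval z y).1 -> linked n.+1 xadj I x y.
Proof.
move=> xy /linked_lift[y' xy' e]; rewrite (@linked_eval_inj x y y' z) //.
  by apply: linked_sub xy'.
have [w _ [_ E]] := linked_eval xy.
by rewrite e [LHS]surjective_pairing E.
Qed.

Lemma ext_flag_inhabited : inhabited EF.
Proof.
have w1 : white (base_flag k ha) by rewrite /base_flag whiteE parity0 odd_perm1.
exact: inhabits (unemb 0 w1).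
Qed.

Lemma facet_inter I J x y : linked n.+1 xadj I x y -> linked n.+1 xadj J x y ->
  linked n.+1 xadj (predI I J) x y.
Proof.
move=> LI LJ; have [z] := ext_flag_inhabited; apply: (@linked_eval_sub _ _ _ z).
  exact: linked_sub LI.
apply: tcell_linked => m mn; rewrite negb_and => /orP[nI|nJ].
  by apply: linked_tcell (linked_eval_fst z LI) _ _ _.
by apply: linked_tcell (linked_eval_fst z LJ) _ _ _.
Qed.

Lemma linked_eval_inv (P : Y -> Prop) (I : pred nat) x y z :
    (forall i q, (i < n.+2)%N -> I i -> P q -> P (eadj i q)) ->
  linked n.+2 xadj I x y -> P (eval z x) -> P (eval z y).
Proof.
move=> HP xy Px; move: y xy; apply: (@linked_ind _ _ _ (fun y => P (eval z y))) =>
  // u i i_n Ii Pu.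
by rewrite eval_xadj //; apply: HP.
Qed.

Lemma facet_section_inter j x y : (j <= n.+1)%N -> linked n.+1 xadj predT x y ->
  linked n.+2 xadj (leq j) x y -> linked n.+1 xadj (leq j) x y.
Proof.
move=> jn Lxy Lj; case: j jn Lj => [|j] jn Lj; first exact: linked_sub Lxy.
have L1 : linked n.+1 xadj (leq 1) x y.
  have [Phi wPhi XPhi] := X_H_flag k hn ha (~~ x.2).
  have [z ez] := @eval_surj x (Phi, 1) wPhi.
  pose P q := contains_X_H hn q.1 /\ q.2 = 1.
  have Px : P (eval z x) by rewrite ez.
  have [|Xy _] := @linked_eval_inv P _ x y z _ Lj Px.
    move=> i q _ ji [X l1]; apply: (ext_adj_X_H hp hroot) => //.
    exact: leq_trans ji.
  apply: (@linked_eval_sub _ _ _ z) => //; apply: tcell_linked => -[_ _|m _ //].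
  have [Xx _] := Px; move: Xx Xy; rewrite !contains_X_H_tcell => /eqP -> /eqP ->.
  by [].
case: j jn Lj => [|j] jn Lj; first exact: L1.
have [q wq Aq] := @apart_flag n k a p hn ha j.+2 (~~ x.2).
have [z ez] := eval_surj wq.
have Ax : apart j.+2 (eval z x) by rewrite ez.
have Ay : apart j.+2 (eval z y).
  apply: (@linked_eval_inv _ _ x y z _ Lj Ax) => i q' _ ji.
  exact: (ext_adj_apart hp hroot).
apply: (@linked_eval_sub _ _ _ z) => //; apply: tcell_linked => m mn.
rewrite -ltnNge => mj; apply: (apart_tcell hn hp _ Ax Ay) => //.
(* [L1], obtained around [X_H], holds at every evaluation point and gives the common vertex here. *)
by apply: (linked_tcell (linked_eval_fst z L1)).
Qed.

Lemma xadj_neq i x : xadj i x != x.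
Proof. by case: x => g []; rewrite /xadj /= xpair_eqE andbF. Qed.

Definition ext_system : flag_system := @FlagSystem n.+2 xflag xadj (1%g, false)
  xadjK xadj_neq xadj_comm xadj_conn
  (linked_inter xadjK xadj_comm facet_inter facet_section_inter).

End Extension.

(** * Facets of the extension *)

Section Facets.
Variables (n k a p : nat) (hn : (1 < n)%N) (ha : (6 * n + 1 <= a)%N).
Variables (hp : prime p) (root : torus k ha -> 'Z_(3 * p)%N -> flag k ha).
Hypothesis hroot : is_root_choice hn root.
Local Notation rr := (@r n k a hn ha).
Local Notation S := (ext_system hp hroot).
Local Notation mkf := (@mk_face S).
Local Notation adjS := (@xadj n k a p hn ha hp root hroot).
Local Notation ev := (@eval n k a p hn ha hp root hroot).
Implicit Types (Phi Psi Theta : flag k ha).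

Lemma in_facetP (y y' : S) :
  linked n.+2 adjS (avoid n.+2) y y' <-> linked n.+1 adjS predT y y'.
Proof.
split=> L; first by apply: linked_sub (linked_strip _ L); rewrite // /avoid eqxx.
apply: linkedW; apply: linked_sub L => i i_n _.
by rewrite /avoid neq_ltn ltnS i_n.
Qed.

(** Evaluation at a fixed [z] is a bijection from the flags through [F] to those of the toroid, with
    inverse [yf]; [key] shows that it matches faces with cells. *)
Lemma facets_toroid (F : face S) : is_facet n.+2 F ->
  face_isomorphic (toroid k ha : finPOrderType _) F.
Proof.
rewrite /is_facet height_fidx => Fd.
have [x0 eF] := face_mk F.
have [z] := ext_flag_inhabited k p ha.
have yfE Phi : exists y : xflag hp hroot,
  linked n.+1 adjS predT x0 y /\ ev z y = (Phi, (ev z x0).2).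
  have : linked n.+1 rr predT (ev z x0).1 Phi by apply: tcell_linked.
  by case/linked_lift => y; exists y.
have [yf yfP] := fin_all_exists yfE.
have yfF Phi Psi : linked n.+1 adjS predT (yf Phi) (yf Psi).
  have [L _] := yfP Phi; have [L' _] := yfP Psi; apply: linked_trans L'.
  by rewrite linked_sym //; apply: xadjK.
have yf_ev y : linked n.+1 adjS predT x0 y -> y = yf (ev z y).1.
  move=> L; have [L' e] := yfP (ev z y).1.
  apply: (linked_eval_inj L L' (z := z)); rewrite e.
  by have [u _ [_ E]] := linked_eval L; rewrite [LHS]surjective_pairing E.
have facetP (y : xflag hp hroot) : (mkf (fidx F) y == F) -> y = yf (ev z y).1.
  rewrite eF eq_sym mk_face_eq fidx_mk eqxx Fd => /in_facetP; exact: yf_ev.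
have key (i : 'I_n.+4) Phi Psi : (i <= n.+2)%N ->
    (mkf i (yf Phi) = mkf i (yf Psi)) <-> tcell i Phi = tcell i Psi.
  move=> i_n; have [_ eP] := yfP Phi; have [_ eQ] := yfP Psi; split=> [/mk_faceP L|e].
    have {}L : linked n.+1 rr (avoid i) Phi Psi.
      have L' := (in_facetP (yf Phi) (yf Psi)).2 (yfF Phi Psi).
      have := @fs_inter S _ _ _ _ L L'.
      move/(@linked_strip _ n.+1 adjS); rewrite /= /avoid eqxx andbF => /(_ isT) {}L.
      have := linked_eval_fst z L; rewrite eP eQ; apply: linked_sub => j _.
      by case/andP.
    case: (nat_of_ord i) i_n L => [|j] j_n L.
      by case: Phi Psi {eP eQ L} => [[? ?] ?] [[? ?] ?].
    have [jn|nj] := leqP j n.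
      by apply: linked_tcell L _ _ _; rewrite // /avoid eqxx.
    by case: Phi Psi {eP eQ L} => [[? ?] ?] [[? ?] ?]; rewrite /= (leqNgt j) nj.
  apply/mk_faceP/linkedW; apply: (linked_eval_sub (yfF _ _) (z := z)).
  rewrite eP eQ; apply: tcell_linked => m mn; rewrite negbK => /eqP im.
  by rewrite im.
have [w wP] := fin_all_exists (@tcell_surj n k a ha).
have {w wP} [wi [wf wP]] : exists (wi : toroid k ha -> 'I_n.+4) wf,
    forall c, (wi c <= n.+2)%N /\ c = tcell (wi c) (wf c).
  have [wf wfP] := fin_all_exists wP.
  exists (fun c => inord (w c)), wf => c; have [c1 c2] := wfP c.
  by rewrite inordK // ltnS ltnW.
have le_F (i : 'I_n.+4) Phi : (i <= n.+2)%N -> (mkf i (yf Phi) <= F)%O.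
  move=> i_n; apply/face_leP; exists (yf Phi), i, (fidx F); split=> //.
    by rewrite Fd.
  rewrite {1}eF; apply/mk_faceP; rewrite Fd; apply/in_facetP.
  by have [] := yfP Phi.
pose f c := mkf (wi c) (yf (wf c)); exists f; split=> [c c'|K].
  have [ci ec] := wP c; have [ci' ec'] := wP c'.
  have T := tcell_le (wf c) (wf c') ci ci'; rewrite -ec -ec' in T.
  apply/idP/idP => [fcc'|/T[ij [Theta [e1 e2]]]]; last first.
    rewrite [RHS]ec in e1; rewrite [RHS]ec' in e2.
    apply/face_leP; exists (yf Theta), (wi c), (wi c').
    by split=> //; apply/key => //; rewrite ?e1 ?e2.
  apply/T; split; first by have := fidx_le fcc'; rewrite !fidx_mk.
  have /chain_sub_mk_flag[y /subsetP sub] : chain [set f c; f c'; F].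
    have h1 := le_F _ (wf c) ci; have h2 := le_F _ (wf c') ci'.
    apply/chainP => A B; rewrite !inE /Order.comparable.
    by move=> /orP[/orP[]|] /eqP -> /orP[/orP[]|] /eqP ->;
       rewrite ?lexx ?fcc' ?h1 ?h2 ?orbT.
  have /facetP ey : mkf (fidx F) y == F.
    by rewrite eq_sym -mem_mk_flag sub // !inE eqxx ?orbT.
  exists (ev z y).1; split.
    rewrite [RHS]ec; apply/key => //; rewrite -ey; apply/esym/eqP.
    by have := sub (f c); rewrite mem_mk_flag => -> //; rewrite !inE eqxx.
  rewrite [RHS]ec'; apply/key => //; rewrite -ey; apply/esym/eqP.
  by have := sub (f c'); rewrite mem_mk_flag => -> //; rewrite !inE eqxx ?orbT.
split=> [/face_leP[y [i [j [ij eK eF']]]]|[c <-]]; last first.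
  by apply: le_F; have [] := wP c.
have jF : j = fidx F by rewrite eF'.
have /facetP ey : mkf (fidx F) y == F by rewrite -jF -eF'.
have i_n : (i <= n.+2)%N by rewrite -Fd -jF.
pose c := tcell i (ev z y).1; have [ci ec] := wP c.
exists c; have ii : wi c = i.
  apply/val_inj/eqP; rewrite eqn_leq /=; apply/andP; split.
    have /(tcell_le _ _ ci i_n)[] // : (tcell (wi c) (wf c) <= tcell i (ev z y).1)%O.
    by rewrite -ec.
  have /(tcell_le _ _ i_n ci)[] // : (tcell i (ev z y).1 <= tcell (wi c) (wf c))%O.
  by rewrite -ec.
rewrite eK ey /f ii; apply/key => //; by rewrite -ii -ec ii.
Qed.

End Facets.

(** * Chirality *)

Section ShiftWords.
Variables (n k a : nat) (hn : (1 < n)%N) (ha : (6 * n + 1 <= a)%N).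
Local Notation rr := (@r n k a hn ha).

Lemma flag_aut_h_pow tau y c j Phi :
  flag_aut tau y c (perm_zpow (h k ha) j Phi) = perm_zpow (h k ha) j (flag_aut tau y
    c Phi).
Proof.
case: Phi => [[s x] t]; rewrite /= !h_powE /=; congr (_, _, _).
rewrite torus_permD addrAC; congr (_ + torus_class _).
apply/rowP => i; rewrite !mxE ffunE pmD invMg permM.
by rewrite /v0; ring.
Qed.

(** A word that is right at the base flag is right everywhere, because [h] commutes with the
    transitive automorphisms of the toroid. *)
Lemma h_pow_word (j : int) : exists2 w, all (fun i => (i < n.+1)%N) w &
  forall Phi, foldr rr Phi w = perm_zpow (h k ha) j Phi.
Proof.
have /linkedP[w aw e] : linked n.+1 rr predT (base_flag k ha)
    (perm_zpow (h k ha) j (base_flag k ha)) by apply: tcell_linked.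
exists w => [|Phi]; first by apply: sub_all aw => i /andP[].
have [tau [y [c <-]]] := flag_aut_trans (base_flag k ha) Phi.
rewrite -flag_aut_h_pow e; elim: w {aw e} => //= i w ->.
by rewrite flag_aut_r.
Qed.

End ShiftWords.

Section Spiral.
Variables (n k a p : nat) (hn : (1 < n)%N) (ha : (6 * n + 1 <= a)%N).
Variables (hp : prime p) (root : torus k ha -> 'Z_(3 * p)%N -> flag k ha).
Hypothesis hroot : is_root_choice hn root.
Local Notation Tor := (torus k ha).
Local Notation tc := (@torus_class n k a ha).
Local Notation Z := 'Z_(3 * p)%N.
Local Notation rr := (@r n k a hn ha).
Local Notation F_ := (@F_ n k a ha).
Local Notation Y := (flag k ha * Z)%type.
Local Notation eadj := (ext_adj hn root).
Local Notation axis := (axis hn root).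
Implicit Types (Phi Psi : flag k ha) (s : 'S_n) (x y : {ffun 'I_n -> bool}).
Implicit Types (t F : Tor) (l : Z) (q : Y).

(* With xi = xi_{n+1}, spiral 2 (-3) 1 is the word h xi h^-3 xi h^2 xi. Through the
   bijection r_0 between white and black flags, its action on the black ones is
   that of the same word in hbar and xi on the white ones. *)
Definition shift (j : int) q : Y := (perm_zpow (h k ha) j q.1, q.2).

Definition turn (j : int) q : Y := shift j (eadj 0 (eadj n.+1 q)).

Definition spiral (j1 j2 j3 : int) q : Y := turn j3 (turn j2 (turn j1 q)).

Lemma shift_inj j : injective (shift j).
Proof. by move=> [P l] [Q l'] [/perm_inj -> ->]. Qed.

Lemma turn_inj j : injective (turn j).
Proof. by move=> q q' /shift_inj/(inv_inj (ext_adjK hp hroot 0))/(inv_inj (ext_adjK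
  hp hroot _)). Qed.

Lemma turnE j s x t l : ~~ in_H hn t l -> turn j ((s, x, t), l) =
  ((s, flip (flip x (axis t l)) (s (idx hn 1)),
    t + tc (j *: h_shift s (flip (flip x (axis t l)) (s (idx hn 1))))),
      next_level t l).
Proof.
move=> nH; rewrite /turn /shift /ext_adj leq0n ltnn /=.
by rewrite (rho_level_axis (root_facet hroot)) //= h_powE.
Qed.

Lemma turn_fix j s x t l : ~~ in_H hn t l -> axis t l = s (idx hn 1) ->
  turn j ((s, x, t), l) = ((s, x, t + tc (j *: h_shift s x)), next_level t l).
Proof. by move=> nH ax; rewrite turnE // ax flipK. Qed.

Lemma F_0 : F_ 0 = 0.
Proof. by rewrite F_E scale0r torus_class_0. Qed.

Lemma next_F (i : int) l : `|i| <= 3 -> i \notin [:: 0; 1;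
  3] -> next_level (F_ i) l = l.
Proof.
move=> i3; rewrite !inE !negb_or => /and3P[/negbTE n0 /negbTE n1 /negbTE n3].
by rewrite /next_level !(F_eq k hn) // n0 n1 n3.
Qed.

Definition pt s y (i : int) : flag k ha := (s, y, tc (i *: h_shift s y)).

Lemma turn_pt i j s y l : ~~ in_H hn (tc (i *: h_shift s y)) l ->
    axis (tc (i *: h_shift s y)) l = s (idx hn 1) ->
  turn j (pt s y i, l) = (pt s y (i + j), next_level (tc (i *: h_shift s y)) l).
Proof. by move=> nH ax; rewrite turn_fix // -torus_classD -scalerDl. Qed.

Lemma Phi_pt i : Phi_ k ha i = pt 1%g (no_signs n) i.
Proof. by rewrite Phi_E. Qed.

Lemma turn_Phi i j l : `|i| <= 3 ->
  turn j (pt 1%g (no_signs n) i, l) = (pt 1%g (no_signs n) (i + j),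
    next_level (F_ i) l).
Proof.
by move=> i3; rewrite turn_pt -?F_E ?(in_H_F k hn ha hp) ?(axis_F hroot) ?perm1.
Qed.

Lemma spiral_Phi1 l : lev l = 0%N ->
  spiral 2 (-3) 1 (pt 1%g (no_signs n) 1, l) = (pt 1%g (no_signs n) 1, l + 3%:R) /\
  lev (l + 3%:R) = 0%N.
Proof.
move=> l0; rewrite (_ : l + 3%:R = l + 1 + 1 + 1); last by rewrite -!addrA.
have l1 : lev (l + 1) = 1%N by rewrite (lev_add1 hp) l0.
have l2 : lev (l + 1 + 1) = 2%N by rewrite (lev_add1 hp) l1.
split; last by rewrite (lev_add1 hp) l2.
rewrite /spiral turn_Phi // (next_F1 k hn ha) l0 /= turn_Phi // (next_F3 k hn ha) l1
  /=.
by rewrite turn_Phi // (next_F0 k hn ha) l2.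
Qed.

Lemma iter_spiral_Phi1 m : iter m (spiral 2 (-3) 1) (Phi_ k ha 1, 0) =
  (Phi_ k ha 1, (3 * m)%:R : Z).
Proof.
suff [] : iter m (spiral 2 (-3) 1) (Phi_ k ha 1, 0) = (Phi_ k ha 1, (3 * m)%:R : Z) /\
  lev ((3 * m)%:R : Z) = 0%N by [].
rewrite !Phi_pt; elim: m => [|m [IH l0]]; first by rewrite muln0 /lev mod0n.
have [e1 e2] := spiral_Phi1 l0.
by rewrite iterS IH e1 -natrD -mulnSr in e2 *.
Qed.

Lemma level_neq1 l : lev l != 1%N -> l != 1.
Proof. by apply: contraNneq => ->; rewrite (lev1 hp). Qed.

Definition all_signs : {ffun 'I_n -> bool} := [ffun=> true].

(** A level change would need a facet [F_ i'], hence trivial [s] and constant signs; with all signs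
    positive the flag would be white. *)
Lemma turn_generic i j s y l : 0 < `|i| <= 3 -> lev l != 1%N ->
    ~~ white ((s, y, 0) : flag k ha) -> (s, y) != (1%g, all_signs) ->
  turn j (pt s y i, l) = (pt s y (i + j), l).
Proof.
move=> /andP[i0 i3] l1 nw ne.
have nH : ~~ in_H hn (tc (i *: h_shift s y)) l.
  by rewrite negb_and orbC level_neq1.
rewrite turn_pt //; last first.
  by apply: (axis_h_shift hroot (j := i) (y := y) _ l1 nw) => //; rewrite i0.
congr (_, _).
have [[i' /mem013 i'3 e]|-> //] := next_case p (tc (i *: h_shift s y)).
rewrite F_E in e; have i00 : i != 0 by rewrite -normr_gt0.
have [s1 iy] := h_shift_inj hn i3 i'3 e i00.
exfalso; move: nw ne; rewrite s1.
have yE m : y m = y (idx hn 1).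
  have : i * pm (y m) = i * pm (y (idx hn 1)) by rewrite !iy !ffunE.
  by move/(mulfI i00); case: (y m); case: (y _).
have [y1|/negbTE y0] := boolP (y (idx hn 1)).
  by have -> : y = all_signs by [apply/ffunP => m; rewrite yE y1 ffunE]; rewrite eqxx.
have -> : y = no_signs n by apply/ffunP => m; rewrite yE y0 ffunE.
by rewrite whiteE parity0 odd_perm1.
Qed.

Lemma h_shift_all_signs (i : int) :
  tc (i *: h_shift 1 all_signs) = F_ (- i).
Proof.
rewrite F_E; congr (tc _); apply/rowP => m; rewrite !mxE !ffunE /pm expr0 expr1.
by rewrite mulNr mulrN mulNr.
Qed.

Lemma turn_all_signs i j l : `|i| <= 3 ->
  turn j (pt 1%g all_signs i, l) = (pt 1%g all_signs (i + j),
    next_level (F_ (- i)) l).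
Proof.
move=> i3; have i3' : `|- i| <= 3 by rewrite normrN.
by rewrite turn_pt h_shift_all_signs ?(in_H_F k hn ha hp) ?(axis_F hroot) ?perm1.
Qed.

(** Cyclic rotations of the word, so that it can be started at whichever turn is a crossing. *)
Definition rotation (j1 j2 j3 : int) : bool :=
  (j1, j2, j3) \in [:: (2, -3%:Z, 1); (-3%:Z, 1, 2); (1, 2, -3%:Z)].

(** The turns that leave their block: [F_0] does not move levels that are 1 modulo 3. *)
Definition crossing q : bool := (facet q.1 == F_ 0) && (lev q.2 != 1%N).

Lemma next_F0_neq1 l : lev l != 1%N -> lev (next_level (F_ 0) l) != 1%N.
Proof.
rewrite (next_F0 k hn ha) => l1; have := lev_lt l;
  case e : (lev l) l1 => [|[|[|]]] //= _ _.
  by rewrite (lev_sub1 hp) e.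
by rewrite (lev_add1 hp) e.
Qed.

(* The two turns after a crossing fix the flag, so that the third one undoes the
   crossing. The only black flags for which this may fail are the images under
   the shifts of the flag with trivial permutation and all signs -1 (for n odd):
   every turn fixes their orientation, and the level moves among three values. *)
Lemma crossing_period j1 j2 j3 q : rotation j1 j2 j3 -> ~~ white q.1 -> crossing q ->
  iter 6 (spiral j1 j2 j3) q = q.
Proof.
case: q => [[[s y] t] l] rot nw /andP[/eqP t0 l1]; rewrite /facet /= in t0 l1.
have jb : [/\ 0 < `|j1| <= 3, 0 < `|j1 + j2| <= 3 & j1 + j2 + j3 = 0].
  by move: rot; rewrite /rotation !inE => /or3P[] /eqP[-> -> ->].
have [j1b j2b j3b] := jb.
have {t0} -> : (s, y, t) = pt s y 0 by rewrite /pt t0 scale0r torus_class_0 F_0.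
have [e|ne] := eqVneq (s, y) (1%g, all_signs).
  case: e nw => -> -> _.
  have E l' : spiral j1 j2 j3 (pt 1 all_signs 0, l') = (pt 1 all_signs 0,
      next_level (F_ (- (j1 + j2))) (next_level (F_ (- j1)) (next_level (F_ 0) l'))).
    rewrite /spiral turn_all_signs // add0r oppr0 turn_all_signs;
      last by case/andP: j1b.
    by rewrite turn_all_signs ?j3b //; case/andP: j2b.
  pose N l' := next_level (F_ (- (j1 + j2))) (next_level (F_ (- j1)) (next_level (F_
    0) l')).
  have Em m l' : iter m (spiral j1 j2 j3) (pt 1 all_signs 0, l') = (pt 1 all_signs 0,
    iter m N l').
    by elim: m => //= m ->; rewrite E.
  rewrite Em; congr (_, _).
  have lt := lev_lt l; have a1 := lev_add1 hp; have s1 := lev_sub1 hp.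
  (* Besides [F_0], the flags lie over [F_1], over [F_3] or over neither, among the facets that
     change levels. The periods are 3, 3 and 2, whence the exponent 6. *)
  move: rot; rewrite /rotation !inE => /or3P[] /eqP[e1 e2 e3].
  - have NE l' : N l' = next_level (F_ 1) (next_level (F_ 0) l').
      by rewrite /N e1 e2 opprD /= [next_level (F_ (- 2)) _]next_F.
    have N0 l' : lev l' = 0%N -> N l' = l' - 1.
      by move=> e; rewrite NE (next_F0 k hn ha) e (next_F1 k hn ha) s1 e.
    have N1 l' : lev l' = 1%N -> N l' = l' - 1.
      by move=> e; rewrite NE (next_F0 k hn ha) e (next_F1 k hn ha) e.
    have N2 l' : lev l' = 2%N -> N l' = l' + 1 + 1.
      by move=> e; rewrite NE (next_F0 k hn ha) e (next_F1 k hn ha) a1 e.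
    have N3 : iter 3 N l = l.
      rewrite /=; case e : (lev l) l1 lt => [|[|[|]]] //= _ _.
        by rewrite (N0 l) // (N2 (l - 1)) ?s1 ?e // subrK N1 ?a1 ?e // addrK.
      by rewrite (N2 l) // (N1 (l + 1 + 1)) ?a1 ?e // addrK N0 ?a1 ?e // addrK.
    by rewrite (iterD 3 3) !N3.
  - have NE l' : N l' = next_level (F_ 3) (next_level (F_ 0) l').
      by rewrite /N e1 e2 /= [next_level (F_ (- (_ + _))) _]next_F.
    have N0 l' : lev l' = 0%N -> N l' = l' - 1 - 1.
      by move=> e; rewrite NE (next_F0 k hn ha) e (next_F3 k hn ha) s1 e.
    have N1 l' : lev l' = 1%N -> N l' = l' + 1.
      by move=> e; rewrite NE (next_F0 k hn ha) e (next_F3 k hn ha) e.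
    have N2 l' : lev l' = 2%N -> N l' = l' + 1.
      by move=> e; rewrite NE (next_F0 k hn ha) e (next_F3 k hn ha) a1 e.
    have N3 : iter 3 N l = l.
      rewrite /=; case e : (lev l) l1 lt => [|[|[|]]] //= _ _.
        by rewrite (N0 l) // (N1 (l - 1 - 1)) ?s1 ?e // subrK N2 ?s1 ?e // subrK.
      by rewrite (N2 l) // (N0 (l + 1)) ?a1 ?e // addrK N1 ?s1 ?e // subrK.
    by rewrite (iterD 3 3) !N3.
  - have NE l' : N l' = next_level (F_ 0) l'.
      by rewrite /N e1 e2 [next_level (F_ (- 1)) _]next_F // next_F.
    have N2 l' : iter 2 N l' = l' by rewrite /= !NE next_levelK.
    by rewrite (iterD 2 4) (iterD 2 2) !N2.
(* Over [F_0] the axis is the first coordinate, which need not be the first direction of the flag: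
   the crossing changes the signs by the involution [y']. *)
pose y' z := flip (flip z (idx hn 1)) (s (idx hn 1)).
have E z l' : lev l' != 1%N -> ~~ white ((s, z, 0) : flag k ha) ->
  (s, z) != (1%g, all_signs) ->
    [/\ spiral j1 j2 j3 (pt s z 0, l') = (pt s (y' z) 0, next_level (F_ 0) l'),
        lev (next_level (F_ 0) l') != 1%N, ~~ white ((s, y' z, 0) : flag k ha)
      & (s, y' z) != (1%g, all_signs)].
  move=> l'1 nw' ne'; have nl := next_F0_neq1 l'1.
  have nwy : ~~ white ((s, y' z, 0) : flag k ha).
    by move: nw'; rewrite /y' !whiteE !parity_flip !negbK.
  have ney : (s, y' z) != (1%g, all_signs).
    apply: contra ne' => /eqP[s1 yz]; apply/eqP; congr (_, _) => //.
    by rewrite -yz /y' s1 perm1 flipK.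
  split=> //; rewrite /spiral.
  have -> : turn j1 (pt s z 0, l') = (pt s (y' z) j1, next_level (F_ 0) l').
    have -> : pt s z 0 = (s, z, F_ 0) by rewrite /pt scale0r torus_class_0 F_0.
    by rewrite turnE ?(in_H_F k hn ha hp) // (axis_F hroot) // F_0 add0r.
  by rewrite turn_generic // turn_generic // j3b.
have y'K z : y' (y' z) = z.
  rewrite /y'; apply/ffunP => m; rewrite !ffunE.
  by case: (z m); case: (m == _); case: (m == _).
have nw0 : ~~ white ((s, y, 0) : flag k ha) by move: nw; rewrite !whiteE.
have S2 : iter 2 (spiral j1 j2 j3) (pt s y 0, l) = (pt s y 0, l).
  have [/= -> l2 nw2 ne2] := E y l l1 nw0 ne.
  by have [-> _ _ _] := E _ _ l2 nw2 ne2; rewrite y'K next_levelK.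
by rewrite (iterD 2 4) (iterD 2 2) !S2.
Qed.

Lemma white_turn j q : white (turn j q).1 = white q.1.
Proof.
have W j' q' : white (shift j' q').1 = white q'.1.
  case: q' => [[[s x] t] l].
  have -> : (shift j' ((s, x, t), l)).1 = perm_zpow (h k ha) j' (s, x, t) by [].
  by rewrite h_powE !whiteE.
by rewrite W !(white_ext_adj hroot) negbK.
Qed.

Lemma block_add1 l : lev l != 2%N -> ((l + 1)%R %/ 3 = l %/ 3)%N.
Proof.
rewrite /lev (level_add1 hp) => l2.
have lt := leq_trans (ltn_ord l) (eq_leq (Zp_cast (Z_gt1 hp))).
move: (nat_of_ord l) l2 lt => m m2 lt; rewrite modn_small; first by lia.
by move: m2; lia.
Qed.

Lemma block_sub1 l : lev l != 0%N -> ((l - 1)%R %/ 3 = l %/ 3)%N.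
Proof.
move=> l0; rewrite -[in RHS](subrK 1 l) block_add1 // (lev_sub1 hp).
by have := lev_lt l; case: (lev l) l0 => [|[|[|]]].
Qed.

Lemma block_turn j q : ~~ crossing q -> ((turn j q).2 %/ 3 = q.2 %/ 3)%N.
Proof.
case: q => Phi l; rewrite /crossing negb_and negbK => nc.
have {}nc : (facet Phi != F_ 0) || (lev l == 1%N) := nc.
have -> : (turn j (Phi, l)).2 = next_level (facet Phi) l.
  by rewrite /turn /shift /ext_adj leq0n ltnn.
have [[i im e]|-> //] := next_case p (facet Phi).
move: im nc; rewrite e !inE => /or3P[] /eqP ->.
- by rewrite eqxx /= (next_F0 k hn ha) => /eqP ->.
- rewrite (next_F1 k hn ha) => _; have := lev_lt l.
  by case E : (lev l) => [|[|[|]]] //= _; rewrite ?block_add1 ?block_sub1 ?E.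
- rewrite (next_F3 k hn ha) => _; have := lev_lt l.
  by case E : (lev l) => [|[|[|]]] //= _; rewrite ?block_add1 ?block_sub1 ?E.
Qed.

Local Notation W := (spiral 2 (-3) 1).

Lemma spiral_inj j1 j2 j3 : injective (spiral j1 j2 j3).
Proof. by move=> q q' /turn_inj/turn_inj/turn_inj. Qed.

Lemma white_spiral j1 j2 j3 q : white (spiral j1 j2 j3 q).1 = white q.1.
Proof. by rewrite /spiral !white_turn. Qed.

Definition meets_crossing q : bool :=
  [|| crossing q, crossing (turn 2 q) | crossing (turn (-3) (turn 2 q))].

Lemma iter_conj (T U : Type) (f : T -> T) (g : U -> U) (u : T -> U) m z :
  (forall z', u (f z') = g (u z')) -> u (iter m f z) = iter m g (u z).
Proof. by move=> ufg; elim: m => //= m <-. Qed.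

(** Turns are injective and conjugate the word to its rotations. *)
Lemma meets_crossing_period q : ~~ white q.1 -> meets_crossing q -> iter 6 W q = q.
Proof.
move=> nw /or3P[] c.
- exact: crossing_period c.
- apply: (@turn_inj 2).
  rewrite (@iter_conj _ _ _ (spiral (-3) 1 2)) //.
  by apply: crossing_period c; rewrite ?white_turn.
- apply: (@turn_inj 2); apply: (@turn_inj (-3)).
  rewrite (@iter_conj _ _ _ (spiral 1 2 (-3)) (fun q => turn (-3) (turn 2 q))) //.
  by apply: crossing_period c; rewrite ?white_turn.
Qed.

Hypothesis p_big : (3 * #|{: white_flag k ha}| < p)%N.

Lemma p_gt6 : (6 < p)%N.
Proof.
suff : (1 < #|{: white_flag k ha}|)%N by have := p_big; lia.
have w0 : white (base_flag k ha) by rewrite /base_flag whiteE parity0 odd_perm1.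
have w1 : white (rr 0 (rr 1 (base_flag k ha))) by rewrite !white_r w0.
apply/card_gt1P; exists (exist (fun P => white P) _ w0), (exist (fun P =>
  white P) _ w1).
split=> //; rewrite -val_eqE /= /r /= hn.
by apply/eqP => /(congr1 (fun P : flag k ha => P.1.2))/ffunP/(_ _)/esym;
  rewrite /= => E;
  have := E ((tperm (idx hn 1) (idx hn 2) * 1)%g (idx hn 1)); rewrite !ffunE eqxx.
Qed.

Lemma white_iter m q : white (iter m W q).1 = white q.1.
Proof. by elim: m => // m IH; rewrite iterS white_spiral. Qed.

Lemma black_orbit q : ~~ white q.1 -> exists2 m, (0 < m < p)%N & iter m W q = q.
Proof.
move=> nw; have Winj := @spiral_inj 2 (-3) 1.
have [/existsP[q' /andP[/iter_findex <- c]]|none] :=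
    boolP [exists q', fconnect W q q' && meets_crossing q'].
  exists 6; first exact: p_gt6.
  move: c; set m := findex _ _ _ => c.
  have inj : injective (iter m W) by elim: (m) => //= i IH ? ? /Winj/IH.
  apply: (inj); rewrite -iterD addnC iterD; apply: meets_crossing_period c.
  by rewrite white_iter.
have nc q' : fconnect W q q' -> ~~ meets_crossing q'.
  by move=> qq'; apply: contra none => c; apply/existsP; exists q'; rewrite qq'.
exists (fingraph.order W q); last exact: fingraph.iter_order.
rewrite fingraph.order_gt0 /=; apply: leq_ltn_trans p_big.
have blk q' : fconnect W q q' -> ~~ white q'.1 /\ (q'.2 %/ 3 = q.2 %/ 3)%N.
  move/iter_findex <-; rewrite white_iter; split=> //.
  elim: (findex _ _ _) => // m IH.
  have := nc _ (fconnect_iter W m q); rewrite !negb_or => /and3P[c1 c2 c3].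
  by rewrite iterS /spiral !block_turn.
have w0 : white (base_flag k ha) by rewrite /base_flag whiteE parity0 odd_perm1.
pose u0 : white_flag k ha := exist (fun P => white P) _ w0.
(* Within one block, the flag and the level modulo 3 determine the point. The default [u0] never
   occurs on the orbit, where [rr 0] yields white flags. *)
pose f q' := (insubd u0 (rr 0 q'.1) : white_flag k ha, Ordinal (lev_lt q'.2)).
rewrite /fingraph.order -(@card_in_imset _ _ f) =>
  [|q1 q2 /blk[nw1 b1] /blk[nw2 b2] [e1 e2]].
  by rewrite (leq_trans (max_card _)) // card_prod card_ord mulnC.
have v q' : ~~ white q'.1 -> val (insubd u0 (rr 0 q'.1)) = rr 0 q'.1.
  by move=> nw'; rewrite val_insubd white_r nw'.
have E1 : q1.1 = q2.1.
  by apply: (inv_inj (@rK n k a hn ha 0)); rewrite -(v _ nw1) -(v _ nw2) e1.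
have E2 : q1.2 = q2.2.
  apply: val_inj => /=; rewrite (divn_eq q1.2 3) (divn_eq q2.2 3) b1 b2.
  by congr (_ + _)%N.
by rewrite [q1]surjective_pairing [q2]surjective_pairing E1 E2.
Qed.

Lemma black_period q : ~~ white q.1 -> iter (p.-1)`! W q = q.
Proof.
move=> nw; have [m /andP[m0 mp] e] := black_orbit nw.
have /dvdnP[c ->] : (m %| (p.-1)`!)%N by rewrite dvdn_fact // m0; lia.
by elim: c => // c IH; rewrite (mulSn c m) iterD IH.
Qed.

(** The level reached is [3 * (p - 1)!], and [p] does not divide [(p - 1)!] by Wilson's theorem. *)
Lemma white_period : iter (p.-1)`! W (Phi_ k ha 1, 0) != (Phi_ k ha 1, 0).
Proof.
rewrite iter_spiral_Phi1 xpair_eqE eqxx /=; apply/eqP => /(congr1 val) /=.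
rewrite (val_Zp_nat (Z_gt1 hp)) => /eqP; rewrite -/(dvdn _ _) dvdn_pmul2l // => pd.
have : (p %| 1)%N.
  by rewrite -(dvdn_addr 1 pd) addn1 -Wilson // prime_gt1.
by rewrite dvdn1 => /eqP p1; have := prime_gt1 hp; rewrite p1.
Qed.

Lemma spiral_word : exists2 w, all (fun i => (i < n.+2)%N) w &
  forall q, foldr eadj q w = W q.
Proof.
have word j : exists2 w, all (fun i => (i < n.+2)%N) w &
    forall q, foldr eadj q w = turn j q.
  have [w aw wE] := h_pow_word k hn ha j.
  exists (w ++ [:: 0; n.+1])%N => [|q].
    by rewrite all_cat /= ltnSn /= andbT; apply: sub_all aw => i /ltnW.
  by rewrite foldr_cat foldr_ext_adj // wE.
have [w1 a1 e1] := word 2; have [w2 a2 e2] := word (-3); have [w3 a3 e3] := word 1.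
exists (w3 ++ w2 ++ w1) => [|q]; first by rewrite !all_cat a1 a2 a3.
by rewrite !foldr_cat e1 e2 e3.
Qed.

End Spiral.

(** * Absence of reflections and the action of the group *)

Section Assembly.
Variables (n k a p : nat) (hn : (1 < n)%N) (ha : (6 * n + 1 <= a)%N).
Variables (hp : prime p) (root : torus k ha -> 'Z_(3 * p)%N -> flag k ha).
Hypothesis hroot : is_root_choice hn root.
Local Notation S := (ext_system hp hroot).
Local Notation X := (xflag hp hroot).
Local Notation adjS := (@xadj n k a p hn ha hp root hroot).
Local Notation ev := (@eval n k a p hn ha hp root hroot).
Local Notation xi := (xi hp hroot).
Local Notation G := (Gamma xi).
Local Notation x0 := ((1%g, false) : X).

(** Such an [f] is an involution commuting with the word [om]. As [f x0] evaluates to black flags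
    only, [(p - 1)!] rounds of [om] fix it, hence also [x0], which the evaluation at [Phi_1]
    refutes. *)
Lemma no_reflection (f : S -> S) : (3 * #|{: white_flag k ha}| < p)%N ->
  commutes_adj f -> f x0 <> adjS 0 x0.
Proof.
move=> p_big fC0 f0.
have fC (i : nat) (x : X) : (i < n.+2)%N -> f (adjS i x) = adjS i (f x) := fC0 i x.
have ff x : f (f x) = x.
  have L : linked n.+2 adjS predT x0 x := fs_conn (f := S) x0 x.
  move: x L; apply: (@linked_ind _ _ _ (fun x => f (f x) = x)) => [|z i i_n _ e].
    by rewrite f0 (fC 0%N) // f0; apply: xadjK.
  by rewrite !(fC i) // e.
have [w aw wE] := spiral_word hn root.
pose om (x : X) : X := foldr adjS x w.
have fom m x : f (iter m om x) = iter m om (f x).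
  apply: iter_conj => y; rewrite /om; elim: w aw {wE om} => //= i w IH /andP[i_n aw].
  by rewrite (fC i) // IH.
have ev_om m z x : ev z (iter m om x) = iter m (spiral hn root 2 (-3) 1) (ev z x).
  apply: (iter_conj (u := ev z)) => y; rewrite -wE /om;
    elim: w aw {wE om fom} => //= i w IH /andP[i_n aw].
  by rewrite eval_xadj // IH.
have per1 : iter (p.-1)`! om (f x0) = f x0.
  apply: eval_faithful => z; rewrite ev_om; apply: black_period => //.
  by rewrite white_eval f0.
have per0 : iter (p.-1)`! om x0 = x0 by rewrite -[LHS]ff fom per1 ff.
have [z ez] : exists z, ev z x0 = (Phi_ k ha 1, 0).
  by apply: eval_surj; rewrite Phi_E whiteE parity0 odd_perm1.
by have := white_period hp hroot; rewrite -ez -ev_om per0 eqxx.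
Qed.

Definition xact (g : {perm ext_flag k ha p}) (x : X) : X := ((subg G g * x.1)%g, x.2).

Lemma subgM (g h : {perm ext_flag k ha p}) : g \in G -> h \in G ->
  subg G (g * h) = (subg G g * subg G h)%g.
Proof. by move=> gG hG; apply: val_inj; rewrite /= !subgE ?groupM. Qed.

Lemma subg1 : subg G 1 = 1%g.
Proof. by apply: val_inj; rewrite /= subgE ?group1. Qed.

Lemma xact1 x : xact 1%g x = x.
Proof. by case: x => g b; rewrite /xact subg1 mul1g. Qed.

Lemma xactM : {in G &, forall g h x, xact (g * h)%g x = xact g (xact h x)}.
Proof. by move=> g h gG hG x; rewrite /xact /= subgM // mulgA. Qed.

Lemma xactC : {in G, forall g, commutes_adj (S := S) (xact g)}.
Proof. by move=> g _ i x _; apply/esym/xadj_mull. Qed.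

Lemma xact_free : {in G &, forall g h, xact g x0 = xact h x0 -> g = h}.
Proof.
by move=> g h gG hG /(congr1 fst)/=; rewrite !mulg1 => /(congr1 sgval);
  rewrite !subgE.
Qed.

Lemma xact_trans (x : X) : x.2 = x0.2 -> exists2 g, g \in G & x = xact g x0.
Proof.
case: x => g b /= ->; exists (sgval g); first exact: subgP.
by rewrite /xact /= sgvalK mulg1.
Qed.

Lemma varsigma_xi i : (1 <= i)%N -> varsigma xi i = (xi i * (xi i.-1)^-1)%g.
Proof. by rewrite /varsigma; case: i => [|[|i]] //= _; rewrite xi0 invg1 mulg1. Qed.

Lemma varsigma_in i : (1 <= i <= n.+1)%N -> varsigma xi i \in G.
Proof.
by case/andP=> i0 i_n; rewrite varsigma_xi // groupM ?groupV ?xi_in //; lia.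
Qed.

Lemma xact_varsigma i : (1 <= i <= n.+1)%N ->
  xact (varsigma xi i) x0 = adjS i.-1 (adjS i x0).
Proof.
move=> ib; have [i0 i_n] := andP ib; rewrite /xact /xadj /= mulg1 mul1g; congr (_, _).
apply: val_inj; have i1 : (i.-1 <= n.+1)%N by lia.
by rewrite /= !subgE ?xi_in ?varsigma_in // varsigma_xi.
Qed.

End Assembly.

Theorem theorem6p23 (n k a p : nat) (hn : (1 < n)%N)
    (hk : k \in [:: 1; 2; n]%N)
    (ha : (6 * n + 1 <= a)%N)
    (hp : prime p) (hpw : (3 * #|{: white_flag k ha}| < p)%N)
    (root : torus k ha -> 'Z_(3 * p)%N -> flag k ha)
    (hroot : is_root_choice hn root) :
  exists xi : nat -> {perm ext_flag k ha p},
    is_xi hn root xi /\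
    exists (disp : Order.disp_t) (P : finTBPOrderType disp) (Psi : {set P})
           (phi : {perm ext_flag k ha p} -> {perm P}),
      [/\ chiral P n.+2,
          is_flag Psi,
          isom_from_left (Gamma xi) phi,
          (forall i, (1 <= i <= n.+1)%N ->
             is_abstract_rotation Psi i (phi (varsigma xi i)))
        & (forall F : P, is_facet n.+2 F ->
             face_isomorphic (toroid k ha : finPOrderType _) F)].
Proof.
exists (xi hp hroot); split; first exact: is_xi_xi.
pose S := ext_system hp hroot.
pose x0 : S := (1%g, false).
have act1 := @xact1 n k a p hn ha hp root hroot.
have actM := @xactM n k a p hn ha hp root hroot.
have actC := @xactC n k a p hn ha hp root hroot.
pose phi := face_aut (S := S) act1 actM actC.
have adj_col i (x : S) : (i < n.+2)%N -> (fs_adj i x).2 = ~~ x.2.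
  by case: x => g [].
have act_trans := @xact_trans n k a p hn ha hp root hroot.
have no_refl f := @no_reflection n k a p hn ha hp root hroot f hpw.
exists _, (face S : finTBPOrderType _), (mk_flag x0), phi; split.
- exact: (faces_chiral (S := S) (col := snd) isT act1 actM actC adj_col act_trans
  no_refl).
- by apply/is_flagP; exists x0.
- split=> [f g fG gG||]; first exact: face_autM.
    by apply: face_aut_in_inj; apply: xact_free.
  exact: (face_aut_surj (S := S) (col := snd) isT act1 actM actC adj_col act_trans
    no_refl).
- move=> i ib; have vG := varsigma_in hp hroot ib; split; first exact: face_aut_aut.
  have [i1 i2] : (i < n.+2)%N /\ (i.-1 < n.+2)%N by lia.
  rewrite face_aut_flag // !adj_mk_flag //; congr mk_flag.
  exact: xact_varsigma.
- exact: facets_toroid.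
Qed.
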